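(* Let $n\ge 1$ and let $\varphi\in\mathcal{S}(\mathbb{B}^n)$. Then there is a sequence $\{\varphi_k\}_k\subseteq\mathcal{E}(\mathbb{B}^n)$ such that $\lim_{k\to\infty}\varphi_k=\varphi$ uniformly on compact subsets of $\mathbb{B}^n$. Furthermore, $$\lim_{k\to\infty}\int_{\mathbb{S}^n}\varphi_k f\,d\sigma=\int_{\mathbb{S}^n}\varphi f\,d\sigma\qquad\text{for all } f\in L^1(\mathbb{S}^n).$$
   Context: $\mathbb{B}^n$ is the open unit ball of $\mathbb{C}^n$, $\mathbb{D}=\mathbb{B}^1$, $\mathbb{S}^n=\partial\mathbb{B}^n$ is the unit sphere in $\mathbb{C}^n$, $\sigma$ is the normalized surface measure on $\mathbb{S}^n$. $H^\infty(\mathbb{B}^n)$ is the algebra of bounded analytic functions on $\mathbb{B}^n$ with the supremum norm $\|\cdot\|_\infty$, and $\mathcal{S}(\mathbb{B}^n)=\{\varphi\in H^\infty(\mathbb{B}^n):\|\varphi\|_\infty\le 1\}$. In integrals over $\mathbb{S}^n$, a function in $H^\infty(\mathbb{B}^n)$ is identified with its boundary function (its $K$-limits, which exist $\sigma$-a.e. and agree with the radial limits $\lim_{r\to1}\varphi(r\zeta)$ a.e.). Interpolation data are a pair $(\mathcal{Z},\mathcal{W})$ with $\mathcal{Z}=\{z_i\}_{i=1}^m$ distinct points of $\mathbb{B}^n$ and $\mathcal{W}=\{w_i\}_{i=1}^m$ scalars in $\mathbb{D}$ (not necessarily distinct). A function $\varphi\in\mathcal{S}(\mathbb{B}^n)$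 interpolates the data if $\varphi(z_i)=w_i$ for all $i$. The data solve the extremal problem if at least one $\varphi\in\mathcal{S}(\mathbb{B}^n)$ interpolates them and every $\varphi\in\mathcal{S}(\mathbb{B}^n)$ interpolating them satisfies $\|\varphi\|_\infty=1$. $\mathcal{E}(\mathbb{B}^n)$ is the set of all $\varphi\in\mathcal{S}(\mathbb{B}^n)$ that interpolate some interpolation data (with any finite number of nodes) which solve the extremal problem. *)

(* Defs.v *)
From HB Require Import structures.
From mathcomp Require Import all_boot all_order all_algebra.
From mathcomp Require Import all_classical all_reals all_analysis measurable_realfun.
Import Order.TTheory GRing.Theory Num.Theory.
Import numFieldNormedType.Exports.
From mathcomp Require Import complex.
Set Implicit Arguments.
Unset Strict Implicit.
Unset Printing Implicit Defensive.
Local Open Scope classical_set_scope.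
Local Open Scope ring_scope.
Local Open Scope complex_scope.

(* R[i] as a normed space over itself, as the library does for the real
   structures. The norm `|z| of R[i] takes values in R[i]; the real modulus is
   [cmod z : R]. *)
HB.instance Definition _ (R : realType) :=
  GRing.ComAlgebra.copy R[i] (R[i] : numFieldType)^o.
HB.instance Definition _ (R : realType) :=
  PseudoPointedMetric.copy R[i] (R[i] : numFieldType)^o.
HB.instance Definition _ (R : realType) :=
  NormedModule.copy R[i] (R[i] : numFieldType)^o.

Notation cmod := (@ComplexField.Normc.normc _).

Section measurable_complex.
Variable R : realType.

(* Generated by the real and imaginary parts: the Borel sigma-algebra of C. *)
HB.instance Definition _ :=
  @isMeasurable.Build
    (measure_prod_display (default_measure_display, default_measure_display))
    R[i] (g_sigma_preimageU (@Re R : _ -> R) (@Im R : _ -> R))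
    (@sigma_algebra0 _ _ _) (@sigma_algebraC _ _)
    (@sigma_algebra_bigcup _ _ _).

Lemma measurable_Re : measurable_fun [set: R[i]] (@Re R).
Proof. by move=> _ A mA; apply: sub_sigma_algebra; left; exists A. Qed.

Lemma measurable_Im : measurable_fun [set: R[i]] (@Im R).
Proof. by move=> _ A mA; apply: sub_sigma_algebra; right; exists A. Qed.

Lemma measurable_fun_complexP d (T : measurableType d) (h : T -> R[i]) :
  measurable_fun setT h <->
  measurable_fun setT (@Re R \o h) /\ measurable_fun setT (@Im R \o h).
Proof.
split => [mh|[mf1 mf2]].
  by split; apply: measurableT_comp => //; [exact: measurable_Re|exact: measurable_Im].
move=> _; apply: (@smallest_sub _ _ _ [set A | measurable (setT `&` h @^-1` A)]).
  split => [|A|F] /=.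
  - by rewrite preimage_set0 setI0.
  - by rewrite setTD -preimage_setC !setTI => /measurableC.
  - by move=> mF; rewrite setTI preimage_bigcup; apply: bigcupT_measurable => i;
      rewrite -[X in measurable X]setTI.
move=> A [] [B mB <-]; rewrite setTI /=.
- exact: mf1.
- exact: mf2.
Qed.

Lemma measurable_cmod : measurable_fun [set: R[i]] (cmod : R[i] -> R).
Proof.
rewrite (_ : (cmod : R[i] -> R) = fun z : R[i] => (Re z ^+ 2 + Im z ^+ 2) `^ (2^-1)); last first.
  by apply/funext => -[a b] /=; rewrite powR12_sqrt// addr_ge0// sqr_ge0.
apply: (measurableT_comp (measurable_powR _)); apply: measurable_funD; apply: measurable_funX.
- exact: measurable_Re.
- exact: measurable_Im.
Qed.

End measurable_complex.

Section measurable_row.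
Variables (R : realType) (n : nat).

Let coor (i : 'I_n) (v : 'rV[R[i]]_n) : R[i] := v 0 i.

(* Generated by the coordinates: the Borel sigma-algebra of C^n. *)
HB.instance Definition _ :=
  @isMeasurable.Build
    (measure_tuple_display
      (measure_prod_display (default_measure_display, default_measure_display)))
    'rV[R[i]]_n (g_sigma_preimage coor)
    (@sigma_algebra0 _ _ _) (@sigma_algebraC _ _)
    (@sigma_algebra_bigcup _ _ _).

Lemma measurable_coor (i : 'I_n) :
  measurable_fun [set: 'rV[R[i]]_n] (fun v : 'rV[R[i]]_n => v 0 i).
Proof.
move=> _ Y mY; rewrite setTI; apply: sub_sigma_algebra => /=.
rewrite -bigcup_seq/=; exists i => /=; first by rewrite mem_index_enum.
by exists Y => //; rewrite setTI.
Qed.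

Lemma measurable_fun_rowP d (T : measurableType d) (h : T -> 'rV[R[i]]_n) :
  measurable_fun setT h <->
  forall i, measurable_fun setT (fun x => h x 0 i).
Proof.
split=> [mh i|mf].
  exact: (measurableT_comp (measurable_coor i) mh).
move=> _; apply: (@smallest_sub _ _ _ [set A | measurable (setT `&` h @^-1` A)]).
  split => [|A|F] /=.
  - by rewrite preimage_set0 setI0.
  - by rewrite setTD -preimage_setC !setTI => /measurableC.
  - by move=> mF; rewrite setTI preimage_bigcup; apply: bigcupT_measurable => i;
      rewrite -[X in measurable X]setTI.
move=> A; rewrite -bigcup_seq /= => -[i _] [B mB <-]; rewrite setTI /=.
exact: mf.
Qed.

End measurable_row.

(* The image of a product measure under a measurable isomorphism. *)
Section product_image.
Context d1 d2 d3 (T1 : measurableType d1) (T2 : measurableType d2)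
  (T3 : measurableType d3) (R : realType).
Variables (m1 : {sigma_finite_measure set T1 -> \bar R})
  (m2 : {sigma_finite_measure set T2 -> \bar R}).
Variables (f : T1 * T2 -> T3) (g : T3 -> T1 * T2).
Hypotheses (mf : measurable_fun setT f) (mg : measurable_fun setT g).
Hypothesis fK : cancel f g.

Let pf : set T3 -> \bar R := pushforward (m1 \x m2)%E f.

Let pf0 : pf set0 = 0%E. Proof. exact: measure0. Qed.

Let pf_ge0 A : (0 <= pf A)%E. Proof. exact: measure_ge0. Qed.

Let pf_sigma_additive : semi_sigma_additive pf.
Proof. exact: measure_semi_sigma_additive. Qed.

HB.instance Definition _ := isMeasure.Build _ _ _ pf
  pf0 pf_ge0 pf_sigma_additive.

Let pf_sigma_finite : sigma_finite setT pf.
Proof.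
have /sigma_finiteP[F [TF ndF Foo]] := sigma_finiteT m1.
have /sigma_finiteP[G [TG ndG Goo]] := sigma_finiteT m2.
exists (fun n => g @^-1` (F n `*` G n)).
  rewrite -preimage_bigcup; apply/seteqP; split=> // z _ /=.
  have [n _ Fn] : (\bigcup_i F i) (g z).1 by rewrite -TF.
  have [k _ Gk] : (\bigcup_i G i) (g z).2 by rewrite -TG.
  exists (maxn n k) => //; split.
  - by move: Fn; exact/subsetPset/ndF/leq_maxl.
  - by move: Gk; exact/subsetPset/ndG/leq_maxr.
move=> k; have [? ?] := Foo k; have [? ?] := Goo k; split.
  by rewrite -[X in measurable X]setTI; apply: mg => //; exact: measurableX.
rewrite /pf /pushforward -comp_preimage.
rewrite (_ : g \o f = id); last by apply/funext => x /=; exact: fK.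
by rewrite preimage_id product_measure1E// lte_mul_pinfty// ge0_fin_numE.
Qed.

HB.instance Definition _ := Measure_isSigmaFinite.Build _ _ _ pf pf_sigma_finite.

Definition product_image : {sigma_finite_measure set T3 -> \bar R} := pf.

End product_image.

Section lebesgue_complex.
Variable R : realType.
Local Notation RM := (measurableTypeR R).

Let of_pair (p : RM * RM) : R[i] := p.1 +i* p.2.
Let to_pair (z : R[i]) : RM * RM := (Re z, Im z).

Let measurable_of_pair : measurable_fun setT of_pair.
Proof.
apply/measurable_fun_complexP; split.
- exact: measurable_fst.
- exact: measurable_snd.
Qed.

Let measurable_to_pair : measurable_fun setT to_pair.
Proof.
apply/measurable_fun_pairP; split.
- exact: measurable_Re.
- exact: measurable_Im.
Qed.

Let of_pairK : cancel of_pair to_pair. Proof. by case. Qed.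

Definition lebesgue_C : {sigma_finite_measure set R[i] -> \bar R} :=
  product_image lebesgue_measure lebesgue_measure
    measurable_of_pair measurable_to_pair of_pairK.

End lebesgue_complex.

Section lebesgue_row.
Variable R : realType.

Let cons_row n (p : R[i] * 'rV[R[i]]_n) : 'rV[R[i]]_n.+1 :=
  \row_j oapp (p.2 0) p.1 (unlift ord0 j).
Let uncons_row n (v : 'rV[R[i]]_n.+1) : R[i] * 'rV[R[i]]_n :=
  (v 0 ord0, \row_j v 0 (lift ord0 j)).

Let measurable_cons_row n : measurable_fun setT (@cons_row n).
Proof.
apply/measurable_fun_rowP => i.
under eq_fun do rewrite mxE.
case: unliftP => [j _|_] /=; last exact: measurable_fst.
exact: (measurableT_comp (measurable_coor j) measurable_snd).
Qed.

Let measurable_uncons_row n : measurable_fun setT (@uncons_row n).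
Proof.
apply/measurable_fun_pairP; split; first exact: measurable_coor.
apply/measurable_fun_rowP => i /=.
under eq_fun do rewrite mxE.
exact: measurable_coor.
Qed.

Let cons_rowK n : cancel (@cons_row n) (@uncons_row n).
Proof.
move=> [z v]; congr pair; first by rewrite mxE unlift_none.
by apply/rowP => j; rewrite !mxE liftK.
Qed.

Fixpoint lebesgue_Cn n : {sigma_finite_measure set 'rV[R[i]]_n -> \bar R} :=
  if n is n'.+1 then
    product_image (lebesgue_C R) (lebesgue_Cn n')
      (@measurable_cons_row n') (@measurable_uncons_row n') (@cons_rowK n')
  else \d_(0 : 'rV[R[i]]_0).

End lebesgue_row.

Section ball_sphere.
Variables (R : realType) (n : nat).
Implicit Types z : 'rV[R[i]]_n.

Definition enorm z : R := Num.sqrt (\sum_j cmod (z 0 j) ^+ 2).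

Definition unit_ball : set 'rV[R[i]]_n := [set z | enorm z < 1].
Definition unit_sphere : set 'rV[R[i]]_n := [set z | enorm z = 1].

Definition radial_proj z : 'rV[R[i]]_n := ((enorm z)^-1)%:C *: z.

Lemma measurable_enorm : measurable_fun setT enorm.
Proof.
rewrite (_ : enorm = fun z => (\sum_j cmod (z 0 j) ^+ 2) `^ (2^-1)); last first.
  by apply/funext => z; rewrite powR12_sqrt// sumr_ge0// => j _; exact: sqr_ge0.
apply: (measurableT_comp (measurable_powR _)); apply: measurable_sum => j.
apply: measurable_funX.
exact: (measurableT_comp (@measurable_cmod R) (measurable_coor j)).
Qed.

Lemma measurable_unit_ball : measurable unit_ball.
Proof.
rewrite (_ : unit_ball = enorm @^-1` `]-oo, 1[).
  by rewrite -[X in measurable X]setTI; exact: measurable_enorm.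
by apply/seteqP; split => z /=; rewrite in_itv.
Qed.

Lemma measurable_unit_sphere : measurable unit_sphere.
Proof.
by rewrite -[X in measurable X]setTI; exact: (measurable_enorm measurableT (measurable_set1 1)).
Qed.

Lemma measurable_radial_proj : measurable_fun setT radial_proj.
Proof.
apply/measurable_fun_rowP => i.
have mV : measurable_fun setT (fun z => (enorm z)^-1).
  under eq_fun do rewrite -powR_inv1 ?sqrtr_ge0//.
  exact: (measurableT_comp (measurable_powR _) measurable_enorm).
have E z : radial_proj z 0 i =
    ((enorm z)^-1 * Re (z 0 i)) +i* ((enorm z)^-1 * Im (z 0 i)).
  by rewrite mxE; case: (z 0 i) => a b /=; simpc.
under eq_fun do rewrite E.
apply/measurable_fun_complexP; split; apply: measurable_funM => //=.
- exact: (measurableT_comp (@measurable_Re R) (measurable_coor i)).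
- exact: (measurableT_comp (@measurable_Im R) (measurable_coor i)).
Qed.

End ball_sphere.

Section sphere_measure.
Variables (R : realType) (n : nat).
Local Notation Cn := 'rV[R[i]]_n.
Local Notation ball := (@unit_ball R n).
Local Notation vol := (@lebesgue_Cn R n).

(* Surface measure in polar coordinates: sigma(A) is the proportion of the unit
   ball occupied by the cone {z : z / |z| \in A}. The set function is defined on
   subsets of C^n and is carried by the unit sphere (radial_proj 0 = 0 only
   concerns the null set {0}). *)
Definition sphere_measure (A : set Cn) : \bar R :=
  ((fine (vol ball))^-1%:E * vol (ball `&` @radial_proj R n @^-1` A))%E.

Let c_ge0 : 0 <= (fine (vol ball))^-1.
Proof. by rewrite invr_ge0 fine_ge0. Qed.

Let cone_measure : set Cn -> \bar R :=
  pushforward (mrestr vol (@measurable_unit_ball R n)) (@radial_proj R n).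

Let cone0 : cone_measure set0 = 0%E.
Proof. by rewrite /cone_measure /pushforward preimage_set0 measure0. Qed.

Let cone_ge0 A : (0 <= cone_measure A)%E.
Proof. exact: (measure_ge0 (mrestr vol (@measurable_unit_ball R n))). Qed.

Let cone_sigma_additive : semi_sigma_additive cone_measure.
Proof.
by apply: measure_semi_sigma_additive; exact: measurable_radial_proj.
Qed.

HB.instance Definition _ := isMeasure.Build _ _ _ cone_measure
  cone0 cone_ge0 cone_sigma_additive.

Let sphere_measureE : sphere_measure =
  fun A => ((fine (vol ball))^-1%:E * cone_measure A)%E.
Proof.
by apply/funext => A; rewrite /cone_measure /pushforward /mrestr setIC.
Qed.

Let sphere_measure0 : sphere_measure set0 = 0%E.
Proof. by rewrite /sphere_measure preimage_set0 setI0 measure0 mule0. Qed.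

Let sphere_measure_ge0 A : (0 <= sphere_measure A)%E.
Proof. by rewrite mule_ge0// lee_fin. Qed.

Let sphere_measure_sigma_additive : semi_sigma_additive sphere_measure.
Proof.
rewrite sphere_measureE.
exact: (@measure_semi_sigma_additive _ _ _ (mscale (NngNum c_ge0) cone_measure)).
Qed.

HB.instance Definition _ := isMeasure.Build _ _ _ sphere_measure
  sphere_measure0 sphere_measure_ge0 sphere_measure_sigma_additive.

Definition sphere_integral (f : Cn -> R[i]) : R[i] :=
  (\int[sphere_measure]_(z in @unit_sphere R n) Re (f z)) +i*
  (\int[sphere_measure]_(z in @unit_sphere R n) Im (f z)).

Definition L1_sphere : set (Cn -> R[i]) :=
  [set f | measurable_fun (@unit_sphere R n) f /\
    (\int[sphere_measure]_(z in @unit_sphere R n) (cmod (f z))%:E < +oo)%E].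

End sphere_measure.

(* Functions on the ball are total functions on C^n; their values off the ball
   are irrelevant to all the notions below. *)
Section schur_class.
Variables (R : realType) (n : nat).
Local Notation Cn := 'rV[R[i]]_n.
Implicit Types phi : Cn -> R[i].

Definition sup_norm phi : R := sup [set cmod (phi z) | z in @unit_ball R n].

(* [differentiable] is over the field R[i], i.e. complex differentiability. *)
Definition Hinfty : set (Cn -> R[i]) :=
  [set phi | (forall z : Cn, unit_ball z -> differentiable phi z) /\
    has_ubound [set cmod (phi z) | z in @unit_ball R n]].

Definition schur_class : set (Cn -> R[i]) :=
  [set phi | Hinfty phi /\ sup_norm phi <= 1].

(* The radial limit, which agrees with the K-limit almost everywhere; it has a
   default value where the limit does not exist. *)
Definition boundary_fun phi (zeta : Cn) : R[i] :=
  lim (phi (r%:C *: zeta) @[r --> (1 : R)^'-]).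

Section interpolation.
Variables (m : nat) (z : 'I_m -> Cn) (w : 'I_m -> R[i]).

Definition interpolation_data : Prop :=
  [/\ injective z, forall i, unit_ball (z i) & forall i, cmod (w i) < 1].

Definition interpolates phi : Prop := forall i, phi (z i) = w i.

Definition solves_extremal : Prop :=
  (exists2 phi, schur_class phi & interpolates phi) /\
  (forall phi, schur_class phi -> interpolates phi -> sup_norm phi = 1).

End interpolation.

Definition extremal_class : set (Cn -> R[i]) :=
  [set phi | schur_class phi /\
    exists (m : nat) (z : 'I_m -> Cn) (w : 'I_m -> R[i]),
      [/\ interpolation_data z w, solves_extremal z w & interpolates z w phi]].

End schur_class.

(* Main.v *)
(* Approximation by extremal functions. Given finitely many nodes in the ball, add
   a node [e] and choose, among the functions of the Schur class with values
   [eta * phi] at the nodes ([eta < 1]), one maximizing the real part at [e]; it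
   exists by compactness, and it is extremal because otherwise a small multiple of
   a polynomial vanishing at the nodes and equal to 1 at [e] could be added. With
   finer and finer grids of nodes and [eta] tending to 1, the Lipschitz estimate of
   the Schur class turns agreement on the grid into locally uniform convergence.

   Weak-star convergence. On the complex circle through a point [zeta] of the
   sphere, [u w = phi (e^w zeta)] is bounded and holomorphic on the half plane
   [Re w < 0]. Cauchy's theorem on a rectangle bounds the difference of the
   integrals of [u (s + i y)] and [u (t + i y)] over [a <= y <= b] by
   [4 |s - t|], uniformly in [phi], so that locally uniform convergence passes to
   the integrals of the boundary values over intervals, hence, by density, to
   their integrals against functions in [L^1]. Averaging over the circles, by
   rotation invariance of the measure and Fubini's theorem, yields the sphere.

   Fatou's theorem is only needed on these half planes: the [L^2] norms on vertical
   lines are monotone and midpoint convex, hence Cauchy at 0, which gives almost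
   everywhere convergence along a sequence; a Poisson kernel estimate then yields
   the radial limit at every Lebesgue point of the limit. *)

(* Extremal data have values in the open disc, so the value at the added node must stay strictly
   inside it. This is why the prescribed values are first shrunk by [eta], and why the node is put
   so close to 0, itself a node, that the Lipschitz estimate leaves room below 1. [boundary_fun] is
   a pointwise radial limit with a default value, about which convergence inside the ball says
   nothing by itself. Fatou's theorem ties it to the interior, and an interval bound common to the
   whole class lets the limit in [k] be exchanged with the limit in the radius. The exponential
   turns circles into vertical segments and radii into horizontal half lines. Goursat's theorem on
   rectangles, together with periodicity, thus stands in for contour integrals over circles, in the
   derivative estimates as well. Constants are not sharp: complex integrals and increments are
   estimated through real and imaginary parts, which costs a factor 2 each time. *)
From HB Require Import structures.
Require Import Defs.
From mathcomp Require Import all_boot all_order all_algebra.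
From mathcomp Require Import all_classical all_reals all_analysis.
From mathcomp Require Import measurable_realfun ring lra.
Import Order.TTheory GRing.Theory Num.Theory.
Import numFieldNormedType.Exports.
From mathcomp Require Import complex.
Local Open Scope classical_set_scope.
Local Open Scope ring_scope.
Local Open Scope complex_scope.
Set Implicit Arguments.
Unset Strict Implicit.
Unset Printing Implicit Defensive.

(** * Complex derivatives *)

(* [cmod] lands in an instance of the algebraic hierarchy rather than in [R]
   itself, which blocks unification; [cabs] is the same function with codomain [R]. *)
Definition cabs (R : realType) (z : R[i]) : R := ComplexField.Normc.normc z.
Arguments cabs : simpl never.

Section complex_modulus.
Variable R : realType.
Implicit Types (x y z w : R[i]) (r : R).

Lemma cabsE z : cmod z = cabs z. Proof. by []. Qed.

Lemma normc_cabs z : `|z| = (cabs z)%:C. Proof. by []. Qed.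

Lemma cabs_def z : cabs z = Num.sqrt (Re z ^+ 2 + Im z ^+ 2).
Proof. by case: z. Qed.

Lemma cabs_ge0 z : 0 <= cabs z.
Proof. by rewrite cabs_def sqrtr_ge0. Qed.

Lemma cabsN z : cabs (- z) = cabs z.
Proof. exact: normcN. Qed.

Lemma cabsB z w : cabs (z - w) = cabs (w - z).
Proof. by rewrite -cabsN opprB. Qed.

Lemma cabsD z w : cabs (z + w) <= cabs z + cabs w.
Proof. exact: le_normcD. Qed.

Lemma cabsBD z w : cabs (z - w) <= cabs z + cabs w.
Proof. by rewrite -[cabs w]cabsN; exact: cabsD. Qed.

Lemma cabsM z w : cabs (z * w) = cabs z * cabs w.
Proof. exact: ComplexField.Normc.normcM. Qed.

Lemma cabs0 : cabs (0 : R[i]) = 0.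
Proof. exact: ComplexField.Normc.normc0. Qed.

Lemma cabs1 : cabs (1 : R[i]) = 1.
Proof. exact: ComplexField.Normc.normc1. Qed.

Lemma cabsV z : cabs z^-1 = (cabs z)^-1.
Proof. exact: ComplexField.Normc.normcV. Qed.

Lemma cabs_eq0 z : (cabs z == 0) = (z == 0).
Proof.
apply/eqP/eqP => [|->]; last exact: cabs0.
exact: ComplexField.Normc.eq0_normc.
Qed.

Lemma cabs_gt0 z : (0 < cabs z) = (z != 0).
Proof. by rewrite lt_def cabs_ge0 andbT cabs_eq0. Qed.

Lemma cabs_real r : cabs r%:C = `|r|.
Proof. by rewrite cabs_def /= expr0n addr0 sqrtr_sqr. Qed.

Lemma cabs_imag r : cabs (0 +i* r) = `|r|.
Proof. by rewrite cabs_def /= expr0n add0r sqrtr_sqr. Qed.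

Lemma normr_Re z : `|Re z| <= cabs z.
Proof.
by rewrite cabs_def -sqrtr_sqr ler_wsqrtr// lerDl sqr_ge0.
Qed.

Lemma normr_Im z : `|Im z| <= cabs z.
Proof.
by rewrite cabs_def -sqrtr_sqr ler_wsqrtr// lerDr sqr_ge0.
Qed.

Lemma cabs_le_ReIm z : cabs z <= `|Re z| + `|Im z|.
Proof.
case: z => a b /=.
rewrite (_ : a +i* b = a%:C + (0 +i* b)); last by simpc.
by apply: le_trans (cabsD _ _) _; rewrite cabs_real cabs_imag.
Qed.

Lemma cabs_conjc z : cabs (z^*)%C = cabs z.
Proof. by case: z => a b; rewrite !cabs_def /= sqrrN. Qed.

Lemma sqr_cabs z : cabs z ^+ 2 = Re z ^+ 2 + Im z ^+ 2.
Proof. by rewrite cabs_def sqr_sqrtr// addr_ge0// sqr_ge0. Qed.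

Lemma cReD z w : Re (z + w) = Re z + Re w.
Proof. by case: z w => [? ?] [? ?]. Qed.
Lemma cImD z w : Im (z + w) = Im z + Im w.
Proof. by case: z w => [? ?] [? ?]. Qed.
Lemma cReN z : Re (- z) = - Re z. Proof. by case: z. Qed.
Lemma cImN z : Im (- z) = - Im z. Proof. by case: z. Qed.
Lemma cReB z w : Re (z - w) = Re z - Re w. Proof. by rewrite cReD cReN. Qed.
Lemma cImB z w : Im (z - w) = Im z - Im w. Proof. by rewrite cImD cImN. Qed.
Lemma cReM z w : Re (z * w) = Re z * Re w - Im z * Im w.
Proof. by case: z w => [? ?] [? ?]. Qed.
Lemma cImM z w : Im (z * w) = Re z * Im w + Im z * Re w.
Proof. by case: z w => [? ?] [? ?]. Qed.

Lemma complex_eq z w : Re z = Re w -> Im z = Im w -> z = w.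
Proof. by case: z w => [? ?] [? ?] /= -> ->. Qed.

End complex_modulus.

Definition cReImE := (cReB, cImB, cReM, cImM, cReD, cImD, cReN, cImN).

Section cderiv.
Variable R : realType.
Local Notation C := R[i].
Implicit Types (f g : C -> C) (w l h : C).

(** The division-free form includes h = 0 and involves only the real modulus, so products,
    composites and restrictions to lines become direct estimates. *)
Definition cderiv f w l := forall e : R, 0 < e -> exists2 d : R, 0 < d &
  forall h, cabs h < d -> cabs (f (w + h) - f w - l * h) <= e * cabs h.

Lemma cderiv_cst c w : cderiv (fun=> c) w 0.
Proof.
move=> e e0; exists 1 => // h _.
by rewrite subrr mul0r subrr cabs0 mulr_ge0 ?cabs_ge0 1?ltW.
Qed.

Lemma cderiv_id w : cderiv id w 1.
Proof.
move=> e e0; exists 1 => // h _.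
rewrite (_ : _ - _ = 0); last by ring.
by rewrite cabs0 mulr_ge0 ?cabs_ge0 1?ltW.
Qed.

Lemma cderiv_cvg f w l : cderiv f w l -> forall e : R, 0 < e ->
  exists2 d : R, 0 < d & forall h, cabs h < d -> cabs (f (w + h) - f w) <= e.
Proof.
move=> /(_ 1 ltr01)[d d0 H] e e0.
have c0 : 0 < 1 + cabs l by rewrite ltr_wpDr ?cabs_ge0.
exists (Num.min d (e / (1 + cabs l))) => [|h].
  by rewrite lt_min d0 divr_gt0.
rewrite lt_min => /andP[/H{}H]; rewrite ltr_pdivlMr// => he.
rewrite -(subrK (l * h) (f (w + h) - f w)).
apply: le_trans (cabsD _ _) _; rewrite cabsM.
apply: le_trans (ltW he); rewrite mulrDr mulr1 (mulrC (cabs h)).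
by rewrite lerD2r (le_trans H)// mul1r.
Qed.

Lemma cderivD f g w l m :
  cderiv f w l -> cderiv g w m -> cderiv (fun z => f z + g z) w (l + m).
Proof.
move=> Hf Hg e e0; have e2 : 0 < e / 2 by rewrite divr_gt0.
have [d d0 {}Hf] := Hf _ e2; have [d' d'0 {}Hg] := Hg _ e2.
exists (Num.min d d') => [|h]; first by rewrite lt_min d0.
rewrite lt_min => /andP[/Hf {}Hf /Hg {}Hg].
rewrite (_ : _ - _ = (f (w + h) - f w - l * h) + (g (w + h) - g w - m * h)); last by ring.
by apply: le_trans (cabsD _ _) _; rewrite [e](splitr e) mulrDl lerD.
Qed.

Lemma cderivZ c f w l : cderiv f w l -> cderiv (fun z => c * f z) w (c * l).
Proof.
move=> Hf e e0; have c0 : 0 < 1 + cabs c by rewrite ltr_wpDr ?cabs_ge0.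
have [|d d0 {}Hf] := Hf (e / (1 + cabs c)); first by rewrite divr_gt0.
exists d => // h /Hf {}Hf.
rewrite (_ : _ - _ = c * (f (w + h) - f w - l * h)); last by ring.
rewrite cabsM; apply: le_trans (ler_wpM2l (cabs_ge0 _) Hf) _.
rewrite mulrA ler_wpM2r ?cabs_ge0// mulrCA ger_pMr//.
by rewrite ler_pdivrMr// mul1r lerDr.
Qed.

Lemma cderivN f w l : cderiv f w l -> cderiv (fun z => - f z) w (- l).
Proof.
move=> /(@cderivZ (-1)); rewrite mulN1r.
by under eq_fun do rewrite mulN1r.
Qed.

Lemma cderivB f g w l m :
  cderiv f w l -> cderiv g w m -> cderiv (fun z => f z - g z) w (l - m).
Proof. by move=> Hf /cderivN; exact: cderivD. Qed.

Lemma cderivM f g w l m : cderiv f w l -> cderiv g w m ->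
  cderiv (fun z => f z * g z) w (l * g w + f w * m).
Proof.
move=> Hf Hg e e0.
(* The error of the product is a sum of four terms with coefficients |f w|, |g w|, 1 and |l|; [A] is
   their sum. The increment of g is kept below both 1 and [e / 3 / A] to treat the product of the
   increments. *)
pose A := 1 + cabs (f w) + cabs (g w) + cabs l.
have A0 : 0 < A by rewrite /A -!addrA ltr_wpDr// !addr_ge0 ?cabs_ge0.
have e3 : 0 < e / 3 / A by rewrite !divr_gt0.
have e3' : 0 < Num.min 1 (e / 3 / A) by rewrite lt_min ltr01.
have [d1 d10 Cg] := cderiv_cvg Hg e3'.
have [d2 d20 {}Hf] := Hf _ e3; have [d3 d30 {}Hg] := Hg _ e3.
exists (Num.min d1 (Num.min d2 d3)) => [|h]; first by rewrite !lt_min d10 d20.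
rewrite !lt_min => /andP[/Cg + /andP[/Hf {}Hf /Hg {}Hg]].
rewrite le_min => /andP[{}Cg1 {}Cg].
rewrite (_ : _ - _ = f w * (g (w + h) - g w - m * h) +
  (g w * (f (w + h) - f w - l * h) +
   ((f (w + h) - f w - l * h) + l * h) * (g (w + h) - g w))); last by ring.
apply: le_trans (cabsD _ _) _; rewrite cabsM.
apply: (@le_trans _ _ (cabs (f w) * (e / 3 / A * cabs h) +
  (cabs (g w) * (e / 3 / A * cabs h) +
   (e / 3 / A * cabs h * 1 + cabs l * cabs h * (e / 3 / A))))).
  apply: lerD; first by rewrite ler_wpM2l ?cabs_ge0.
  apply: le_trans (cabsD _ _) _; rewrite cabsM.
  apply: lerD; first by rewrite ler_wpM2l ?cabs_ge0.
  rewrite mulrDl; apply: le_trans (cabsD _ _) _; rewrite !cabsM.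
  by apply: lerD; rewrite ?ler_wpM2l ?ler_pM ?mulr_ge0 ?cabs_ge0.
rewrite (_ : _ + _ = A * (e / 3 / A) * cabs h); last by rewrite /A; ring.
rewrite mulrCA divff ?gt_eqF// mulr1 ler_wpM2r ?cabs_ge0//.
by rewrite ler_pdivrMr// ler_peMr ?ler1n// ltW.
Qed.

Lemma cderiv_comp f g w l m : cderiv g w m -> cderiv f (g w) l ->
  cderiv (fun z => f (g z)) w (l * m).
Proof.
move=> Hg Hf e e0.
have lpos : 0 < 1 + cabs l by rewrite ltr_wpDr ?cabs_ge0.
have mpos : 0 < 1 + cabs m by rewrite ltr_wpDr ?cabs_ge0.
have [|d1 d10 {}Hf] := Hf (e / 2 / (1 + cabs m)); first by rewrite !divr_gt0.
have [|d2 d20 Hg2] := Hg (Num.min 1 (e / 2 / (1 + cabs l))).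
  by rewrite lt_min ltr01 !divr_gt0.
have [|d3 d30 Hg3] := cderiv_cvg Hg (e := d1 / 2); first by rewrite divr_gt0.
exists (Num.min d2 d3) => [|h]; first by rewrite lt_min d20.
rewrite lt_min => /andP[/Hg2 {}Hg2 /Hg3 {}Hg3].
have := Hf (g (w + h) - g w).
rewrite [g w + _]addrC subrK => /(_ _)/wrap[].
  by rewrite (le_lt_trans Hg3)// ltr_pdivrMr// ltr_pMr// ltr1n.
move=> {}Hf.
rewrite (_ : _ - _ = (f (g (w + h)) - f (g w) - l * (g (w + h) - g w)) +
   l * (g (w + h) - g w - m * h)); last by ring.
apply: le_trans (cabsD _ _) _; rewrite cabsM [e](splitr e) mulrDl.
have gl : cabs (g (w + h) - g w) <= (1 + cabs m) * cabs h.
  rewrite -(subrK (m * h) (g (w + h) - g w)).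
  apply: le_trans (cabsD _ _) _; rewrite cabsM mulrDl lerD2r.
  by apply: le_trans Hg2 _; rewrite ler_wpM2r ?cabs_ge0// ge_min lexx.
apply: lerD.
  apply: le_trans Hf _; apply: (@le_trans _ _ (e / 2 / (1 + cabs m) * ((1 + cabs m) * cabs h))).
    by rewrite ler_wpM2l// ltW// !divr_gt0.
  by rewrite mulrA divfK ?gt_eqF.
apply: (@le_trans _ _ ((1 + cabs l) * (e / 2 / (1 + cabs l) * cabs h))).
  apply: ler_pM; rewrite ?cabs_ge0 ?lerDr//.
  apply: le_trans Hg2 _; rewrite ler_wpM2r ?cabs_ge0//.
  by rewrite ge_min lexx orbT.
by rewrite mulrA mulrCA divff ?gt_eqF// mulr1.
Qed.

Lemma cderivV w : w != 0 -> cderiv (fun z => z^-1) w (- w ^- 2).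
Proof.
move=> w0 e e0; have W : 0 < cabs w by rewrite cabs_gt0.
(* The error is h^2 / (w^2 (w + h)). The first bound gives |w + h| >= |w| / 2, and the second then
   makes the error at most e |h|. *)
exists (Num.min (cabs w / 2) (e * cabs w ^+ 3 / 2)) => [|h].
  by rewrite lt_min !divr_gt0// mulr_gt0// exprn_gt0.
rewrite lt_min => /andP[h1 h2].
have wh : cabs w / 2 <= cabs (w + h).
  have := cabsBD (w + h) h; rewrite addrK.
  move: h1 => /ltW; lra.
have wh0 : w + h != 0 by rewrite -cabs_gt0 (lt_le_trans _ wh)// divr_gt0.
rewrite (_ : _ - _ = h * h / (w ^+ 2 * (w + h))); last first.
  by field; rewrite w0 wh0.
rewrite !cabsM cabsV !cabsM; have whp : 0 < cabs (w + h) by rewrite cabs_gt0.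
rewrite ler_pdivrMr ?mulr_gt0//.
rewrite mulrAC ler_wpM2r ?cabs_ge0//.
apply: (@le_trans _ _ (e * (cabs w * cabs w * (cabs w / 2)))).
  by move: h2 => /ltW /le_trans; apply; rewrite exprS expr2; lra.
apply: ler_wpM2l; first exact: ltW.
by apply: ler_wpM2l => //; rewrite mulr_ge0 ?cabs_ge0.
Qed.

Lemma cderiv_conj f w l : cderiv f (w^*)%C l ->
  cderiv (fun z => (f (z^*)%C)^*)%C w (l^*)%C.
Proof.
move=> Hf e e0; have [d d0 {}Hf] := Hf _ e0; exists d => // h hd.
have := Hf (h^*)%C; rewrite !cabs_conjc => /(_ hd).
by rewrite -[cabs (_ - _ - _)]cabs_conjc !(rmorphB, rmorphD, rmorphM) /= !conjcK.
Qed.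

End cderiv.

(** * Integrals of complex functions on an interval *)

Section complex_integral.
Variable R : realType.
Local Notation C := R[i].
Local Notation mu := (@lebesgue_measure R).
Implicit Types (g h : R -> C) (a b c d x y M : R).

Definition cintegrable a b g :=
  mu.-integrable `[a, b] (EFin \o (fun x => Re (g x))) /\
  mu.-integrable `[a, b] (EFin \o (fun x => Im (g x))).

Definition ci a b g : C :=
  (\int[mu]_(x in `[a, b]) Re (g x)) +i* (\int[mu]_(x in `[a, b]) Im (g x)).

Lemma cintegrable_sub a b c d g : a <= c -> d <= b ->
  cintegrable a b g -> cintegrable c d g.
Proof.
move=> ac db [Hr Hi]; split.
- apply: integrableS Hr => //; apply: subset_itv; by rewrite bnd_simp.
- apply: integrableS Hi => //; apply: subset_itv; by rewrite bnd_simp.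
Qed.

Lemma itv_measure_lty a b : (mu `[a, b] < +oo)%E.
Proof. by rewrite lebesgue_measure_itv /=; case: ifP => _; rewrite -?EFinB ltry. Qed.

Lemma itv_bounded_integrable a b (f : R -> R) M : measurable_fun `[a, b] f ->
  (forall x, a <= x <= b -> `|f x| <= M) -> mu.-integrable `[a, b] (EFin \o f).
Proof.
move=> mf fM; apply: measurable_bounded_integrable => //.
  exact: itv_measure_lty.
exists M; split; first exact: num_real.
by move=> K MK x /=; rewrite in_itv => /fM /le_trans; apply; exact: ltW.
Qed.

Lemma cintegrable_cst a b (k : C) : cintegrable a b (fun=> k).
Proof.
split.
- by apply: (@itv_bounded_integrable _ _ _ `|Re k|).
- by apply: (@itv_bounded_integrable _ _ _ `|Im k|).
Qed.

Lemma cintegrableD a b g h : cintegrable a b g -> cintegrable a b h ->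
  cintegrable a b (fun x => g x + h x).
Proof.
move=> [gr gi] [hr hi]; split.
- rewrite (_ : EFin \o _ = (EFin \o (fun x => Re (g x))) \+ (EFin \o (fun x => Re (h x))))%E.
    exact: integrableD.
  by apply/funext => x /=; rewrite cReD.
- rewrite (_ : EFin \o _ = (EFin \o (fun x => Im (g x))) \+ (EFin \o (fun x => Im (h x))))%E.
    exact: integrableD.
  by apply/funext => x /=; rewrite cImD.
Qed.

Lemma cintegrableZ a b (k : C) g : cintegrable a b g ->
  cintegrable a b (fun x => k * g x).
Proof.
move=> [gr gi]; split.
- rewrite (_ : EFin \o _ = (fun x => (Re k)%:E * (EFin \o (fun x => Re (g x))) x) \-
    (fun x => (Im k)%:E * (EFin \o (fun x => Im (g x))) x))%E.
    by apply: integrableB => //; exact: integrableZl.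
  by apply/funext => x /=; rewrite cReM.
- rewrite (_ : EFin \o _ = (fun x => (Re k)%:E * (EFin \o (fun x => Im (g x))) x) \+
    (fun x => (Im k)%:E * (EFin \o (fun x => Re (g x))) x))%E.
    by apply: integrableD => //; exact: integrableZl.
  by apply/funext => x /=; rewrite cImM.
Qed.

Lemma cintegrableN a b g : cintegrable a b g -> cintegrable a b (fun x => - g x).
Proof.
move=> /(@cintegrableZ _ _ (-1)).
by under [X in cintegrable _ _ X -> _]eq_fun do rewrite mulN1r.
Qed.

Lemma cintegrableB a b g h : cintegrable a b g -> cintegrable a b h ->
  cintegrable a b (fun x => g x - h x).
Proof. by move=> ? /cintegrableN; exact: cintegrableD. Qed.

Lemma eq_ci a b g h : (forall x, a <= x <= b -> g x = h x) -> ci a b g = ci a b h.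
Proof.
move=> gh; rewrite /ci; congr Complex; apply: eq_Rintegral => x;
  by rewrite inE /= in_itv /= => /gh ->.
Qed.

Lemma ciD a b g h : cintegrable a b g -> cintegrable a b h ->
  ci a b (fun x => g x + h x) = ci a b g + ci a b h.
Proof.
move=> [gr gi] [hr hi]; apply: complex_eq; rewrite /ci /=.
- by rewrite -RintegralD//; apply: eq_Rintegral => x _; rewrite cReD.
- by rewrite -RintegralD//; apply: eq_Rintegral => x _; rewrite cImD.
Qed.

Lemma ciZ a b (k : C) g : cintegrable a b g ->
  ci a b (fun x => k * g x) = k * ci a b g.
Proof.
move=> [gr gi]; apply: complex_eq; rewrite /ci ?cReM ?cImM /=.
- rewrite -!RintegralZl// -RintegralB//; last 2 first.
  + by rewrite (_ : EFin \o _ = (fun x => (Re k)%:E * (EFin \o (fun x => Re (g x))) x)%E)//; exact: integrableZl.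
  + by rewrite (_ : EFin \o _ = (fun x => (Im k)%:E * (EFin \o (fun x => Im (g x))) x)%E)//; exact: integrableZl.
  by apply: eq_Rintegral => x _; rewrite cReM.
- rewrite -!RintegralZl// -RintegralD//; last 2 first.
  + by rewrite (_ : EFin \o _ = (fun x => (Re k)%:E * (EFin \o (fun x => Im (g x))) x)%E)//; exact: integrableZl.
  + by rewrite (_ : EFin \o _ = (fun x => (Im k)%:E * (EFin \o (fun x => Re (g x))) x)%E)//; exact: integrableZl.
  by apply: eq_Rintegral => x _; rewrite cImM.
Qed.

Lemma ciN a b g : cintegrable a b g -> ci a b (fun x => - g x) = - ci a b g.
Proof.
move=> gi; rewrite -[RHS]mulN1r -ciZ//.
by apply: eq_ci => x _; rewrite mulN1r.
Qed.

Lemma ciB a b g h : cintegrable a b g -> cintegrable a b h ->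
  ci a b (fun x => g x - h x) = ci a b g - ci a b h.
Proof.
by move=> gi hi; rewrite ciD ?ciN//; exact: cintegrableN.
Qed.

Lemma ci_cst a b (k : C) : a <= b -> ci a b (fun=> k) = (b - a)%:C * k.
Proof.
move=> ab.
have E : fine (mu `[a, b]) = b - a.
  by rewrite /= lebesgue_measure_itv /= lte_fin; move: ab; rewrite le_eqVlt => /predU1P[->|->]; rewrite ?ltxx ?subrr.
by apply: complex_eq; rewrite /ci ?cReM ?cImM /= Rintegral_cst// ?E ?mul0r ?subr0 ?addr0 mulrC.
Qed.

Lemma Rintegral_split (f : R -> R) a b c : a <= b -> b <= c ->
  mu.-integrable `[a, c] (EFin \o f) ->
  \int[mu]_(x in `[a, c]) f x = \int[mu]_(x in `[a, b]) f x + \int[mu]_(x in `[b, c]) f x.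
Proof.
move=> ab bc fi; rewrite -[LHS](subrK (\int[mu]_(x in `[a, b]) f x)).
rewrite Rintegral_itvB// ?bnd_simp// addrC; congr (_ + _).
rewrite Rintegral_itv_obnd_cbnd//.
apply: integrableS fi => //; apply: subset_itv; by rewrite bnd_simp.
Qed.

Lemma ci_split a b c g : a <= b -> b <= c -> cintegrable a c g ->
  ci a c g = ci a b g + ci b c g.
Proof.
move=> ab bc [gr gi]; rewrite /ci (Rintegral_split ab bc gr) (Rintegral_split ab bc gi).
by [].
Qed.

Lemma Rintegral_le_cst (f : R -> R) a b M : a <= b ->
  mu.-integrable `[a, b] (EFin \o f) ->
  (forall x, a <= x <= b -> `|f x| <= M) ->
  `|\int[mu]_(x in `[a, b]) f x| <= M * (b - a).
Proof.
move=> ab fi fM; apply: le_trans (le_normr_Rintegral _ _) _ => //.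
have E : fine (mu `[a, b]) = b - a.
  by rewrite /= lebesgue_measure_itv /= lte_fin; move: ab; rewrite le_eqVlt => /predU1P[->|->]; rewrite ?ltxx ?subrr.
rewrite -E -Rintegral_cst//; apply: le_Rintegral => //.
- by apply: (integrable_norm fi).
- have [] := cintegrable_cst a b (M%:C); by [].
Qed.

(** The factor 2 comes from bounding the two real integrals separately. *)
Lemma ci_bound a b g M : a <= b -> cintegrable a b g ->
  (forall x, a <= x <= b -> cabs (g x) <= M) -> cabs (ci a b g) <= 2 * M * (b - a).
Proof.
move=> ab [gr gi] gM; apply: le_trans (cabs_le_ReIm _) _.
rewrite (_ : 2 * M * (b - a) = M * (b - a) + M * (b - a)); last by ring.
apply: lerD; rewrite /ci /=; apply: Rintegral_le_cst => // x /gM;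
  apply: le_trans; [exact: normr_Re|exact: normr_Im].
Qed.

Definition rcts g x := forall e : R, 0 < e -> exists2 d : R, 0 < d &
  forall t, `|t| < d -> cabs (g (x + t) - g x) <= e.

Lemma rcts_continuous (f : C -> R) g x :
  (forall z w, `|f z - f w| <= cabs (z - w)) -> rcts g x ->
  {for x, continuous (fun t => f (g t))}.
Proof.
move=> fl gc; apply/cvgrPdist_le => /= e e0.
have [d d0 H] := gc _ e0.
exists d => //= y /= xy; rewrite distrC; apply: le_trans (fl _ _) _.
by have := H (y - x); rewrite distrC => /(_ xy); rewrite [x + _]addrC subrK.
Qed.

Lemma Re_lip (z w : C) : `|Re z - Re w| <= cabs (z - w).
Proof. by rewrite -cReB; exact: normr_Re. Qed.

Lemma Im_lip (z w : C) : `|Im z - Im w| <= cabs (z - w).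
Proof. by rewrite -cImB; exact: normr_Im. Qed.

Lemma cintegrable_rcts a b g : (forall x, a <= x <= b -> rcts g x) ->
  cintegrable a b g.
Proof.
move=> gc; split; apply: continuous_compact_integrable; try exact: segment_compact.
- apply: continuous_in_subspaceT => x; rewrite inE /= in_itv => /gc.
  by apply: (@rcts_continuous (@Re R)); exact: Re_lip.
- apply: continuous_in_subspaceT => x; rewrite inE /= in_itv => /gc.
  by apply: (@rcts_continuous (@Im R)); exact: Im_lip.
Qed.

Lemma cderiv_rcts (f : C -> C) (w v l : C) x : cabs v = 1 ->
  cderiv f (w + x%:C * v) l -> rcts (fun t : R => f (w + t%:C * v)) x.
Proof.
move=> v1 /cderiv_cvg H e /H[d d0 {}H]; exists d => // t td.
have := H (t%:C * v); rewrite cabsM v1 mulr1 cabs_real => /(_ td).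
by rewrite rmorphD /= mulrDl addrA.
Qed.

End complex_integral.

(** * Goursat's theorem on rectangles *)

Section bisection.
Variable R : realType.
Implicit Types (a b c d x y : R).

Lemma nested_intervals (A B : nat -> R) :
  (forall n, A n <= A n.+1) -> (forall n, B n.+1 <= B n) ->
  (forall n, A n <= B n) -> exists x, forall n, A n <= x <= B n.
Proof.
move=> /nondecreasing_seqP Ai /nonincreasing_seqP Bi AB.
have ABmn m n : A m <= B n.
  apply: le_trans (Ai _ _ (leq_maxl m n)) _.
  by apply: le_trans (AB _) _; exact: Bi (leq_maxr m n).
have ubA n : ubound (range A) (B n) by move=> _ [m _ <-].
exists (sup (range A)) => n; apply/andP; split.
  by apply: ub_le_sup; [exists (B 0%N); exact: ubA|exists n].
by apply: ge_sup; [exists (A 0%N); exists 0%N|exact: ubA].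
Qed.

(** If P failed on the whole rectangle it would fail on a nested sequence of quarters, which shrinks
    to a point where P holds on all small rectangles. Besides Goursat's theorem this serves for
    intervals, with a degenerate second side. *)
Lemma rectangle_bisection (P : R -> R -> R -> R -> Prop) a b c d :
  a <= b -> c <= d ->
  (forall a' b' c' d', a <= a' -> a' <= b' -> b' <= b ->
     c <= c' -> c' <= d' -> d' <= d ->
     let m := (a' + b') / 2 in let k := (c' + d') / 2 in
     P a' m c' k -> P m b' c' k -> P a' m k d' -> P m b' k d' ->
     P a' b' c' d') ->
  (forall x y, a <= x <= b -> c <= y <= d -> exists2 e, 0 < e &
     forall a' b' c' d', a <= a' -> a' <= x <= b' -> b' <= b ->
     c <= c' -> c' <= y <= d' -> d' <= d -> b' - a' < e -> d' - c' < e ->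
     P a' b' c' d') ->
  P a b c d.
Proof.
move=> ab cd Psplit Ploc; apply: contrapT => nP.
pose ok (q : (R * R) * (R * R)) :=
  [/\ a <= q.1.1, q.1.1 <= q.1.2, q.1.2 <= b,
      (c <= q.2.1 /\ q.2.1 <= q.2.2 /\ q.2.2 <= d)
    & ~ P q.1.1 q.1.2 q.2.1 q.2.2].
(* Bad subrectangles form a subtype, so that [choice] turns the existence of a bad quarter into a
   function that can be iterated. *)
pose T := {q | ok q}.
pose next (q q' : T) := [/\ (sval q).1.1 <= (sval q').1.1,
  (sval q').1.2 <= (sval q).1.2, (sval q).2.1 <= (sval q').2.1,
  (sval q').2.2 <= (sval q).2.2 &
  (sval q').1.2 - (sval q').1.1 = ((sval q).1.2 - (sval q).1.1) / 2 /\
  (sval q').2.2 - (sval q').2.1 = ((sval q).2.2 - (sval q).2.1) / 2].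
have ex_next (q : T) : exists q' : T, next q q'.
  case: q => -[[a' b'] [c' d']] /= okq; have [/= aa ab' bb [cc [cd' dd]] nPq] := okq.
  have h := Psplit _ _ _ _ aa ab' bb cc cd' dd.
  have [H1|n1] := pselect (P a' ((a' + b') / 2) c' ((c' + d') / 2)); last first.
    have k1 : ok ((a', (a' + b') / 2), (c', (c' + d') / 2)).
      by split=> //=; try (repeat split => //); lra.
    by exists (exist _ _ k1); split => //=; try split; lra.
  have [H2|n2] := pselect (P ((a' + b') / 2) b' c' ((c' + d') / 2)); last first.
    have k1 : ok (((a' + b') / 2, b'), (c', (c' + d') / 2)).
      by split=> //=; try (repeat split => //); lra.
    by exists (exist _ _ k1); split => //=; try split; lra.
  have [H3|n3] := pselect (P a' ((a' + b') / 2) ((c' + d') / 2) d'); last first.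
    have k1 : ok ((a', (a' + b') / 2), ((c' + d') / 2, d')).
      by split=> //=; try (repeat split => //); lra.
    by exists (exist _ _ k1); split => //=; try split; lra.
  have [H4|n4] := pselect (P ((a' + b') / 2) b' ((c' + d') / 2) d'); last first.
    have k1 : ok (((a' + b') / 2, b'), ((c' + d') / 2, d')).
      by split=> //=; try (repeat split => //); lra.
    by exists (exist _ _ k1); split => //=; try split; lra.
  by exfalso; apply: nPq; exact: h.
have [f fP] := choice ex_next.
have ok0 : ok ((a, b), (c, d)) by split=> //=; repeat split.
pose s n := iter n f (exist _ _ ok0 : T).
have snext n : next (s n) (s n.+1) by exact: fP.
have sok n : ok (sval (s n)) by exact: svalP.
have [x xP] : exists x, forall n, (sval (s n)).1.1 <= x <= (sval (s n)).1.2.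
  by apply: nested_intervals => n; [case: (snext n)|case: (snext n)|case: (sok n)].
have [y yP] : exists y, forall n, (sval (s n)).2.1 <= y <= (sval (s n)).2.2.
  by apply: nested_intervals => n; [case: (snext n)|case: (snext n)|case: (sok n) => _ _ _ [_ []]].
have w1 n : (sval (s n)).1.2 - (sval (s n)).1.1 = (b - a) / 2 ^+ n.
  elim: n => [|n IH]; first by rewrite expr0 divr1.
  by case: (snext n) => _ _ _ _ [-> _]; rewrite IH exprSr invfM mulrA.
have w2 n : (sval (s n)).2.2 - (sval (s n)).2.1 = (d - c) / 2 ^+ n.
  elim: n => [|n IH]; first by rewrite expr0 divr1.
  by case: (snext n) => _ _ _ _ [_ ->]; rewrite IH exprSr invfM mulrA.
have [e e0 eP] := Ploc x y (xP 0%N) (yP 0%N).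
have small (u : R) : 0 <= u -> \forall n \near \oo, u / 2 ^+ n < e.
  move=> u0; have : (u * (2^-1) ^+ n) @[n --> \oo] --> u * 0.
    apply: cvgM; first exact: cvg_cst.
    by apply: cvg_expr; rewrite ger0_norm ?invr_ge0// invf_lt1// ltr1n.
  rewrite mulr0 => /cvgrPdist_lt/(_ _ e0); apply: filterS => n /=.
  rewrite sub0r normrN exprVn ger0_norm// mulr_ge0// invr_ge0 exprn_ge0//.
have ba : 0 <= b - a by rewrite subr_ge0.
have dc : 0 <= d - c by rewrite subr_ge0.
near \oo => n.
have [/= h1 h2 h3 [h4 [h5 h6]] nPq] := sok n.
apply: nPq; apply: eP => //.
- by rewrite w1; near: n; exact: small.
- by rewrite w2; near: n; exact: small.
Unshelve. all: by end_near. Qed.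

End bisection.

Section goursat.
Variable R : realType.
Local Notation C := R[i].
Implicit Types (f : C -> C) (a b c d x y M : R).

(* The contour integral of [f] around the rectangle [a, b] x [c, d]. *)
Definition rect a b c d f : C :=
  ci a b (fun x => f (x +i* c) - f (x +i* d)) +
  'i * ci c d (fun y => f (b +i* y) - f (a +i* y)).

Lemma cderiv_rctsx f x c l : cderiv f (x +i* c) l ->
  rcts (fun t : R => f (t +i* c)) x.
Proof.
have E (t : R) : t +i* c = (0 +i* c) + t%:C * 1 by rewrite mulr1; simpc.
rewrite E => /cderiv_rcts; rewrite cabs1 => /(_ erefl).
by under eq_fun do rewrite -E.
Qed.

Lemma cderiv_rctsy f x c l : cderiv f (c +i* x) l ->
  rcts (fun t : R => f (c +i* t)) x.
Proof.
have E (t : R) : c +i* t = c%:C + t%:C * 'i by simpc.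
rewrite E => /cderiv_rcts; rewrite cabs_imag normr1 => /(_ erefl).
by under eq_fun do rewrite -E.
Qed.

Definition holo_on (D : set C) f := forall w, D w -> exists l, cderiv f w l.

Definition crect a b c d : set C := [set w | a <= Re w <= b /\ c <= Im w <= d].

Lemma crect_intx f a b c d y : holo_on (crect a b c d) f ->
  c <= y <= d -> cintegrable a b (fun x => f (x +i* y)).
Proof.
move=> Hf hy; apply: cintegrable_rcts => x hx.
by have [|l /cderiv_rctsx] := Hf (x +i* y).
Qed.

Lemma crect_inty f a b c d x : holo_on (crect a b c d) f ->
  a <= x <= b -> cintegrable c d (fun y => f (x +i* y)).
Proof.
move=> Hf hx; apply: cintegrable_rcts => y hy.
by have [|l /cderiv_rctsy] := Hf (x +i* y).
Qed.

Lemma rect_splitx f a b c d m : a <= m -> m <= b ->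
  cintegrable a b (fun x => f (x +i* c)) -> cintegrable a b (fun x => f (x +i* d)) ->
  cintegrable c d (fun y => f (a +i* y)) -> cintegrable c d (fun y => f (m +i* y)) ->
  cintegrable c d (fun y => f (b +i* y)) ->
  rect a b c d f = rect a m c d f + rect m b c d f.
Proof.
move=> am mb ic id ia im ib; rewrite /rect (ci_split am mb); last exact: cintegrableB.
rewrite [ci c d _](_ : _ = ci c d (fun y => f (m +i* y) - f (a +i* y)) +
   ci c d (fun y => f (b +i* y) - f (m +i* y))).
  by rewrite mulrDr; ring.
by rewrite !ciB//; ring.
Qed.

Lemma rect_splity f a b c d m : c <= m -> m <= d ->
  cintegrable c d (fun y => f (a +i* y)) -> cintegrable c d (fun y => f (b +i* y)) ->
  cintegrable a b (fun x => f (x +i* c)) -> cintegrable a b (fun x => f (x +i* m)) ->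
  cintegrable a b (fun x => f (x +i* d)) ->
  rect a b c d f = rect a b c m f + rect a b m d f.
Proof.
move=> am mb ic id ia im ib; rewrite /rect (ci_split am mb); last exact: cintegrableB.
rewrite [ci a b _](_ : _ = ci a b (fun x => f (x +i* c) - f (x +i* m)) +
   ci a b (fun x => f (x +i* m) - f (x +i* d))).
  by rewrite mulrDr; ring.
by rewrite !ciB//; ring.
Qed.

Lemma rect_bound f a b c d M : a <= b -> c <= d ->
  cintegrable a b (fun x => f (x +i* c)) -> cintegrable a b (fun x => f (x +i* d)) ->
  cintegrable c d (fun y => f (a +i* y)) -> cintegrable c d (fun y => f (b +i* y)) ->
  (forall w, crect a b c d w -> cabs (f w) <= M) ->
  cabs (rect a b c d f) <= 4 * M * ((b - a) + (d - c)).
Proof.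
move=> ab cd i1 i2 i3 i4 fM; apply: le_trans (cabsD _ _) _.
rewrite cabsM cabs_imag normr1 mul1r mulrDr.
have H (z w : C) : cabs z <= M -> cabs w <= M -> cabs (z - w) <= 2 * M.
  by move=> *; apply: le_trans (cabsBD _ _) _; lra.
apply: lerD.
- rewrite (_ : 4 * M = 2 * (2 * M)); last by ring.
  apply: ci_bound => // [|x hx]; first exact: cintegrableB.
  by apply: H; apply: fM; split => //=; rewrite lexx ?cd ?ab.
- rewrite (_ : 4 * M = 2 * (2 * M)); last by ring.
  apply: ci_bound => // [|x hx]; first exact: cintegrableB.
  by apply: H; apply: fM; split => //=; rewrite lexx ?ab ?andbT.
Qed.

Lemma crect_sub a b c d a' b' c' d' : a <= a' -> b' <= b -> c <= c' -> d' <= d ->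
  crect a' b' c' d' `<=` crect a b c d.
Proof.
move=> h1 h2 h3 h4 w [/andP[? ?] /andP[? ?]]; split; apply/andP; split; lra.
Qed.

Lemma holo_onS (D E : set C) f : D `<=` E -> holo_on E f -> holo_on D f.
Proof. by move=> DE H w /DE; exact: H. Qed.

(* For an affine function the rectangle integral vanishes without computing any
   integral: the integrands of [rect] are then constant. *)
Lemma rect_local f a b c d (w l : C) (e : R) : a <= b -> c <= d ->
  holo_on (crect a b c d) f -> crect a b c d w ->
  (forall z, crect a b c d z -> cabs (f z - f w - l * (z - w)) <= e * cabs (z - w)) ->
  0 <= e ->
  cabs (rect a b c d f) <= 4 * e * ((b - a) + (d - c)) ^+ 2.
Proof.
move=> ab cd Hf [/andP[wa wb] /andP[wc wd]] He e0; set S := (b - a) + (d - c).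
have Hz z : crect a b c d z -> cabs (f z - f w - l * (z - w)) <= e * S.
  move=> zr; apply: le_trans (He _ zr) _; rewrite ler_wpM2l//.
  apply: le_trans (cabs_le_ReIm _) _; case: zr => /andP[? ?] /andP[? ?].
  by rewrite !cReImE /S; apply: lerD; rewrite ler_norml; apply/andP; split; lra.
have H2 z z' v : crect a b c d z -> crect a b c d z' -> z - z' = v ->
    cabs (f z - f z' - l * v) <= 2 * (e * S).
  move=> zr z'r <-.
  rewrite (_ : _ - _ = (f z - f w - l * (z - w)) - (f z' - f w - l * (z' - w))); last by ring.
  by apply: le_trans (cabsBD _ _) _; have := Hz _ zr; have := Hz _ z'r; lra.
have aa : a <= a <= b by rewrite lexx ab.
have bb : a <= b <= b by rewrite lexx ab.
have cc : c <= c <= d by rewrite lexx cd.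
have dd : c <= d <= d by rewrite lexx cd.
have i1 : cintegrable a b (fun x => f (x +i* c) - f (x +i* d)).
  by apply: cintegrableB; exact: (crect_intx Hf).
have i2 : cintegrable c d (fun y => f (b +i* y) - f (a +i* y)).
  by apply: cintegrableB; exact: (crect_inty Hf).
have -> : rect a b c d f =
    ci a b (fun x => f (x +i* c) - f (x +i* d) - l * (0 +i* (c - d))) +
    'i * ci c d (fun y => f (b +i* y) - f (a +i* y) - l * (b - a)%:C).
  rewrite (ciB i1 (cintegrable_cst _ _ _)) (ciB i2 (cintegrable_cst _ _ _)).
  rewrite !ci_cst// /rect.
  rewrite (_ : (0 +i* (c - d)) = - ('i * (d - c)%:C)); last first.
    by apply: complex_eq; rewrite ?cReImE /=; ring.
  by ring.
apply: le_trans (cabsD _ _) _; rewrite cabsM cabs_imag normr1 mul1r.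
rewrite (_ : 4 * e * S ^+ 2 = 2 * (2 * (e * S)) * (b - a) + 2 * (2 * (e * S)) * (d - c)); last first.
  by rewrite /S; ring.
apply: lerD; apply: ci_bound => //; try by apply: cintegrableB => //; exact: cintegrable_cst.
- by move=> x hx; apply: H2; [by split|by split|apply: complex_eq; rewrite !cReImE /=; ring].
- by move=> x hx; apply: H2; [by split|by split|apply: complex_eq; rewrite !cReImE /=; ring].
Qed.

(** Bisection applies to the bound 4 e (half perimeter)^2: it is local by [rect_local], and the
    bounds of four quarters add up exactly to that of the rectangle since each half perimeter is
    halved. Then e tends to 0. *)
Theorem goursat f a b c d : a <= b -> c <= d ->
  holo_on (crect a b c d) f -> rect a b c d f = 0.
Proof.
move=> ab cd Hf.
suff H e : 0 < e -> cabs (rect a b c d f) <= 4 * e * ((b - a) + (d - c)) ^+ 2.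
  apply/eqP; rewrite -cabs_eq0; apply/eqP/le_anti; rewrite cabs_ge0 andbT.
  apply/ler_addgt0Pl => e e0; rewrite addr0.
  set S := ((b - a) + (d - c)) ^+ 2 in H.
  have S0 : 0 <= S by exact: sqr_ge0.
  have := H (e / (4 * (S + 1))); rewrite divr_gt0//; last first.
    by rewrite mulr_gt0// ltr_wpDl.
  move=> /(_ isT) /le_trans; apply.
  rewrite -mulrA (_ : 4 * _ = e * (S / (S + 1))); last first.
    by field; rewrite gt_eqF// ltr_wpDl.
  by rewrite ger_pMr// ler_pdivrMr ?ltr_wpDl// mul1r lerDl.
move=> e0.
apply: (@rectangle_bisection _ (fun a b c d =>
  cabs (rect a b c d f) <= 4 * e * ((b - a) + (d - c)) ^+ 2)) => //.
- move=> a' b' c' d' aa ab' bb cc cd' dd m k.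
  have am : a' <= m by rewrite /m; lra.
  have mb : m <= b' by rewrite /m; lra.
  have ck : c' <= k by rewrite /k; lra.
  have kd : k <= d' by rewrite /k; lra.
  have intx a1 b1 y : a <= a1 -> b1 <= b -> c <= y <= d -> cintegrable a1 b1 (fun x => f (x +i* y)).
    by move=> *; apply: cintegrable_sub (crect_intx Hf _).
  have inty c1 d1 x : c <= c1 -> d1 <= d -> a <= x <= b -> cintegrable c1 d1 (fun y => f (x +i* y)).
    by move=> *; apply: cintegrable_sub (crect_inty Hf _).
  have ac := le_trans aa am; have cb := le_trans mb bb.
  have ec := le_trans cc ck; have ed := le_trans kd dd.
  have [ia ib] : a <= a' <= b /\ a <= b' <= b by rewrite aa bb (le_trans ab' bb) (le_trans aa ab').
  have [ic id] : c <= c' <= d /\ c <= d' <= d by rewrite cc dd (le_trans cd' dd) (le_trans cc cd').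
  have im : a <= m <= b by rewrite ac cb.
  have ik : c <= k <= d by rewrite ec ed.
  rewrite (rect_splitx am mb); [|exact: intx|exact: intx|exact: inty|exact: inty|exact: inty].
  rewrite (rect_splity ck kd (a := a') (b := m)); [|exact: inty|exact: inty|exact: intx|exact: intx|exact: intx].
  rewrite (rect_splity ck kd (a := m) (b := b')); [|exact: inty|exact: inty|exact: intx|exact: intx|exact: intx].
  move=> h1 h2 h3 h4.
  apply: le_trans (cabsD _ _) _; apply: le_trans (lerD (cabsD _ _) (cabsD _ _)) _.
  apply: le_trans (lerD (lerD h1 h3) (lerD h2 h4)) _.
  by rewrite le_eqVlt; apply/orP; left; apply/eqP; rewrite /m /k; field.
- move=> x y hx hy; have [|l /(_ _ e0)[r r0 Hr]] := Hf (x +i* y); first by split.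
  exists (r / 2) => [|a' b' c' d' aa hx' bb cc hy' dd ba dc]; first by rewrite divr_gt0.
  have [/andP[h1 h2] /andP[h3 h4]] := (hx', hy').
  apply: (@rect_local _ _ _ _ _ (x +i* y) l); [lra|lra| |by []| |exact: ltW].
    by apply: holo_onS Hf; apply: crect_sub.
  move=> z [/andP[z1 z2] /andP[z3 z4]].
  have := Hr (z - (x +i* y)); rewrite [_ + (z - _)]addrC subrK; apply.
  apply: le_lt_trans (cabs_le_ReIm _) _; rewrite !cReImE /= (splitr r).
  by apply: ltrD; rewrite ltr_norml; apply/andP; split; lra.
Qed.

End goursat.

(** * The complex exponential *)

Section real_derivative.
Variable R : realType.
Implicit Types (f : R -> R) (x l e d t : R).

Lemma is_deriveP_eps f x l : is_derive x 1 f l <->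
  forall e, 0 < e -> exists2 d, 0 < d &
    forall t, `|t| < d -> `|f (x + t) - f x - l * t| <= e * `|t|.
Proof.
split=> [[df dl] e e0|H].
- move: df dl; rewrite /derivable /derive => df dl.
  have : h^-1 *: ((f \o shift x) (h *: 1) - f x) @[h --> 0^'] --> l.
    by rewrite -dl; exact: df.
  move=> /cvgrPdist_le /(_ _ e0) [d /= d0 Hd]; exists d => // t td.
  have [->|t0] := eqVneq t 0; first by rewrite addr0 subrr mulr0 subr0 normr0 mulr0.
  have := Hd t; rewrite /= sub0r normrN => /(_ td t0).
  rewrite /shift /= [_ *: 1]mulr1 [t + x]addrC => {}Hd.
  have {}Hd : `|l - t^-1 * (f (x + t) - f x)| <= e := Hd.
  rewrite -ler_pdivrMr ?normr_gt0// -normfV -normrM.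
  by rewrite (_ : _ / t = t^-1 * (f (x + t) - f x) - l); [rewrite distrC|field].
- have cv : h^-1 *: ((f \o shift x) (h *: 1) - f x) @[h --> 0^'] --> l.
    apply/cvgrPdist_le => e e0; have [d d0 Hd] := H _ e0.
    exists d => // t /=; rewrite sub0r normrN => td t0.
    rewrite /shift /= [_ *: 1]mulr1 [t + x]addrC.
    suff : `|l - t^-1 * (f (x + t) - f x)| <= e by [].
    rewrite distrC (_ : _ - l = (f (x + t) - f x - l * t) / t); last by field.
    rewrite normrM normfV ler_pdivrMr ?normr_gt0//; exact: Hd.
  by apply: DeriveDef; [apply/cvg_ex; exists l|apply: cvg_lim].
Qed.

End real_derivative.

Section holomorphic.
Variable R : realType.
Local Notation C := R[i].
Implicit Types (f : C -> C) (w z l h : C) (a b c d M r e t : R).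

Lemma cderiv_is_derive (p : C -> R) f w v l t :
  (forall z w, p (z - w) = p z - p w) -> (forall a z, p (a%:C * z) = a * p z) ->
  (forall z, `|p z| <= cabs z) ->
  cderiv f (w + t%:C * v) l ->
  is_derive t 1 (fun t : R => p (f (w + t%:C * v))) (p (l * v)).
Proof.
move=> pB pZ pl Hf; apply/is_deriveP_eps => e e0.
have [v0|v0] := eqVneq v 0.
  exists 1 => // s _; rewrite v0 !mulr0 subrr (_ : p 0 = 0) ?mul0r ?subr0 ?normr0; last first.
    by rewrite -[0](subrr 0) pB subrr.
  by rewrite mulr_ge0// ltW.
have V : 0 < cabs v by rewrite cabs_gt0.
have [|d d0 Hd] := Hf (e / cabs v); first by rewrite divr_gt0.
exists (d / cabs v) => [|s sd]; first by rewrite divr_gt0.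
rewrite [p (l * v) * s]mulrC -pZ -pB -pB; apply: le_trans (pl _) _.
have := Hd (s%:C * v); rewrite cabsM cabs_real -ltr_pdivlMr// => /(_ sd).
rewrite (_ : w + (t + s)%:C * v = w + t%:C * v + s%:C * v); last by rewrite rmorphD /=; ring.
rewrite (_ : e / cabs v * (`|s| * cabs v) = e * `|s|); last by field; rewrite gt_eqF.
by rewrite (_ : l * (s%:C * v) = s%:C * (l * v))//; ring.
Qed.

(** The mean value theorem holds only for real functions, so it is applied along the segment to the
    real and to the imaginary part, whence the factor 2. *)
Lemma cabs_increment f w v M :
  (forall t, 0 <= t <= 1 -> exists2 l, cderiv f (w + t%:C * v) l & cabs l <= M) ->
  cabs (f (w + v) - f w) <= 2 * M * cabs v.
Proof.
move=> H.
have K (p : C -> R) : (forall z w, p (z - w) = p z - p w) ->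
    (forall a z, p (a%:C * z) = a * p z) -> (forall z, `|p z| <= cabs z) ->
    `|p (f (w + v) - f w)| <= M * cabs v.
  move=> pB pZ pl.
  set F := fun t : R => p (f (w + t%:C * v)).
  have Hdf t : 0 <= t <= 1 -> is_derive t 1 F ('D_1 F t) /\ `|'D_1 F t| <= M * cabs v.
    move=> /H[l dl lM]; have dF := cderiv_is_derive pB pZ pl dl.
    rewrite derive_val; split => //.
    by apply: le_trans (pl _) _; rewrite cabsM ler_wpM2r ?cabs_ge0.
  have [|||c c01] := @MVT_segment R F (fun t : R => 'D_1 F t) 0 1.
  - exact: ler01.
  - move=> x; rewrite in_itv => /andP[x0 x1].
    have h : 0 <= x <= 1 by rewrite !ltW.
    by have [] := Hdf x h.
  - apply: continuous_in_subspaceT => x; rewrite inE /= in_itv => hx.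
    have [[dx _] _] := Hdf _ hx.
    by apply/differentiable_continuous/derivable1_diffP.
  rewrite /F subr0 mulr1 rmorph1 mul1r mul0r addr0 pB -/F => ->.
  by move: c01; rewrite in_itv => /Hdf[].
apply: le_trans (cabs_le_ReIm _) _.
rewrite (_ : 2 * M * cabs v = M * cabs v + M * cabs v); last by ring.
apply: lerD; apply: K => *; rewrite ?cReImE /= ?mul0r ?subr0 ?addr0//.
- exact: normr_Re.
- exact: normr_Im.
Qed.

Definition cexp w : C := (expR (Re w) * cos (Im w)) +i* (expR (Re w) * sin (Im w)).

Lemma cexpD w z : cexp (w + z) = cexp w * cexp z.
Proof.
rewrite /cexp; apply: complex_eq; rewrite ?cReImE /= expRD ?cosD ?sinD; ring.
Qed.

Lemma cexp0 : cexp 0 = 1.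
Proof. by rewrite /cexp /= expR0 cos0 sin0 mulr1 mulr0. Qed.

Lemma cabs_cexp w : cabs (cexp w) = expR (Re w).
Proof.
by rewrite cabs_def /cexp /= !exprMn -mulrDr cos2Dsin2 mulr1 sqrtr_sqr ger0_norm// expR_ge0.
Qed.

Lemma cexpN w : cexp (- w) = (cexp w)^-1.
Proof.
have e0 : cexp w != 0 by rewrite -cabs_gt0 cabs_cexp expR_gt0.
by apply: (mulfI e0); rewrite divff// -cexpD subrr cexp0.
Qed.

Lemma cexp_pi (x : R) : cexp (x +i* (- pi)) = cexp (x +i* pi).
Proof. by rewrite /cexp /= cosN sinN sinpi oppr0. Qed.

Lemma cexp_real (x : R) : cexp x%:C = (expR x)%:C.
Proof. by rewrite /cexp /= cos0 sin0 mulr1 mulr0. Qed.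

(** The point 0 is enough: the addition formula [cexpD] carries the derivative to every other
    point. *)
Lemma cderiv_cexp0 : cderiv cexp 0 1.
Proof.
(* Each coordinate may cost e/2 |h|. With |e^(Re h)| <= 2, its error consists of one term of size
   e/8 |h| and one of size 2 e/8 |h|. *)
move=> e e0; have e8 : 0 < e / 8 by rewrite divr_gt0.
have /is_deriveP_eps /(_ _ e8)[d1 d10 H1] : is_derive (0 : R) 1 expR (expR 0) by exact: is_derive_expR.
have /is_deriveP_eps /(_ _ e8)[d2 d20 H2] : is_derive (0 : R) 1 cos (- sin 0) by exact: is_derive_cos.
have /is_deriveP_eps /(_ _ e8)[d3 d30 H3] : is_derive (0 : R) 1 sin (cos 0) by exact: is_derive_sin.
have e9 : 0 < Num.min 1 (e / 8) by rewrite lt_min ltr01.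
have /cvgrPdist_le/(_ _ e9)[d4 /= d40 H4] : expR x @[x --> (0 : R)] --> expR 0.
  exact: continuous_expR.
exists (Num.min (Num.min d1 d2) (Num.min d3 d4)) => [|h].
  by rewrite !lt_min d10 d20 d30.
rewrite !lt_min => /andP[/andP[h1 h2] /andP[h3 h4]]; rewrite add0r mul1r.
have {}H1 := H1 _ (le_lt_trans (normr_Re h) h1).
have {}H2 := H2 _ (le_lt_trans (normr_Im h) h2).
have {}H3 := H3 _ (le_lt_trans (normr_Im h) h3).
have {}H4 : `|expR (Re h) - 1| <= Num.min 1 (e / 8).
  have := H4 (Re h); rewrite /= sub0r normrN expR0 distrC; apply.
  exact: le_lt_trans (normr_Re h) h4.
move: H1 H2 H3; rewrite !add0r expR0 cos0 sin0 oppr0 mul0r !subr0 !addr0 !mul1r => H1 H2 H3.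
move: H4; rewrite le_min => /andP[H4 H4'].
have E2 : expR (Re h) <= 2 by move: H4; rewrite ler_norml => /andP[_]; lra.
have E0 := expR_ge0 (Re h).
apply: le_trans (cabs_le_ReIm _) _; rewrite cexp0 !cReImE /cexp /=.
have hR := normr_Re h; have hI := normr_Im h.
have A1 : `|expR (Re h) * cos (Im h) - 1 - Re h| <= e / 2 * cabs h.
  rewrite (_ : _ - Re h = (expR (Re h) - 1 - Re h) + expR (Re h) * (cos (Im h) - 1)); last by ring.
  apply: le_trans (ler_normD _ _) _; rewrite normrM (ger0_norm E0).
  have : expR (Re h) * `|cos (Im h) - 1| <= 2 * (e / 8 * `|Im h|).
    by apply: ler_pM.
  have : e / 8 * `|Re h| <= e / 8 * cabs h by rewrite ler_wpM2l// ltW.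
  have : e / 8 * `|Im h| <= e / 8 * cabs h by rewrite ler_wpM2l// ltW.
  have : 0 <= e / 8 * cabs h by rewrite mulr_ge0 ?cabs_ge0 ?ltW.
  lra.
have A2 : `|expR (Re h) * sin (Im h) - 0 - Im h| <= e / 2 * cabs h.
  rewrite (_ : _ - Im h = expR (Re h) * (sin (Im h) - Im h) + (expR (Re h) - 1) * Im h); last by ring.
  apply: le_trans (ler_normD _ _) _; rewrite !normrM (ger0_norm E0).
  have : expR (Re h) * `|sin (Im h) - Im h| <= 2 * (e / 8 * `|Im h|).
    by apply: ler_pM.
  have : `|expR (Re h) - 1| * `|Im h| <= e / 8 * `|Im h| by rewrite ler_wpM2r.
  have : e / 8 * `|Im h| <= e / 8 * cabs h by rewrite ler_wpM2l// ltW.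
  have : 0 <= e / 8 * cabs h by rewrite mulr_ge0 ?cabs_ge0 ?ltW.
  lra.
by move: A1 A2; lra.
Qed.

Lemma cderiv_shift f w v l : cderiv f (v + w) l -> cderiv (fun z => f (v + z)) w l.
Proof.
by move=> H e /H[d d0 Hd]; exists d => // h /Hd; rewrite addrA.
Qed.

Lemma cderiv_cexp w : cderiv cexp w (cexp w).
Proof.
have := cderivZ (cexp w) cderiv_cexp0.
rewrite mulr1; under [X in cderiv X]eq_fun do rewrite -cexpD.
move=> H e /H[d d0 Hd]; exists d => // h /Hd.
by rewrite add0r addr0.
Qed.

(** A square of half side r around [w0] is cut out. The four remaining rectangles contribute 0 by
    Goursat's theorem, and the square at most 16 M r, which tends to 0 with r. The cuts run along
    lines that avoid [w0]. *)
Lemma goursat_except f a b c d w0 M :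
  a < Re w0 < b -> c < Im w0 < d ->
  (forall w, crect a b c d w -> w != w0 -> exists l, cderiv f w l) ->
  (forall w, crect a b c d w -> cabs (f w) <= M) ->
  rect a b c d f = 0.
Proof.
case: w0 => p q /= /andP[ap pb] /andP[cq qd] Hf fM.
have M0 : 0 <= M.
  by apply: le_trans (fM (p +i* q) _); rewrite ?cabs_ge0//; split => /=; rewrite !ltW.
suff H r : 0 < r -> r < Num.min (Num.min (p - a) (b - p)) (Num.min (q - c) (d - q)) ->
    cabs (rect a b c d f) <= 16 * M * r.
  apply/eqP; rewrite -cabs_eq0; apply/eqP/le_anti; rewrite cabs_ge0 andbT.
  apply/ler_addgt0Pl => e e0; rewrite addr0.
  set m := Num.min _ _ in H.
  have m0 : 0 < m by rewrite /m !lt_min !subr_gt0 ap pb cq.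
  pose r := Num.min (m / 2) (e / (16 * (M + 1))).
  have r0 : 0 < r by rewrite lt_min !divr_gt0// mulr_gt0// ltr_wpDl.
  apply: le_trans (H r r0 _) _.
    by rewrite gt_min ltr_pdivrMr// ltr_pMr// ltr1n.
  apply: (@le_trans _ _ (16 * (M + 1) * (e / (16 * (M + 1))))).
    by apply: ler_pM => //; [lra|exact: ltW|lra|rewrite ge_min lexx orbT].
  by rewrite mulrCA divff ?mulr1// gt_eqF// mulr_gt0// ltr_wpDl.
move=> r0; rewrite !lt_min => /andP[/andP[r1 r2] /andP[r3 r4]].
have intx a1 b1 y : a <= a1 -> b1 <= b -> c <= y <= d -> y != q ->
    cintegrable a1 b1 (fun x => f (x +i* y)).
  move=> h1 h2 h3 yq; apply: cintegrable_rcts => x /andP[hx1 hx2].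
  have [||l /cderiv_rctsx] := Hf (x +i* y) => //.
    by split => //=; apply/andP; split; lra.
  by rewrite eq_complex /= negb_and yq orbT.
have inty c1 d1 x : c <= c1 -> d1 <= d -> a <= x <= b -> x != p ->
    cintegrable c1 d1 (fun y => f (x +i* y)).
  move=> h1 h2 h3 yq; apply: cintegrable_rcts => y /andP[hx1 hx2].
  have [||l /cderiv_rctsy] := Hf (x +i* y) => //.
    by split => //=; apply/andP; split; lra.
  by rewrite eq_complex /= negb_and yq.
have nsub x : x - r != x by rewrite lt_eqF// ltrBlDr ltrDl.
have nadd x : x + r != x by rewrite gt_eqF// ltrDl.
have sub0 a1 b1 c1 d1 : a <= a1 -> a1 <= b1 -> b1 <= b -> c <= c1 -> c1 <= d1 -> d1 <= d ->
   [|| b1 < p, p < a1, d1 < q | q < c1] -> rect a1 b1 c1 d1 f = 0.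
  move=> h1 h2 h3 h4 h5 h6 out; apply: goursat => // w hw.
  apply: Hf; first exact: crect_sub hw.
  apply/eqP => wE; move: hw; rewrite wE => -[/= /andP[k1 k2] /andP[k3 k4]].
  by move: out => /or4P[]; rewrite ltNge ?k1 ?k2 ?k3 ?k4.
have [A1 A2 A3] : [/\ a <= p - r, p - r <= p + r & p + r <= b] by split; lra.
have [B1 B2 B3] : [/\ c <= q - r, q - r <= q + r & q + r <= d] by split; lra.
have A12 := le_trans A1 A2; have A23 := le_trans A2 A3.
have B12 := le_trans B1 B2; have B23 := le_trans B2 B3.
have ab := le_trans A1 A23; have cd := le_trans B1 B23.
have [aI bI] : a <= a <= b /\ a <= b <= b by rewrite !lexx ab.
have [cI dI] : c <= c <= d /\ c <= d <= d by rewrite !lexx cd.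
have [p1 p2] : a <= p - r <= b /\ a <= p + r <= b by rewrite A1 A23 A12 A3.
have [q1 q2] : c <= q - r <= d /\ c <= q + r <= d by rewrite B1 B23 B12 B3.
have [na nb] : a != p /\ b != p by rewrite (lt_eqF ap) (gt_eqF pb).
have [nc nd] : c != q /\ d != q by rewrite (lt_eqF cq) (gt_eqF qd).
have aa := lexx a; have bb := lexx b; have cc := lexx c; have dd := lexx d.
have e1 : rect a b c d f = rect a (p - r) c d f + rect (p - r) b c d f.
  by apply: rect_splitx => //; [exact: intx|exact: intx|exact: inty|exact: inty|exact: inty].
have e2 : rect (p - r) b c d f = rect (p - r) (p + r) c d f + rect (p + r) b c d f.
  by apply: rect_splitx => //; [exact: intx|exact: intx|exact: inty|exact: inty|exact: inty].
have e3 : rect (p - r) (p + r) c d f = rect (p - r) (p + r) c (q - r) f + rect (p - r) (p + r) (q - r) d f.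
  by apply: rect_splity => //; [exact: inty|exact: inty|exact: intx|exact: intx|exact: intx].
have e4 : rect (p - r) (p + r) (q - r) d f = rect (p - r) (p + r) (q - r) (q + r) f + rect (p - r) (p + r) (q + r) d f.
  by apply: rect_splity => //; [exact: inty|exact: inty|exact: intx|exact: intx|exact: intx].
have [pr1 pr2] : p - r < p /\ p < p + r by rewrite ltrBlDr ltrDl.
have [qr1 qr2] : q - r < q /\ q < q + r by rewrite ltrBlDr ltrDl.
rewrite e1 (sub0 a (p - r) c d) ?pr1// e2 (sub0 (p + r) b c d) ?pr2 ?orbT//.
rewrite e3 (sub0 _ _ c (q - r)) ?qr1 ?orbT// e4 (sub0 _ _ (q + r) d) ?qr2 ?orbT// !addr0 !add0r.
rewrite (_ : 16 * M * r = 4 * M * (((p + r) - (p - r)) + ((q + r) - (q - r)))); last by ring.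
apply: rect_bound => //; [exact: intx|exact: intx|exact: inty|exact: inty|].
by move=> w hw; apply: fM; exact: crect_sub hw.
Qed.

End holomorphic.

(** * Cauchy estimates on a disc *)

Section cauchy_estimates.
Variable R : realType.
Local Notation C := R[i].
Implicit Types (f q : C -> C) (w z l h : C) (a b c d M r e t s : R).

Lemma ci0 a b : ci a b (fun=> 0 : C) = 0.
Proof. by rewrite /ci /Rintegral /= !integral0. Qed.

(* On a rectangle of height [2 pi] the horizontal sides of a [2 pi i]-periodic
   function cancel, so the vertical sides have the same integral. *)
Lemma ci_periodic q s s' : s <= s' ->
  holo_on (crect s s' (- pi) pi) q ->
  (forall x, q (x +i* (- pi)) = q (x +i* pi)) ->
  ci (- pi) pi (fun y => q (s +i* y)) = ci (- pi) pi (fun y => q (s' +i* y)).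
Proof.
move=> ss Hq per; have p0 : - pi <= pi :> R by rewrite ge0_cp// ?pi_ge0.
have := goursat ss p0 Hq; rewrite /rect.
rewrite (@eq_ci _ s s' _ (fun=> 0)); last by move=> x _; rewrite per subrr.
rewrite ci0 add0r => /eqP; rewrite mulf_eq0 eq_complex /= oner_eq0 andbF /=.
rewrite ciB; last 2 first.
- by apply: (crect_inty Hq); rewrite ss lexx.
- by apply: (crect_inty Hq); rewrite ss lexx.
by rewrite subr_eq0 => /eqP.
Qed.

(* In the variable [w] with [z = a + e^w] the difference quotient of [f] at [a]
   has no singularity, and it tends to [l] as [Re w] tends to [-oo]. *)
Lemma cauchy_deriv_bound f z l r M : 0 < r ->
  (forall h, cabs h <= r -> exists l, cderiv f (z + h) l) -> cderiv f z l ->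
  (forall h, cabs h = r -> cabs (f (z + h) - f z) <= M) ->
  cabs l <= 2 * M / r.
Proof.
move=> r0 Hf Hl fM.
pose q w := (f (z + cexp w) - f z) * cexp (- w).
have Hq : holo_on [set w | Re w <= ln r] q.
  move=> w /= wr.
  have [l' Hl'] : exists l, cderiv f (z + cexp w) l.
    by apply: Hf; rewrite cabs_cexp -ler_ln ?posrE ?expR_gt0// expRK.
  have H1 : cderiv (fun w => f (z + cexp w) - f z) w (l' * (0 + cexp w) - 0).
    apply: cderivB; last exact: cderiv_cst.
    apply: (cderiv_comp (g := fun w => z + cexp w)) => //.
    by apply: cderivD; [exact: cderiv_cst|exact: cderiv_cexp].
  have H2 : cderiv (fun w => cexp (- w)) w (cexp (- w) * (- 1)).
    apply: (cderiv_comp (g := fun w => - w)); last exact: cderiv_cexp.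
    exact: cderivN (cderiv_id _).
  by eexists; exact: cderivM H1 H2.
have per x : q (x +i* (- pi)) = q (x +i* pi).
  rewrite /q cexp_pi; congr (_ * _).
  rewrite (_ : - (x +i* - pi) = (- x) +i* pi); last by rewrite /GRing.opp /= opprK.
  by rewrite (_ : - (x +i* pi) = (- x) +i* (- pi))// cexp_pi.
have pi0 : 0 < pi :> R by exact: pi_gt0.
have p0 : - pi <= pi :> R by lra.
have cabs_scale (x : R) (v : C) : 0 <= x -> cabs (x%:C * v) = cabs v * x.
  by move=> x0; rewrite cabsM cabs_real ger0_norm// mulrC.
have pp : 0 <= pi - - pi :> R by lra.
(* The segment Re w = ln r parametrizes the circle of radius r around z, where [q] has modulus at
   most M / r. *)
set S := ln r.
have qint s : s <= S -> cintegrable (- pi) pi (fun y => q (s +i* y)).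
  move=> sS; apply: (@crect_inty _ q s s); last by rewrite lexx.
  by apply: holo_onS Hq => w [/andP[_ ws] _] /=; apply: le_trans sS.
have B1 : cabs (ci (- pi) pi (fun y => q (S +i* y))) <= 2 * (M / r) * (pi - - pi).
  apply: ci_bound => //; first exact: qint.
  move=> y _; rewrite /q cabsM !cabs_cexp /= expRN /S lnK ?posrE//.
  apply: ler_wpM2r; first by rewrite invr_ge0 ltW.
  by apply: fM; rewrite cabs_cexp /= lnK ?posrE.
suff B2 e : 0 < e -> cabs l * (pi - - pi) <= 2 * (M / r) * (pi - - pi) + 2 * e * (pi - - pi).
  apply/ler_addgt0Pr => e e0.
  have {B2} := B2 (e / 2); rewrite divr_gt0// => /(_ isT).
  rewrite -mulrDl ler_pM2r; last lra.
  by rewrite mulrA mulrCA divff// mulr1.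
move=> e0; have [d d0 Hd] := Hl _ e0.
(* Far enough to the left, z + e^w is so close to z that the difference quotient is within e of
   l. *)
pose s := Num.min S (ln (d / 2)).
have sS : s <= S by rewrite ge_min lexx.
have sd : expR s <= d / 2.
  rewrite -[leRHS]lnK ?posrE ?divr_gt0// ler_expR ge_min lexx orbT//.
have B3 : cabs (ci (- pi) pi (fun y => q (s +i* y)) - (pi - - pi)%:C * l)
    <= 2 * e * (pi - - pi).
  rewrite -ci_cst// -ciB; [|exact: qint|exact: cintegrable_cst].
  apply: ci_bound => //; first by apply: cintegrableB; [exact: qint|exact: cintegrable_cst].
  move=> y _; set w := s +i* y; have ew : cexp w != 0 by rewrite -cabs_gt0 cabs_cexp expR_gt0.
  have := Hd (cexp w); rewrite cabs_cexp /= => /(_ _)/wrap[].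
    by apply: le_lt_trans sd _; rewrite ltr_pdivrMr// ltr_pMr// ltr1n.
  rewrite /q cexpN (_ : _ / _ - l = (f (z + cexp w) - f z - l * cexp w) / cexp w); last by field.
  by rewrite cabsM cabsV ler_pdivrMr ?cabs_gt0// cabs_cexp.
have E : ci (- pi) pi (fun y => q (s +i* y)) = ci (- pi) pi (fun y => q (S +i* y)).
  apply: ci_periodic => //.
  by apply: holo_onS Hq => w [/andP[]].
rewrite E in B3.
rewrite -(cabs_scale _ l pp).
set I := ci _ _ _ in B1 B3.
rewrite -(subrK I (_ * l)); apply: le_trans (cabsD _ _) _.
by rewrite cabsB addrC lerD.
Qed.

(** An oscillation of at most 2 on circles of radius d/2 gives the derivative bound 8/d, doubled by
    [cabs_increment]. The same derivative bound on radius d/8 for h |-> f(w + h) - f(h), of size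
    16/d |z|, shows that f' varies by at most 512/d^2 |z|; integrating along the segment doubles
    this once more. No second derivative appears. *)
Lemma holo_taylor1 f d l0 : 0 < d ->
  (forall z, cabs z < d -> exists l, cderiv f z l) ->
  (forall z, cabs z < d -> cabs (f z) <= 1) -> cderiv f 0 l0 ->
  [/\ cabs l0 <= 8 / d,
    forall z w, cabs z < d / 2 -> cabs w < d / 2 ->
      cabs (f z - f w) <= 16 / d * cabs (z - w) &
    forall z, cabs z < d / 4 ->
      cabs (f z - f 0 - l0 * z) <= 1024 / d ^+ 2 * cabs z ^+ 2].
Proof.
move=> d0 Hf f1 Hl0.
have B z l : cabs z < d / 2 -> cderiv f z l -> cabs l <= 8 / d.
  move=> zd Hl; have d2 : 0 < d / 2 by rewrite divr_gt0.
  have zh h : cabs h <= d / 2 -> cabs (z + h) < d.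
    by move=> hd; apply: le_lt_trans (cabsD _ _) _; rewrite [d]splitr ltr_leD.
  have := @cauchy_deriv_bound f z l (d / 2) 2 d2.
  rewrite (_ : 2 * 2 / (d / 2) = 8 / d); last by field; rewrite gt_eqF.
  apply => // h hd; first by apply: Hf; exact: zh.
  apply: le_trans (cabsBD _ _) _; rewrite (_ : 2 = 1 + 1 :> R)//.
  apply: lerD; apply: f1; first by apply: zh; rewrite hd.
  by apply: lt_trans zd _; rewrite ltr_pdivrMr// ltr_pMr// ltr1n.
have d2d : d / 2 < d by rewrite ltr_pdivrMr// ltr_pMr// ltr1n.
have seg z w t k : 0 <= t <= 1 -> cabs z < k -> cabs w < k -> cabs (w + t%:C * (z - w)) < k.
  move=> /andP[t0 t1] zk wk.
  rewrite (_ : _ + _ = t%:C * z + (1 - t)%:C * w); last by rewrite rmorphB /= rmorph1; ring.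
  apply: le_lt_trans (cabsD _ _) _; rewrite !cabsM !cabs_real !ger0_norm ?subr_ge0//.
  rewrite (_ : k = t * k + (1 - t) * k); last by ring.
  move: t0; rewrite le_eqVlt => /predU1P[<-|t0]; first by rewrite !mul0r subr0 !mul1r !add0r.
  by rewrite ltr_leD ?ltr_pM2l// ler_wpM2l ?subr_ge0// ltW.
have L z w : cabs z < d / 2 -> cabs w < d / 2 -> cabs (f z - f w) <= 16 / d * cabs (z - w).
  move=> zd wd; rewrite -{1}(subrK w z) [z - w + w]addrC.
  rewrite (_ : 16 / d = 2 * (8 / d)); last by field; rewrite gt_eqF.
  apply: cabs_increment => t t01; have h := seg _ _ _ _ t01 zd wd.
  have [l Hl] := Hf _ (lt_trans h d2d); exists l => //; exact: B Hl.
have c0 : cabs (0 : C) < d by rewrite cabs0.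
split => //; first by apply: B Hl0; rewrite cabs0 divr_gt0.
move=> z zd4.
have dd : d / 4 + d / 8 < d / 2 by lra.
have D w l : cabs w <= cabs z -> cderiv f w l -> cabs (l - l0) <= 512 / d ^+ 2 * cabs z.
  move=> wz Hl.
  have wd4 : cabs w < d / 4 by apply: le_lt_trans zd4.
  pose g h := f (w + h) - f (0 + h).
  have d8 : 0 < d / 8 by rewrite divr_gt0.
  have := @cauchy_deriv_bound g 0 (l - l0) (d / 8) (32 / d * cabs z) d8.
  rewrite (_ : 2 * (32 / d * cabs z) / (d / 8) = 512 / d ^+ 2 * cabs z); last by field; rewrite gt_eqF.
  have wh h : cabs h <= d / 8 -> cabs (w + h) < d / 2.
    by move=> hd; apply: le_lt_trans (cabsD _ _) _; lra.
  have ww h : cabs h <= d / 8 -> cabs h < d / 2 by lra.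
  have gb h : cabs h <= d / 8 -> cabs (g h) <= 16 / d * cabs z.
    move=> hd; rewrite /g; apply: le_trans (L _ _ _ _) _; [exact: wh|rewrite add0r; exact: ww|].
    rewrite (_ : w + h - (0 + h) = w); last by ring.
    by apply: ler_wpM2l wz; rewrite divr_ge0// ltW.
  apply.
  - move=> h hd; have [l1 H1] := Hf _ (lt_trans (wh _ hd) d2d).
    have hd' : cabs (0 + h) < d by rewrite add0r (lt_trans (ww _ hd)).
    have [l2 H2] := Hf _ hd'.
    by exists (l1 - l2); rewrite add0r; apply: cderivB; exact: cderiv_shift.
  - by apply: cderivB; apply: cderiv_shift; rewrite addr0.
  - move=> h hd; rewrite add0r; apply: le_trans (cabsBD _ _) _.
    rewrite (_ : 32 / d * cabs z = 16 / d * cabs z + 16 / d * cabs z); last by field; rewrite gt_eqF.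
    by apply: lerD; apply: gb; [rewrite hd|rewrite cabs0 ltW].
have := @cabs_increment R (fun w => f w - l0 * w) 0 z (512 / d ^+ 2 * cabs z).
rewrite add0r mulr0 subr0 (_ : 2 * (512 / d ^+ 2 * cabs z) * cabs z = 1024 / d ^+ 2 * cabs z ^+ 2); last by field; rewrite gt_eqF.
rewrite (_ : f z - l0 * z - f 0 = f z - f 0 - l0 * z); last by ring.
apply=> t /andP[t0 t1]; rewrite add0r.
have tz : cabs (t%:C * z) <= cabs z.
  by rewrite cabsM cabs_real ger0_norm// ler_piMl ?cabs_ge0.
have [|l Hl] := Hf (t%:C * z).
  by apply: le_lt_trans tz _; apply: lt_trans zd4 _; lra.
exists (l - l0 * 1); last by rewrite mulr1; exact: D Hl.
by apply: cderivB => //; apply: cderivZ; exact: cderiv_id.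
Qed.

End cauchy_estimates.

(** * The Euclidean norm *)

Section enorm_theory.
Variables (R : realType) (n : nat).
Local Notation C := R[i].
Local Notation Cn := 'rV[R[i]]_n.
Implicit Types (z w h : Cn) (l mu : C).

Lemma enorm_ge0 z : 0 <= enorm z. Proof. exact: sqrtr_ge0. Qed.

Lemma sqr_enorm z : enorm z ^+ 2 = \sum_j cabs (z 0 j) ^+ 2.
Proof. by rewrite sqr_sqrtr// sumr_ge0// => j _; exact: sqr_ge0. Qed.

Lemma enormZ l z : enorm (l *: z) = cabs l * enorm z.
Proof.
apply/eqP; rewrite -(@eqrXn2 _ 2)// ?mulr_ge0 ?enorm_ge0 ?cabs_ge0//.
rewrite exprMn !sqr_enorm mulr_sumr; apply/eqP/eq_bigr => j _.
by rewrite mxE cabsM exprMn.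
Qed.

Lemma enorm0 : enorm (0 : Cn) = 0.
Proof. by rewrite -(scale0r (0 : Cn)) enormZ cabs0 mul0r. Qed.

Lemma enormN z : enorm (- z) = enorm z.
Proof. by rewrite -scaleN1r enormZ cabsN cabs1 mul1r. Qed.

Lemma cabs_le_enorm z j : cabs (z 0 j) <= enorm z.
Proof.
rewrite -(@ler_pXn2r _ 2)// ?nnegrE ?enorm_ge0 ?cabs_ge0// sqr_enorm.
by rewrite (bigD1 j)//= lerDl sumr_ge0// => k _; exact: sqr_ge0.
Qed.

Lemma enorm_eq0 z : enorm z = 0 -> z = 0.
Proof.
move=> z0; apply/rowP => j; rewrite mxE; apply/eqP.
by rewrite -cabs_eq0 eq_le cabs_ge0 andbT -z0 cabs_le_enorm.
Qed.

(** Cauchy-Schwarz, by expanding the sum of the squares (|w| |z_j| - |z| |w_j|)^2. The result is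
    then divided by |z| |w|, whence the two null cases. *)
Lemma sum_cabs_mul_le z w :
  \sum_j cabs (z 0 j) * cabs (w 0 j) <= enorm z * enorm w.
Proof.
have [/enorm_eq0->|z0] := eqVneq (enorm z) 0.
  rewrite big1 ?mulr_ge0 ?enorm_ge0// => j _.
  by rewrite mxE cabs0 mul0r.
have [/enorm_eq0->|w0] := eqVneq (enorm w) 0.
  rewrite big1 ?mulr_ge0 ?enorm_ge0// => j _.
  by rewrite (_ : (0 : Cn) 0 j = 0) ?mxE// cabs0 mulr0.
have zw : 0 < enorm z * enorm w by rewrite mulr_gt0// lt_def ?z0 ?w0 enorm_ge0.
rewrite -(ler_pM2l zw) -(@ler_pM2l _ 2)//.
have : 0 <= \sum_j (enorm w * cabs (z 0 j) - enorm z * cabs (w 0 j)) ^+ 2.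
  by rewrite sumr_ge0// => j _; exact: sqr_ge0.
rewrite (_ : \sum_j _ = 2 * (enorm z * enorm w * (enorm z * enorm w)) -
    2 * (enorm z * enorm w * \sum_j cabs (z 0 j) * cabs (w 0 j))); first lra.
rewrite (_ : 2 * (enorm z * enorm w * (enorm z * enorm w)) =
  enorm w ^+ 2 * enorm z ^+ 2 + enorm z ^+ 2 * enorm w ^+ 2); last by ring.
rewrite [X in _ * X + _]sqr_enorm [X in _ + _ * X]sqr_enorm !mulr_sumr -big_split -sumrB /=.
by apply: eq_bigr => j _; ring.
Qed.

Lemma enormD z w : enorm (z + w) <= enorm z + enorm w.
Proof.
rewrite -(@ler_pXn2r _ 2)// ?nnegrE ?addr_ge0 ?enorm_ge0// sqr_enorm.
apply: (@le_trans _ _ (\sum_j (cabs (z 0 j) + cabs (w 0 j)) ^+ 2)).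
  apply: ler_sum => j _; rewrite ler_pXn2r ?nnegrE ?addr_ge0 ?cabs_ge0//.
  by rewrite mxE; exact: cabsD.
rewrite (_ : \sum_j _ = enorm z ^+ 2 + enorm w ^+ 2 +
    2 * \sum_j cabs (z 0 j) * cabs (w 0 j)).
  by have := sum_cabs_mul_le z w; rewrite sqrrD; lra.
rewrite !sqr_enorm mulr_sumr -!big_split /=.
by apply: eq_bigr => j _; ring.
Qed.

Lemma enormB z w : enorm (z - w) = enorm (w - z).
Proof. by rewrite -enormN opprB. Qed.

Lemma enorm_ler_sum z : enorm z <= \sum_j cabs (z 0 j).
Proof.
rewrite -(@ler_pXn2r _ 2)// ?nnegrE ?enorm_ge0 ?sumr_ge0//; last first.
  by move=> j _; exact: cabs_ge0.
rewrite sqr_enorm expr2 mulr_suml; apply: ler_sum => j _.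
rewrite expr2 ler_wpM2l ?cabs_ge0// (bigD1 j)//= lerDl sumr_ge0// => k _.
exact: cabs_ge0.
Qed.

(** Differentiability refers to the max norm on rows, with values in [R[i]], while the ball refers
    to [enorm]; this and the next two lemmas allow passage between them. *)
Lemma cabs_le_mx_norm z j : (cabs (z 0 j))%:C <= `|z|.
Proof.
suff : `|z 0 j| <= mx_norm z by [].
rewrite mx_normE -[leLHS]nngE num_le.
exact: (le_bigmax _ (fun i : 'I_1 * 'I_n => `|z i.1 i.2|%:nng) (0, j)).
Qed.

Lemma mx_norm_le_enorm z : `|z| <= (enorm z)%:C.
Proof.
suff : mx_norm z <= (enorm z)%:C by [].
have [->|/mx_norm_neq0[[i j] /= ->]] := eqVneq (mx_norm z) 0.
  by rewrite ler0c enorm_ge0.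
by rewrite normc_cabs lecR ord1 cabs_le_enorm.
Qed.

Lemma enorm_le_mx_norm z : (enorm z)%:C <= n%:R * `|z|.
Proof.
apply: (@le_trans _ _ (\sum_j cabs (z 0 j))%:C); first by rewrite lecR enorm_ler_sum.
rewrite rmorph_sum /=; apply: (@le_trans _ _ (\sum_(j < n) `|z|)).
  by apply: ler_sum => j _; exact: cabs_le_mx_norm.
by rewrite sumr_const card_ord mulr_natl lexx.
Qed.

End enorm_theory.

(** * One variable estimates on complex lines *)

Section slices.
Variables (R : realType) (n : nat).
Local Notation C := R[i].
Local Notation Cn := 'rV[R[i]]_n.
Implicit Types (phi : Cn -> C) (z w h : Cn) (l mu : C) (r : R).

Lemma gtc0_real (e : C) : 0 < e -> e = (Re e)%:C /\ 0 < Re e.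
Proof.
by case: e => a b; rewrite ltcE /= => /andP[/eqP -> ?].
Qed.

Lemma differentiable_cderiv phi z h l : differentiable phi (z + l *: h) ->
  cderiv (fun mu => phi (z + mu *: h)) l ('d phi (z + l *: h) h).
Proof.
move=> /diff_locallyP[_ /eqaddoP H] e e0.
have c0 : 0 < 1 + enorm h by rewrite ltr_wpDr ?enorm_ge0.
have e1 : 0 < (e / (1 + enorm h))%:C by rewrite ltcR divr_gt0.
have := H _ e1; rewrite -nbhs_nearE => /nbhs_ballP[d d0 Hd].
have [dE dR] := gtc0_real d0; rewrite dE in Hd.
exists (Re d / (1 + enorm h)) => [|mu]; first by rewrite divr_gt0.
rewrite ltr_pdivlMr// => mud.
have muh : `|mu *: h| <= (cabs mu * enorm h)%:C by rewrite -enormZ; exact: mx_norm_le_enorm.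
have /Hd : ball (0 : Cn) (Re d)%:C (mu *: h).
  rewrite -ball_normE /= sub0r normrN; apply: le_lt_trans muh _; rewrite ltcR.
  apply: le_lt_trans mud; rewrite ler_wpM2l ?cabs_ge0// lerDr//.
rewrite /= !fctE /= /shift => {}Hd.
have E : phi (mu *: h + (z + l *: h)) - (phi (z + l *: h) + 'd phi (z + l *: h) (mu *: h)) =
  phi (z + (l + mu) *: h) - phi (z + l *: h) - 'd phi (z + l *: h) h * mu.
  rewrite linearZ /= [_ * mu]mulrC (_ : z + (l + mu) *: h = mu *: h + (z + l *: h)).
    by rewrite opprD addrA.
  by rewrite scalerDl addrA addrC.
have {}Hd : (cabs (phi (z + (l + mu) *: h) - phi (z + l *: h) - 'd phi (z + l *: h) h * mu))%:C <=
  (e / (1 + enorm h))%:C * (cabs mu * enorm h)%:C.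
  rewrite -E; apply: le_trans Hd _; apply: ler_wpM2l muh.
  by rewrite ler0c divr_ge0 ?ltW.
rewrite -rmorphM /= lecR in Hd; apply: le_trans Hd _.
rewrite (_ : _ * (_ * _) = e * cabs mu * (enorm h / (1 + enorm h))); last by field; rewrite gt_eqF.
by rewrite ler_piMr ?mulr_ge0 ?cabs_ge0 ?ltW// ltr_pdivrMr// mul1r ltrDr.
Qed.

Lemma diff_coord phi z h :
  'd phi z h = \sum_j 'd phi z (delta_mx 0 j) * h 0 j.
Proof.
rewrite {1}(row_sum_delta h) linear_sum; apply: eq_bigr => j _.
by rewrite linearZ /= mulrC.
Qed.

Lemma unit_ball0 : unit_ball (0 : Cn).
Proof. by rewrite /unit_ball /= enorm0. Qed.

Lemma schur_classP phi : schur_class phi <->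
  (forall z, unit_ball z -> differentiable phi z) /\
  (forall z, unit_ball z -> cabs (phi z) <= 1).
Proof.
split=> [[[dphi ubphi] s1]|[dphi phi1]].
  split => // z bz; apply: le_trans s1.
  by apply: ub_le_sup => //; exists z.
have ub1 : ubound [set cmod (phi z) | z in @unit_ball R n] 1.
  by move=> _ [z bz <-]; exact: phi1.
split; first by split => //; exists 1.
by apply: ge_sup => //; exists (cmod (phi 0)); exists 0 => //; exact: unit_ball0.
Qed.

Lemma schur_sup_norm phi : schur_class phi ->
  forall z, unit_ball z -> cabs (phi z) <= sup_norm phi.
Proof. by move=> [[_ ubphi] _] z bz; apply: ub_le_sup => //; exists z. Qed.

(* The one variable estimates applied on the complex line through [z] and
   [z + h], which meets the ball in a disc of radius at least
   [(1 - |z|) / |h|] around [z]. *)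
Lemma schur_taylor phi z h : schur_class phi -> unit_ball z -> h != 0 ->
  [/\ cabs ('d phi z h) <= 8 * enorm h / (1 - enorm z),
    enorm h < (1 - enorm z) / 2 ->
      cabs (phi (z + h) - phi z) <= 16 * enorm h / (1 - enorm z) &
    enorm h < (1 - enorm z) / 4 ->
      cabs (phi (z + h) - phi z - 'd phi z h) <= 1024 * (enorm h / (1 - enorm z)) ^+ 2].
Proof.
move=> /schur_classP[dphi phi1] bz h0.
have hp : 0 < enorm h.
  by rewrite lt_def enorm_ge0 andbT; apply: contra h0 => /eqP/enorm_eq0/eqP.
have d0 : 0 < 1 - enorm z by rewrite subr_gt0.
set d := 1 - enorm z in d0 *.
have bl l : cabs l < d / enorm h -> unit_ball (z + l *: h).
  rewrite ltr_pdivlMr// => lh; rewrite /unit_ball /=.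
  by apply: le_lt_trans (enormD _ _) _; rewrite enormZ -ltrBrDl.
have [|l lh|l lh||H1 H2 H3] := @holo_taylor1 R (fun l => phi (z + l *: h)) (d / enorm h) ('d phi z h).
- by rewrite divr_gt0.
- by eexists; apply: differentiable_cderiv; apply: dphi; exact: bl.
- by apply: phi1; exact: bl.
- have := @differentiable_cderiv phi z h 0; rewrite scale0r addr0; apply.
  exact: dphi.
have hd : enorm h / d = (d / enorm h)^-1 by rewrite invf_div.
split.
- by rewrite -mulrA hd.
- move=> hd2; have := H2 1 0; rewrite scale0r scale1r addr0 subr0 cabs1 cabs0 mulr1 -mulrA hd.
  apply; last by rewrite !divr_gt0.
  by rewrite mulrAC ltr_pdivlMr// mul1r.
- move=> hd4; have := H3 1; rewrite scale0r scale1r addr0 cabs1 !mulr1 expr1n mulr1 hd exprVn.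
  by apply; rewrite mulrAC ltr_pdivlMr// mul1r.
Qed.

Lemma schur_lipschitz phi z w : schur_class phi -> unit_ball z ->
  enorm (w - z) < (1 - enorm z) / 2 ->
  cabs (phi w - phi z) <= 16 * enorm (w - z) / (1 - enorm z).
Proof.
move=> sphi bz wz; have [/subr0_eq ->|wz0] := eqVneq (w - z) 0.
  by rewrite !subrr cabs0 enorm0 mulr0 mul0r.
have [_ H _] := schur_taylor sphi bz wz0.
by have := H wz; rewrite [z + _]addrC subrK.
Qed.

(** The quadratic remainder is o(h), so the linear form with coefficients D is the differential.
    Holomorphy of limits of Schur functions is read off from an inequality in this way. *)
Lemma differentiable_taylor phi z (D : 'I_n -> C) (K r : R) : 0 < r ->
  (forall h, enorm h < r ->
     cabs (phi (z + h) - phi z - \sum_j D j * h 0 j) <= K * enorm h ^+ 2) ->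
  differentiable phi z.
Proof.
move=> r0 H.
pose L h : C := \sum_j D j * h 0 j.
have Llin : linear L.
  move=> a u v; rewrite /L scaler_sumr -big_split /=; apply: eq_bigr => j _.
  by rewrite !mxE /= mulrDr; congr (_ + _); rewrite mulrCA.
pose LM := GRing.isLinear.Build _ _ _ _ L Llin.
pose LL : {linear Cn -> C} := HB.pack L LM.
have LLc : continuous LL.
  apply: bounded_linear_continuous; apply/linear_boundedP.
  exists (\sum_j cabs (D j))%:C; split; first by rewrite complex_real.
  move=> k /ltW Mk v; apply: le_trans (ler_wpM2r (normr_ge0 _) Mk).
  rewrite rmorph_sum mulr_suml; apply: le_trans (ler_norm_sum _ _ _) _.
  apply: ler_sum => j _; rewrite normrM; apply: ler_pM => //.
  exact: cabs_le_mx_norm.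
have LLo : phi \o shift z = cst (phi z) + LL +o_ (0 : Cn) id.
  apply/eqaddoP => e e0; have [eE eR] := gtc0_real e0; rewrite eE.
  (* [N] bounds [enorm] by the max norm; adding 1 keeps both [N] and [K'] positive, also for n = 0
     or K <= 0. *)
  pose N : R := 1 + n%:R; have N0 : 0 < N by rewrite ltr_wpDr.
  pose K' := 1 + `|K|; have K0 : 0 < K' by rewrite ltr_wpDr.
  apply/nbhs_ballP; exists (Num.min (r / N) (Re e / (K' * N ^+ 2)))%:C.
    by rewrite /= ltcR lt_min !divr_gt0// mulr_gt0// exprn_gt0.
  move=> h; rewrite -ball_normE /= sub0r normrN => hr.
  have hreal : `|h| \is Num.real by exact: normr_real.
  have hE : `|h| = (Re `|h|)%:C by rewrite RRe_real.
  have h0 : 0 <= Re `|h| by rewrite -ler0c -hE.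
  have hN : enorm h <= N * Re `|h|.
    rewrite -lecR; apply: le_trans (enorm_le_mx_norm h) _.
    rewrite [in leLHS]hE rmorphM /= ler_wpM2r ?ler0c//.
    by rewrite /N rmorphD rmorph1 rmorph_nat lerDr.
  rewrite hE ltcR lt_min in hr; move: hr => /andP[hr1 hr2].
  have {}H : cabs (phi (z + h) - phi z - L h) <= K * enorm h ^+ 2.
    apply: H; apply: le_lt_trans hN _; by rewrite mulrC -ltr_pdivlMr.
  rewrite !fctE /= /shift.
  rewrite (_ : phi (h + z) - (phi z + L h) = phi (z + h) - phi z - L h); last first.
    by rewrite [h + z]addrC opprD addrA.
  rewrite normc_cabs hE -rmorphM /= lecR; apply: le_trans H _.
  apply: (@le_trans _ _ (K' * (N * Re `|h|) ^+ 2)).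
    apply: (@le_trans _ _ (K' * enorm h ^+ 2)).
      apply: ler_wpM2r; first exact: sqr_ge0.
      by rewrite /K'; have := ler_norm K; lra.
    by rewrite ler_pM2l// ler_pXn2r ?nnegrE ?enorm_ge0// mulr_ge0// ltW.
  rewrite exprMn mulrA expr2 mulrA ler_wpM2r//.
  by rewrite -ler_pdivlMl ?mulr_gt0 ?exprn_gt0// mulrC ltW.
apply/diff_locallyP; rewrite (diff_unique LLc LLo); split => //.
Qed.

End slices.

(** * Compactness of the Schur class *)

Section complex_topology.
Variable R : realType.
Local Notation C := R[i].

Lemma nbhs_cabsP (z : C) (P : set C) : nbhs z P <->
  exists2 d : R, 0 < d & forall w, cabs (w - z) < d -> P w.
Proof.
split=> [/nbhs_ballP[d d0 Hd]|[d d0 Hd]].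
- have [dE dR] := gtc0_real d0; exists (Re d) => // w wz; apply: Hd.
  by rewrite -ball_normE /= dE normc_cabs ltcR cabsB.
- apply/nbhs_ballP; exists d%:C; first by rewrite /= ltcR.
  move=> w; rewrite -ball_normE /= normc_cabs ltcR cabsB; exact: Hd.
Qed.

Lemma cvg_cabsP T (F : set_system T) (FF : Filter F) (f : T -> C) (l : C) :
  f x @[x --> F] --> l <->
  forall e : R, 0 < e -> \forall x \near F, cabs (f x - l) <= e.
Proof.
split=> [H e e0|H].
  suff /H : nbhs l [set w | cabs (w - l) <= e] by [].
  by apply/nbhs_cabsP; exists e => // w /ltW.
move=> P /nbhs_cabsP[d d0 Hd]; rewrite /nbhs /=.
have d2 : 0 < d / 2 by rewrite divr_gt0.
near=> x; apply: Hd; apply: (@le_lt_trans _ _ (d / 2)); first by near: x; exact: H.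
by rewrite ltr_pdivrMr// ltr_pMr// ltr1n.
Unshelve. all: by end_near. Qed.

Lemma continuous_lip (T : topologicalType) (G : T -> C) (p : C -> R) :
  (forall z w, `|p z - p w| <= cabs (z - w)) -> continuous G ->
  continuous (fun x => p (G x)).
Proof.
move=> pl Gc x; apply/cvgrPdist_le => e e0.
have /cvg_cabsP /(_ _ e0) := Gc x; apply: filterS => y H.
by rewrite distrC; exact: le_trans (pl _ _) H.
Qed.

Lemma cabs_lip (z w : C) : `|cabs z - cabs w| <= cabs (z - w).
Proof.
rewrite ler_norml; apply/andP; split.
  by have := cabsD (w - z) z; rewrite subrK cabsB; lra.
by have := cabsD (z - w) w; rewrite subrK; lra.
Qed.

Lemma continuous_sumC (T : topologicalType) (I : Type) (r : seq I) (G : I -> T -> C) :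
  (forall i, continuous (G i)) -> continuous (fun x => \sum_(i <- r) G i x).
Proof.
move=> Gc; elim: r => [|i r IH] x.
  by under eq_fun do rewrite big_nil; exact: cvg_cst.
by under eq_fun do rewrite big_cons; apply: cvgD; [exact: Gc|exact: IH].
Qed.

Lemma continuousB_C (T : topologicalType) (G H : T -> C) :
  continuous G -> continuous H -> continuous (fun x => G x - H x).
Proof. by move=> Gc Hc x; apply: cvgB; [exact: Gc|exact: Hc]. Qed.

Lemma continuousMr_C (T : topologicalType) (G : T -> C) (c : C) :
  continuous G -> continuous (fun x => G x * c).
Proof. by move=> Gc x; apply: cvgM; [exact: Gc|exact: cvg_cst]. Qed.

(** A square rather than a disc: it is the image of a product of two segments, hence compact. *)
Definition box (b : R) : set C := [set z | `|Re z| <= b /\ `|Im z| <= b].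

Lemma compact_box b : compact (box b).
Proof.
rewrite (_ : box b = (fun p : R * R => p.1 +i* p.2) @` (`[- b, b] `*` `[- b, b])).
  apply: continuous_compact; last by apply: compact_setX; exact: segment_compact.
  apply: continuous_subspaceT => -[x y]; apply/cvg_cabsP => e e0.
  have e2 : 0 < e / 2 by rewrite divr_gt0.
  have hx0 : fst p @[p --> (x, y)] --> x by exact: cvg_fst.
  have hy0 : snd p @[p --> (x, y)] --> y by exact: cvg_snd.
  move/cvgrPdist_le in hx0; move/cvgrPdist_le in hy0.
  apply: filterS2 (hx0 _ e2) (hy0 _ e2) => -[x' y'] /= hx hy.
  apply: le_trans (cabs_le_ReIm _) _; rewrite !cReImE /= (splitr e).
  by apply: lerD; rewrite distrC.
apply/seteqP; split=> [z [hr hi]|_ [[x y] [/= hx hy] <-]].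
  by exists (Re z, Im z); rewrite /= ?in_itv /= -?ler_norml//; case: z {hr hi}.
by move: hx hy; rewrite !in_itv /= -!ler_norml.
Qed.

End complex_topology.

Section schur_compact.
Variables (R : realType) (n : nat).
Local Notation C := R[i].
Local Notation Cn := 'rV[R[i]]_n.
Implicit Types (z h : Cn).

(* A point of this product lists the values ([None]) and the partial derivatives
   ([Some j]) of a function at all points: with the derivatives as coordinates,
   holomorphy with the uniform Taylor estimate is a pointwise closed condition. *)
Definition jet_space := prod_topology (fun _ : Cn * option 'I_n => C).

(** The derivative bound of [schur_taylor] for a unit vector. The absolute value keeps it
    nonnegative off the ball, where the jets of interest are set to 0. *)
Definition jet_bound (i : Cn * option 'I_n) : R :=
  if i.2 is None then 1 else `|8 / (1 - enorm i.1)|.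

Definition taylor_rest z h (F : jet_space) : C :=
  F (z + h, None) - F (z, None) - \sum_j F (z, Some j) * h 0 j.

(** Differentiability is not imposed as such: the Taylor inequality forces the [Some j] coordinates
    to be the partial derivatives inside the ball. *)
Definition schur_jets : set jet_space :=
  [set F | forall i, box (jet_bound i) (F i)] `&`
  ([set F | forall z, unit_ball z -> cabs (F (z, None)) <= 1] `&`
   [set F | forall p, unit_ball p.1 /\ enorm p.2 < (1 - enorm p.1) / 4 ->
     cabs (taylor_rest p.1 p.2 F) <= 1024 * (enorm p.2 / (1 - enorm p.1)) ^+ 2]).

Lemma continuous_jet i : continuous (fun F : jet_space => F i).
Proof. by move=> F; exact: (@proj_continuous _ _ i F). Qed.

Lemma continuous_taylor_rest z h : continuous (taylor_rest z h).
Proof.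
rewrite /taylor_rest.
apply: (@continuousB_C _ jet_space (fun F => F (z + h, None) - F (z, None))
  (fun F => \sum_j F (z, Some j) * h 0 j)).
- apply: (@continuousB_C _ jet_space (fun F => F (z + h, None)) (fun F => F (z, None)));
    exact: continuous_jet.
- apply: (@continuous_sumC _ jet_space _ _ (fun j F => F (z, Some j) * h 0 j)) => j.
  apply: (@continuousMr_C _ jet_space (fun F => F (z, Some j))); exact: continuous_jet.
Qed.

Lemma closed_cabs_le (G : jet_space -> C) (c : R) : continuous G ->
  closed [set F | cabs (G F) <= c].
Proof.
move=> Gc; apply: (@closed_comp _ _ (fun F => cabs (G F)) [set x | x <= c]).
  by move=> F _; apply: continuous_lip => //; exact: cabs_lip.
exact: closed_le.
Qed.

(** This plays the role of Montel's theorem, for pointwise convergence of jets. Tychonoff's theorem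
    makes the product of boxes compact, and each remaining condition involves finitely many
    coordinates, hence is closed. *)
Lemma compact_schur_jets : compact schur_jets.
Proof.
apply: compact_closedI; 
  first by apply: (@tychonoff _ (fun=> C) (fun i => box (jet_bound i))) => i; exact: compact_box.
apply: closedI.
- rewrite (_ : mkset _ = \bigcap_(z in @unit_ball R n) [set F | cabs (F (z, None)) <= 1]).
    by apply: closed_bigI => z _; apply: (closed_cabs_le (G := fun F => F (z, None)));
      exact: continuous_jet.
  by apply/seteqP; split.
- rewrite (_ : mkset _ = \bigcap_(p in [set p | unit_ball p.1 /\ enorm p.2 < (1 - enorm p.1) / 4])
    [set F | cabs (taylor_rest p.1 p.2 F) <= 1024 * (enorm p.2 / (1 - enorm p.1)) ^+ 2]).
    by apply: closed_bigI => p _; apply: (closed_cabs_le (G := taylor_rest p.1 p.2));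
      exact: continuous_taylor_rest.
  by apply/seteqP; split.
Qed.

Lemma schur_jets_schur F : schur_jets F -> schur_class (fun z => F (z, None)).
Proof.
move=> [_ [F1 FT]]; apply/schur_classP; split => // z bz.
have d0 : 0 < 1 - enorm z by rewrite subr_gt0.
apply: (@differentiable_taylor _ _ _ _ (fun j => F (z, Some j)) (1024 / (1 - enorm z) ^+ 2)
  ((1 - enorm z) / 4)); first by rewrite divr_gt0.
move=> h hd; apply: le_trans (FT (z, h) _) _ => //=.
by rewrite exprMn exprVn mulrA mulrAC.
Qed.

Lemma schur_jet_of (phi : Cn -> C) : schur_class phi ->
  exists2 F, schur_jets F & forall z, unit_ball z -> F (z, None) = phi z.
Proof.
move=> sphi; have /schur_classP[dphi phi1] := sphi.
(* Off the ball [phi] is arbitrary, so 0 is put there to respect the boxes. *)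
pose F (i : Cn * option 'I_n) : C := if i.2 is Some j then
  if `[< unit_ball i.1 >] then 'd phi (i.1 : Cn) (delta_mx 0 j : Cn) else 0
  else if `[< unit_ball i.1 >] then phi i.1 else 0.
have FE z : unit_ball z -> F (z, None) = phi z by move=> bz; rewrite /F /= asboolT.
have boxc (z : C) r : cabs z <= r -> box r z.
  by move=> zr; split; apply: le_trans zr; [exact: normr_Re|exact: normr_Im].
exists (F : jet_space) => //; split; [|split].
- move=> [z [j|]]; apply: boxc; rewrite /jet_bound /F /=; case: asboolP => bz; rewrite ?cabs0//.
    have d0 : 0 < 1 - enorm z by rewrite subr_gt0.
    have e1 : enorm (delta_mx 0 j : Cn) <= 1.
      rewrite -(@ler_pXn2r _ 2)// ?nnegrE ?enorm_ge0// sqr_enorm (bigD1 j)//= big1.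
        by rewrite mxE !eqxx cabs1 expr1n addr0.
      by move=> k kj; rewrite mxE (negPf kj) andbF cabs0 expr0n.
    have dn0 : delta_mx 0 j != 0 :> Cn.
      by apply/eqP => /rowP/(_ j); rewrite !mxE !eqxx => /eqP; rewrite oner_eq0.
    have [H _ _] := schur_taylor sphi bz dn0; apply: le_trans H _.
    rewrite ger0_norm; last by rewrite divr_ge0// ltW.
    rewrite ler_pM2r ?invr_gt0//; lra.
  exact: phi1.
- by move=> z bz; rewrite FE//; exact: phi1.
- move=> [z h] /= [bz hz]; rewrite /taylor_rest.
  have bzh : unit_ball (z + h).
    rewrite /unit_ball /=; apply: le_lt_trans (enormD _ _) _.
    by move: bz hz; rewrite /unit_ball /=; lra.
  rewrite !FE//.
  have [->|h0] := eqVneq h 0.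
    rewrite addr0 subrr big1; last by move=> j _; rewrite mxE mulr0.
    by rewrite subr0 cabs0; apply: mulr_ge0; [exact: ler0n|exact: sqr_ge0].
  have [_ _ H] := schur_taylor sphi bz h0; have := H hz; rewrite diff_coord.
  by rewrite /F /= asboolT.
Qed.

End schur_compact.

(** * Extremal interpolants *)

Section extremal.
Variables (R : realType) (n : nat).
Local Notation C := R[i].
Local Notation Cn := 'rV[R[i]]_n.
Implicit Types (z h e : Cn) (s : seq Cn) (phi psi p : Cn -> C).

Lemma enorm_delta (j : 'I_n) : enorm (delta_mx 0 j : Cn) = 1.
Proof.
apply/eqP; rewrite -(@eqrXn2 _ 2)// ?enorm_ge0// sqr_enorm (bigD1 j)//= big1.
  by rewrite mxE !eqxx cabs1 expr1n addr0.
by move=> k kj; rewrite mxE (negPf kj) andbF cabs0 expr0n.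
Qed.

(** A product of affine functions, one per node y: some coordinate distinguishes e from y, and (z_j
    - y_j) / (e_j - y_j) vanishes at y and equals 1 at e. *)
Lemma separating_fun s e : e \notin s -> exists p (M : R),
  [/\ forall z, differentiable p z, forall z, unit_ball z -> cabs (p z) <= M,
      p e = 1 & forall z, z \in s -> p z = 0].
Proof.
elim: s => [_|y s IH].
  exists (fun=> 1), 1; split => // z _.
  by rewrite cabs1.
rewrite inE negb_or => /andP[ey /IH[p [M [dp pM pe ps]]]].
have [j ej] : exists j, e 0 j != y 0 j.
  apply/existsP; move: ey; apply: contraR; rewrite negb_exists => /forallP H.
  by apply/eqP/rowP => j; apply/eqP; move: (H j); rewrite negbK.
pose a z : C := (z 0 j - y 0 j) * (e 0 j - y 0 j)^-1.
exists (fun z => a z * p z), ((1 + cabs (y 0 j)) / cabs (e 0 j - y 0 j) * M).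
split => [z|z bz||z].
- apply: differentiableM; last exact: dp.
  apply: differentiableM; last exact: differentiable_cst.
  apply: differentiableB; last exact: differentiable_cst.
  exact: differentiable_coord.
- rewrite !cabsM cabsV; apply: ler_pM; rewrite ?mulr_ge0 ?invr_ge0 ?cabs_ge0//; last exact: pM.
  rewrite ler_wpM2r ?invr_ge0 ?cabs_ge0//; apply: le_trans (cabsBD _ _) _.
  by rewrite lerD2r (le_trans (cabs_le_enorm z j))// ltW.
- by rewrite /a divff ?mul1r// subr_eq0.
- rewrite inE => /predU1P[->|/ps ->]; last by rewrite mulr0.
  by rewrite /a subrr !mul0r.
Qed.

Lemma schur_scale phi (eta : R) : 0 <= eta <= 1 -> schur_class phi ->
  schur_class (fun z => eta%:C * phi z).
Proof.
move=> /andP[e0 e1] /schur_classP[dphi phi1]; apply/schur_classP; split=> z bz.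
  by apply: differentiableM; [exact: differentiable_cst|exact: dphi].
by rewrite cabsM cabs_real ger0_norm// mulr_ile1 ?cabs_ge0// phi1.
Qed.

(** Pigeonhole: the points with j-th coordinate c / (k + 1), for k up to the size of s, are distinct
    and outnumber s. *)
Lemma exists_small_node s (j : 'I_n) (c : R) : 0 < c ->
  exists2 t : R, 0 < t <= c & t%:C *: (delta_mx 0 j : Cn) \notin s.
Proof.
move=> c0; pose g k : Cn := (c / k.+1%:R)%:C *: delta_mx 0 j.
have g_inj : injective g.
  move=> k l /rowP/(_ j); rewrite !mxE !eqxx !mulr1 => /complexI /eqP.
  rewrite (inj_eq (mulfI (lt0r_neq0 c0))) (inj_eq invr_inj) eqr_nat => /eqP[].
  by [].
have [/allP H|/allPn[_ /mapP[k _ ->] ks]] := boolP (all (mem s) [seq g k | k <- iota 0 (size s).+1]).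
  have := @uniq_leq_size _ [seq g k | k <- iota 0 (size s).+1] s.
  by rewrite size_map size_iota ltnn (map_inj_uniq g_inj) iota_uniq => /(_ isT H).
exists (c / k.+1%:R) => //; rewrite divr_gt0//= ler_pdivrMr//.
by apply: ler_peMr; [exact: ltW|rewrite ler1n].
Qed.

(* An extra node [e] close to [0] is added, and the value at [e] is pushed to
   the boundary of the set of admissible values: the data are then extremal. *)
Lemma extremal_interpolant phi (eta : R) s : (1 <= n)%N -> 0 <= eta < 1 ->
  schur_class phi -> (forall z, z \in s -> unit_ball z) ->
  exists2 psi, extremal_class psi & forall z, z \in s -> psi z = eta%:C * phi z.
Proof.
move=> hn /andP[eta0 eta1] sphi sb.
(* With 0 as a node, every competitor has modulus at most [eta] at 0; [undup] makes the nodes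
   distinct. *)
pose s0 := undup (0 :: s).
have s0b z : z \in s0 -> unit_ball z.
  by rewrite mem_undup inE => /predU1P[->|/sb//]; exact: unit_ball0.
have zs0 : 0 \in s0 by rewrite mem_undup mem_head.
(* The bound 1/4 allows the Lipschitz estimate at 0, of constant 16; the other one gives 16 |e| <=
   (1 - eta) / 2, so the value at e has modulus at most (1 + eta) / 2 < 1. *)
pose c := Num.min 4^-1 ((1 - eta) / 32).
have c0 : 0 < c by rewrite lt_min invr_gt0 ltr0n divr_gt0// subr_gt0.
have [t /andP[t0 tc] es0] := exists_small_node s0 (Ordinal hn) c0.
set e : Cn := _ *: _ in es0.
have en : enorm e = t by rewrite enormZ enorm_delta mulr1 cabs_real gtr0_norm.
move: tc; rewrite le_min => /andP[t4 t32].
have eb : unit_ball e by rewrite /unit_ball /= en; lra.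
(* The interpolation equations are written as inequalities [<= 0] so that [closed_cabs_le]
   applies. *)
pose K : set (jet_space R n) := @schur_jets R n `&`
  [set F : jet_space R n | forall z, z \in s0 -> cabs (F (z, None) - eta%:C * phi z) <= 0].
have cK : compact K.
  apply: compact_closedI; first exact: compact_schur_jets.
  rewrite (_ : mkset _ = \bigcap_(z in [set` s0])
     [set F : jet_space R n | cabs (F (z, None) - eta%:C * phi z) <= 0]).
    apply: closed_bigI => z _.
    apply: (closed_cabs_le (G := fun F => F (z, None) - eta%:C * phi z)).
    apply: (@continuousB_C _ (jet_space R n) (fun F => F (z, None)) (fun=> _)).
      exact: continuous_jet.
    exact: cst_continuous.
  by apply/seteqP; split.
have KP psi : schur_class psi -> (forall z, z \in s0 -> psi z = eta%:C * phi z) ->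
    exists2 F : jet_space R n, K F & forall z, unit_ball z -> F (z, None) = psi z.
  move=> spsi E; have [F HF FE] := schur_jet_of spsi.
  exists F => //; split => // z zs; rewrite FE ?E ?subrr ?cabs0//.
  exact: s0b.
have seta : schur_class (fun z => eta%:C * phi z) by apply: schur_scale; rewrite ?eta0 ?ltW.
have K0 : K !=set0 by have [F KF _] := KP _ seta (fun z _ => erefl); exists F.
have [|F] := @compact_EVT_max _ R (fun F : jet_space R n => Re (F (e, None))) K K0 cK.
  apply: continuous_subspaceT; apply: continuous_lip; first exact: Re_lip.
  exact: continuous_jet.
rewrite inE => KF Fmax.
pose psi z := F (z, None).
have spsi : schur_class psi by case: KF => /schur_jets_schur.
have psiE z : z \in s0 -> psi z = eta%:C * phi z.
  move=> zs; case: KF => _ /(_ _ zs) H; apply/eqP; rewrite -subr_eq0 -cabs_eq0.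
  by rewrite eq_le cabs_ge0 andbT.
have phi1 z : unit_ball z -> cabs (phi z) <= 1 by move/schur_classP: sphi => [_]; exact.
have psi0 z : z \in s0 -> cabs (psi z) <= eta.
  move=> zs; rewrite psiE// cabsM cabs_real ger0_norm// ler_piMr// phi1//.
  exact: s0b.
have psie : cabs (psi e) < 1.
  have := schur_lipschitz (w := e) spsi (unit_ball0 R n); rewrite subr0 enorm0 subr0 en divr1.
  move=> /(_ _)/wrap[]; first lra.
  have := cabsD (psi e - psi 0) (psi 0); rewrite subrK; have := psi0 _ zs0; lra.
exists psi; last first.
  by move=> z zs; apply: psiE; rewrite mem_undup inE zs orbT.
split => //; pose L := e :: s0.
have Lu : uniq L by rewrite /L cons_uniq es0 undup_uniq.
have Lb z : z \in L -> unit_ball z by rewrite inE => /predU1P[->|/s0b].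
have nthL (i : 'I_(size L)) : nth 0 L i \in L by exact: mem_nth.
exists (size L), (fun i => nth 0 L i), (fun i => psi (nth 0 L i)); split => //.
  split => [i k /eqP|i|i]; first by rewrite nth_uniq// => /eqP/val_inj.
  - exact: Lb.
  - rewrite cabsE; have := nthL i; rewrite inE => /predU1P[-> //|/psi0].
    by move=> /le_lt_trans; apply.
split; first by exists psi.
move=> chi schi chiE; apply/eqP; rewrite eq_le (proj2 schi) /=; rewrite leNgt; apply/negP => chi1.
have chiL z : z \in L -> chi z = psi z.
  by move=> zL; have := chiE (Ordinal (etrans (index_mem z L) zL)); rewrite /= nth_index.
have [p [M [dp pM pe ps]]] := separating_fun es0.
pose M' := 1 + `|M|; have M'0 : 0 < M' by rewrite ltr_wpDr.
(* The perturbation [ep * p] has modulus at most [ep * M'], which is exactly the room that [chi]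
   leaves below 1, and it raises the real part at e by [ep]. *)
pose ep := (1 - sup_norm chi) / M'.
have ep0 : 0 < ep by rewrite divr_gt0// subr_gt0.
have schi2 : schur_class (fun z => chi z + ep%:C * p z).
  have /schur_classP[dchi _] := schi.
  apply/schur_classP; split=> z bz.
    apply: differentiableD; first exact: dchi.
    by apply: differentiableM; [exact: differentiable_cst|exact: dp].
  apply: le_trans (cabsD _ _) _; rewrite cabsM cabs_real gtr0_norm//.
  have h1 := schur_sup_norm schi bz.
  have : ep * cabs (p z) <= ep * M'.
    rewrite ler_pM2l//; apply: le_trans (pM z bz) _.
    by rewrite /M'; have := ler_norm M; lra.
  by rewrite {2}/ep divfK ?gt_eqF//; move: h1; lra.
have [z zs|F2 KF2 F2E] := KP _ schi2.
  by rewrite ps// mulr0 addr0 chiL ?psiE// inE zs orbT.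
have := Fmax F2; rewrite inE => /(_ KF2); rewrite F2E// pe mulr1 chiL ?mem_head// cReImE /=.
by rewrite -/(psi e); lra.
Qed.

End extremal.

(** * Locally uniform approximation *)

Section approximation.
Variables (R : realType) (n : nat).
Local Notation C := R[i].
Local Notation Cn := 'rV[R[i]]_n.
Implicit Types (z h e : Cn) (phi psi : Cn -> C).

(** The 2N + 1 values k/N - 1 form a mesh of step 1/N on [-1, 1] for each real coordinate. Such
    points may lie outside the ball, whence the filter in [grid]. *)
Definition grid_point N (f : {ffun 'I_n -> 'I_(N.*2).+1 * 'I_(N.*2).+1}) : Cn :=
  \row_j (((f j).1%:R / N%:R - 1) +i* ((f j).2%:R / N%:R - 1)).

(** Rounding down each of the 2n real coordinates costs at most 1/N, and [enorm] is at most the sum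
    of the moduli of the coordinates. *)
Lemma grid_near N z : (0 < N)%N -> unit_ball z ->
  exists f : {ffun 'I_n -> 'I_(N.*2).+1 * 'I_(N.*2).+1},
    enorm (grid_point f - z) <= (2 * n%:R) / N%:R.
Proof.
move=> N0 bz; have NR : (0 : R) < N%:R by rewrite ltr0n.
have round (x : R) : `|x| <= 1 -> exists k : 'I_(N.*2).+1, `|k%:R / N%:R - 1 - x| <= N%:R^-1.
  rewrite ler_norml => /andP[x1 x2]; pose y := (x + 1) * N%:R.
  have y0 : 0 <= y by apply: mulr_ge0; [lra|exact: ltW].
  have /andP[ty yt] := truncn_itv y0.
  have k2 : (Num.truncn y < (N.*2).+1)%N.
    rewrite ltnS -(ler_nat R); apply: le_trans ty _.
    by rewrite -muln2 natrM /y mulrC ler_pM2l//; lra.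
  exists (Ordinal k2) => /=.
  rewrite (_ : _ - x = (Num.truncn y)%:R / N%:R - y / N%:R); last by rewrite /y; field; rewrite gt_eqF.
  rewrite -mulrBl normrM normfV (gtr0_norm NR) ler_piMl ?invr_ge0//.
  rewrite ler_norml; apply/andP; split; move: ty yt; rewrite -natr1; lra.
have c1 j : cabs (z 0 j) <= 1 by apply: le_trans (cabs_le_enorm z j) _; exact: ltW.
have /choice[a Ha] : forall j, exists k : 'I_(N.*2).+1, `|k%:R / N%:R - 1 - Re (z 0 j)| <= N%:R^-1.
  by move=> j; apply: round; apply: le_trans (normr_Re _) _.
have /choice[b Hb] : forall j, exists k : 'I_(N.*2).+1, `|k%:R / N%:R - 1 - Im (z 0 j)| <= N%:R^-1.
  by move=> j; apply: round; apply: le_trans (normr_Im _) _.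
exists [ffun j => (a j, b j)]; apply: le_trans (enorm_ler_sum _) _.
apply: (@le_trans _ _ (\sum_(j < n) 2 / N%:R)); last first.
  rewrite sumr_const card_ord (_ : 2 * n%:R / N%:R = 2 / N%:R * n%:R); last by rewrite mulrAC.
  by rewrite mulr_natr lexx.
apply: ler_sum => j _; rewrite !mxE ffunE /=; apply: le_trans (cabs_le_ReIm _) _.
rewrite !cReImE /= (_ : 2 / N%:R = N%:R^-1 + N%:R^-1); last by ring.
exact: lerD.
Qed.

Definition grid N : seq Cn :=
  [seq z <- [seq grid_point f | f : {ffun 'I_n -> 'I_(N.*2).+1 * 'I_(N.*2).+1}] | enorm z < 1].

Lemma enorm_lip z h : `|enorm z - enorm h| <= enorm (z - h).
Proof.
rewrite ler_norml; apply/andP; split.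
  by have := enormD (h - z) z; rewrite subrK enormB; lra.
by have := enormD (z - h) h; rewrite subrK; lra.
Qed.

Lemma continuous_enorm : continuous (@enorm R n).
Proof.
move=> z; apply/(@cvgrPdist_le _ _ _ (nbhs z) (nbhs_filter z)) => e e0.
have d0 : 0 < e / (n%:R + 1) by rewrite divr_gt0// ltr_wpDl.
apply/nbhs_ballP; exists (e / (n%:R + 1))%:C; first by rewrite /= ltcR.
move=> h; rewrite -ball_normE /= => zh; apply: le_trans (enorm_lip _ _) _.
rewrite -lecR; apply: le_trans (enorm_le_mx_norm _) _.
apply: (@le_trans _ _ (n%:R * (e / (n%:R + 1))%:C)); first by rewrite ler_wpM2l ?ler0n// ltW.
rewrite -(rmorph_nat (real_complex R)) -rmorphM /= lecR mulrCA ger_pMr//.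
by rewrite ler_pdivrMr ?ltr_wpDl// mul1r lerDl.
Qed.

Lemma compact_ball_radius (K : set Cn) : compact K -> K `<=` @unit_ball R n ->
  exists2 r : R, r < 1 & forall z, K z -> enorm z <= r.
Proof.
move=> cK KB; have [->|K0] := eqVneq K set0; first by exists 0.
have [||c] := @compact_EVT_max _ R (@enorm R n) K _ cK.
- exact/set0P.
- exact: (continuous_subspaceT continuous_enorm).
rewrite inE => Kc cmax; exists (enorm c); first exact: KB.
by move=> z Kz; apply: cmax; rewrite inE.
Qed.

Lemma uniform_cabsP (K : set Cn) (f_ : nat -> Cn -> C) (f : Cn -> C) :
  (forall e : R, 0 < e -> \forall k \near \oo, forall z, K z -> cabs (f_ k z - f z) <= e) ->
  {uniform K, f_ @ \oo --> f}.
Proof.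
move=> H P /uniform_nbhs[E [entE EP]].
move: entE; rewrite -entourage_from_ballE => -[d d0 dE].
have [dR d1] := gtc0_real d0.
have d2 : 0 < Re d / 2 by rewrite divr_gt0.
have := H _ d2; rewrite /nbhs /=; apply: filterS => k Hk; apply: EP => z Kz.
apply: dE; rewrite /= -ball_normE /= dR normc_cabs ltcR cabsB.
by apply: le_lt_trans (Hk _ Kz) _; rewrite ltr_pdivrMr// ltr_pMr// ltr1n.
Qed.

(** A grid point y lies within d = 2n/(k + 1) of z, with 1 - |y| >= (1 - r)/2, so [phi] and [psi]
    each vary by at most 32 d/(1 - r) between y and z. At y itself they differ by at most 1/(k +
    1). *)
Lemma grid_interpolation_close phi psi (k : nat) z (r : R) :
  schur_class phi -> schur_class psi ->
  (forall y, y \in grid k.+1 -> psi y = (1 - k.+1%:R^-1)%:C * phi y) ->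
  r < 1 -> enorm z <= r -> (2 * n%:R) / k.+1%:R < (1 - r) / 4 ->
  cabs (psi z - phi z) <= (128 * n%:R / (1 - r) + 1) / k.+1%:R.
Proof.
move=> sphi spsi E r1 zr small.
have bz : unit_ball z by apply: le_lt_trans zr _.
have [f yz] := grid_near (ltn0Sn k) bz.
set y := grid_point f in yz; set d := 2 * n%:R / k.+1%:R in small yz.
have yr : enorm y <= r + d.
  by rewrite -(subrK z y) (le_trans (enormD _ _))// addrC lerD.
have by_ : unit_ball y by rewrite /unit_ball /=; lra.
have yg : y \in grid k.+1.
  by rewrite mem_filter [_ < _]by_ /=; apply: map_f; exact: mem_enum.
have d0 : 0 <= d by rewrite divr_ge0 ?mulr_ge0 ?ler0n.
have L chi : schur_class chi -> cabs (chi z - chi y) <= 32 * d / (1 - r).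
  move=> schi; have zy : enorm (z - y) <= d by rewrite enormB.
  have r0 : 0 < 1 - r by rewrite subr_gt0.
  have y0 : 0 < 1 - enorm y by rewrite subr_gt0.
  have := schur_lipschitz schi by_ (w := z) => /(_ _)/wrap[].
    by apply: le_lt_trans zy _; rewrite ltr_pdivlMr//; move: small; lra.
  move=> /le_trans; apply; rewrite ler_pdivrMr//.
  rewrite (_ : 32 * d / (1 - r) * (1 - enorm y) = 16 * d * (2 * (1 - enorm y) / (1 - r))); last first.
    by field; rewrite gt_eqF.
  apply: (@le_trans _ _ (16 * d)); first by rewrite ler_pM2l.
  rewrite ler_peMr ?mulr_ge0// ler_pdivlMr// mul1r; move: small; lra.
have H1 := L _ spsi; have H2 := L _ sphi.
have H3 : cabs (psi y - phi y) <= k.+1%:R^-1.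
  rewrite E// -[X in _ - X]mul1r -mulrBl cabsM -(rmorph1 (real_complex R)) -rmorphB /=.
  rewrite addrAC subrr add0r cabs_real normrN ger0_norm ?invr_ge0// ler_piMr ?invr_ge0//.
  by move/schur_classP: sphi => [_]; apply.
rewrite (_ : psi z - phi z = (psi z - psi y) + (psi y - phi y) - (phi z - phi y)); last by ring.
apply: le_trans (cabsBD _ _) _; apply: le_trans (lerD (cabsD _ _) (lexx _)) _.
rewrite (_ : _ / k.+1%:R = 32 * d / (1 - r) + k.+1%:R^-1 + 32 * d / (1 - r)); last first.
  by rewrite /d; field; rewrite nat1r pnatr_eq0 /= subr_eq0 eq_sym lt_eqF.
by rewrite !lerD.
Qed.

(** Convergence is stated on closed balls of radius r < 1, a form that serves both for compact sets
    and for the slices through the sphere. *)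
Lemma extremal_sequence phi : (1 <= n)%N -> schur_class phi ->
  exists phi_ : nat -> Cn -> C, (forall k, extremal_class (phi_ k)) /\
    forall r : R, r < 1 -> forall e : R, 0 < e ->
      \forall k \near \oo, forall z, enorm z <= r -> cabs (phi_ k z - phi z) <= e.
Proof.
move=> hn sphi.
have /choice[phi_ phiP] : forall k, exists psi, extremal_class psi /\
    forall y, y \in grid k.+1 -> psi y = (1 - k.+1%:R^-1)%:C * phi y.
  move=> k; have [|||psi ? ?] := @extremal_interpolant R n phi (1 - k.+1%:R^-1) (grid k.+1) hn.
  - have k0 : (0 : R) < k.+1%:R^-1 by rewrite invr_gt0.
    have k1 : k.+1%:R^-1 <= 1 :> R by rewrite invf_le1 ?ler1n.
    by rewrite subr_ge0 k1 /= ltrBlDr ltrDl k0.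
  - exact: sphi.
  - by move=> z; rewrite mem_filter => /andP[].
  - by exists psi.
exists phi_; split=> [k|r r1 e e0]; first by case: (phiP k).
have r0 : 0 < 1 - r by rewrite subr_gt0.
have big (c M : R) : 0 < c -> \forall k \near \oo, M / k.+1%:R < c.
  move=> c0; have [N NP] : exists N : nat, `|M| / c < N%:R.
    by exists (Num.truncn (`|M| / c)).+1; exact: truncnS_gt.
  exists N => // k /= Nk; apply: (@le_lt_trans _ _ (`|M| / k.+1%:R)).
    by rewrite ler_wpM2r ?invr_ge0// ler_norm.
  rewrite ltr_pdivrMr ?ltr0n// mulrC -ltr_pdivrMr//; apply: lt_le_trans NP _.
  by rewrite ler_nat leqW.
near=> k => z zr.
have [[sk _] gk] := phiP k.
apply: le_trans (grid_interpolation_close sphi sk gk r1 zr _) _.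
  by near: k; apply: big; rewrite divr_gt0.
by apply: ltW; near: k; exact: big.
Unshelve. all: by end_near. Qed.

End approximation.

(** * Functions on the half plane *)

Section half_plane.
Variable R : realType.
Local Notation C := R[i].
Local Notation mu := (@lebesgue_measure R).
Variable u : C -> C.
Hypothesis Hu : forall w : C, Re w < 0 -> exists l, cderiv u w l.
Hypothesis u1 : forall w : C, Re w < 0 -> cabs (u w) <= 1.
Implicit Types (a b c s t : R).

Lemma half_plane_int a b s : s < 0 -> cintegrable a b (fun y => u (s +i* y)).
Proof.
move=> s0; apply: (@crect_inty _ u s s); last by rewrite lexx.
by move=> w [/andP[_ ws] _]; apply: Hu; exact: le_lt_trans ws s0.
Qed.

Lemma half_plane_interval a b s t : s <= t -> t < 0 -> a <= b ->
  cabs (ci a b (fun y => u (t +i* y)) - ci a b (fun y => u (s +i* y))) <= 4 * (t - s).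
Proof.
move=> st t0 ab.
have Hr : holo_on (crect s t a b) u.
  by move=> w [/andP[_ ws] _]; apply: Hu; exact: le_lt_trans ws t0.
have := goursat st ab Hr; rewrite /rect ciB; last 2 first.
- by apply: (crect_intx Hr); rewrite lexx.
- by apply: (crect_intx Hr); rewrite lexx andbT.
rewrite ciB; [|exact: half_plane_int|apply: half_plane_int; exact: le_lt_trans t0].
move=> /eqP; rewrite addrC addr_eq0 => /eqP E.
set D := _ - _ in E *.
have -> : cabs D = cabs ('i * D) by rewrite cabsM cabs_imag normr1 mul1r.
rewrite E cabsN.
rewrite -ciB; last 2 first.
- by apply: (crect_intx Hr); rewrite lexx.
- by apply: (crect_intx Hr); rewrite lexx andbT.
rewrite (_ : 4 * (t - s) = 2 * 2 * (t - s)); last by ring.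
apply: ci_bound => //.
  by apply: cintegrableB; apply: (crect_intx Hr); rewrite ?lexx ?ab ?andbT.
move=> x /andP[_ xt]; apply: le_trans (cabsBD _ _) _.
by rewrite (_ : 2 = 1 + 1 :> R)//; apply: lerD; apply: u1 => /=; exact: le_lt_trans t0.
Qed.

Hypothesis per : forall x, u (x +i* (- pi)) = u (x +i* pi).

Definition h2prod s t : C := ci (- pi) pi (fun y => u (s +i* y) * (u (t +i* y))^*)%C.

Let pi_le : - pi <= pi :> R. Proof. by rewrite ge0_cp// pi_ge0. Qed.

(* The function [w |-> u w * conj (u (s + t - conj w))] is holomorphic and periodic,
   so its integrals over vertical segments agree. *)
Lemma h2prod_diag s t : s < 0 -> t < 0 -> h2prod s t = h2prod ((s + t) / 2) ((s + t) / 2).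
Proof.
move=> s0 t0; pose V w := (u w * (u ((s + t)%:C - (w^*)))^*)%C.
have VE x y : V (x +i* y) = (u (x +i* y) * (u ((s + t - x) +i* y))^*)%C.
  rewrite /V; congr (_ * (u _)^*)%C.
  by apply: complex_eq; rewrite !cReImE /= ?opprK ?add0r.
have HV (w : C) : s + t < Re w < 0 -> exists l, cderiv V w l.
  move=> /andP[w1 w0]; have [l Hl] := Hu w0.
  have [l' Hl'] : exists l, cderiv u ((s + t)%:C - (w^*)%C) l.
    by apply: Hu; case: (w) w1 => a b /= ; rewrite subr_lt0.
  have H1 : cderiv (fun z => u ((s + t)%:C - z)) (w^*)%C (l' * (0 - 1)).
    apply: (cderiv_comp (g := fun z => (s + t)%:C - z)) => //.
    by apply: cderivB; [exact: cderiv_cst|exact: cderiv_id].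
  by eexists; exact: cderivM Hl (cderiv_conj H1).
have perV x : V (x +i* (- pi)) = V (x +i* pi) by rewrite !VE !per.
have HVr a b : s + t < a -> b < 0 -> holo_on (crect a b (- pi) pi) V.
  move=> sa b0 w [/andP[aw wb] _]; apply: HV.
  by rewrite (lt_le_trans sa aw) (le_lt_trans wb b0).
have E a b : s + t < a -> a <= b -> b < 0 ->
    ci (- pi) pi (fun y => V (a +i* y)) = ci (- pi) pi (fun y => V (b +i* y)).
  by move=> sa ab b0; apply: ci_periodic => //; exact: HVr.
have E1 : h2prod s t = ci (- pi) pi (fun y => V (s +i* y)).
  by apply: eq_ci => y _; rewrite VE; congr (_ * (u (_ +i* _))^*)%C; ring.
have E2 : h2prod ((s + t) / 2) ((s + t) / 2) = ci (- pi) pi (fun y => V (((s + t) / 2) +i* y)).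
  by apply: eq_ci => y _; rewrite VE; congr (_ * (u (_ +i* _))^*)%C; field.
rewrite E1 E2; have [st|ts] := leP s ((s + t) / 2).
- by apply: E => //; lra.
- by apply/esym; apply: E; lra.
Qed.

Definition h2norm s : R := Re (h2prod s s).

Definition h2dist s t : R := \int[mu]_(y in `[- pi, pi]) cabs (u (s +i* y) - u (t +i* y)) ^+ 2.

Lemma rcts_conj (g : R -> C) x : rcts g x -> rcts (fun y => (g y)^*)%C x.
Proof.
move=> H e /H[d d0 Hd]; exists d => // t /Hd.
by rewrite -[cabs (_ - _)]cabs_conjc rmorphB.
Qed.

Lemma rctsM (g h : R -> C) x : rcts g x -> rcts h x -> rcts (fun y => g y * h y) x.
Proof.
move=> Hg Hh e e0.
pose A := 1 + cabs (g x) + cabs (h x).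
have A0 : 0 < A by rewrite /A -addrA ltr_wpDr// addr_ge0 ?cabs_ge0.
have e1 : 0 < Num.min 1 (e / A) by rewrite lt_min ltr01 divr_gt0.
have [d d0 Hd] := Hg _ e1; have [d' d'0 Hd'] := Hh _ e1.
exists (Num.min d d') => [|t]; first by rewrite lt_min d0.
rewrite lt_min => /andP[/Hd + /Hd']; rewrite !le_min => /andP[h1 h2] /andP[h3 h4].
rewrite (_ : _ - _ = (g (x + t) - g x) * (h (x + t) - h x) +
  (g x * (h (x + t) - h x) + (g (x + t) - g x) * h x)); last by ring.
apply: le_trans (cabsD _ _) _; apply: le_trans (lerD (lexx _) (cabsD _ _)) _; rewrite !cabsM.
apply: (@le_trans _ _ (1 * (e / A) + (cabs (g x) * (e / A) + e / A * cabs (h x)))).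
  by apply: lerD; [apply: ler_pM|apply: lerD; apply: ler_pM]; rewrite ?cabs_ge0.
rewrite (_ : _ + _ = A * (e / A)); last by rewrite /A; ring.
by rewrite mulrCA divff ?mulr1// gt_eqF.
Qed.

Lemma half_plane_rcts s y : s < 0 -> rcts (fun y => u (s +i* y)) y.
Proof. by move=> s0; have [l /cderiv_rctsy] := @Hu (s +i* y) s0. Qed.

Lemma h2prod_int s t a b : s < 0 -> t < 0 ->
  cintegrable a b (fun y => u (s +i* y) * (u (t +i* y))^*)%C.
Proof.
move=> s0 t0; apply: cintegrable_rcts => y _; apply: rctsM.
  exact: half_plane_rcts.
by apply: rcts_conj; exact: half_plane_rcts.
Qed.

(** Expanding |u(s + iy) - u(t + iy)|^2, both cross terms equal the squared norm on the middle line
    by [h2prod_diag]. *)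
Lemma h2distE s t : s < 0 -> t < 0 ->
  h2dist s t = h2norm s + h2norm t - 2 * h2norm ((s + t) / 2).
Proof.
move=> s0 t0.
rewrite (_ : h2dist s t = Re (h2prod s s - h2prod s t + (h2prod t t - h2prod t s))).
  rewrite (h2prod_diag s0 t0) (h2prod_diag t0 s0) [t + s]addrC !cReImE /h2norm; ring.
rewrite /h2prod -(ciB (h2prod_int _ _ s0 s0) (h2prod_int _ _ s0 t0)).
rewrite -(ciB (h2prod_int _ _ t0 t0) (h2prod_int _ _ t0 s0)) -ciD; last 2 first.
- by apply: cintegrableB; exact: h2prod_int.
- by apply: cintegrableB; exact: h2prod_int.
rewrite /h2dist /ci /=; apply: eq_Rintegral => y _.
rewrite sqr_cabs; case: (u _) => a b; case: (u _) => c d /=; ring.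
Qed.

Lemma h2dist_ge0 s t : 0 <= h2dist s t.
Proof. by apply: Rintegral_ge0 => y _; exact: sqr_ge0. Qed.

Lemma h2norm_bound s : s < 0 -> h2norm s <= 4 * pi.
Proof.
move=> s0; apply: le_trans (ler_norm _) _; apply: le_trans (normr_Re _) _.
rewrite (_ : 4 * pi = 2 * 1 * (pi - - pi)); last by ring.
apply: ci_bound => //; first exact: h2prod_int.
move=> y _; rewrite cabsM cabs_conjc mulr_ile1 ?cabs_ge0//; exact: u1.
Qed.

Lemma h2norm_midpoint s t : s < 0 -> t < 0 ->
  2 * h2norm ((s + t) / 2) <= h2norm s + h2norm t.
Proof. by move=> s0 t0; have := h2dist_ge0 s t; rewrite h2distE//; lra. Qed.

(* A midpoint convex function bounded above near [-oo] is nondecreasing. *)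
Lemma h2norm_homo s t : s <= t -> t < 0 -> h2norm s <= h2norm t.
Proof.
move=> st t0; rewrite leNgt; apply/negP => mst.
set h := t - s; have h0 : 0 <= h by rewrite subr_ge0.
set d := h2norm s - h2norm t; have d0 : 0 < d by rewrite subr_gt0.
have neg (k : nat) : t - k%:R * h < 0.
  by apply: le_lt_trans t0; rewrite lerBlDr lerDl mulr_ge0.
(* By midpoint convexity a drop of d from s to t repeats at every further step of length h to the
   left, so the norm would exceed 4 pi. *)
have H (k : nat) : d <= h2norm (t - k.+1%:R * h) - h2norm (t - k%:R * h).
  elim: k => [|k IH]; first by rewrite mul1r mul0r subr0 /h subKr.
  have := h2norm_midpoint (neg k.+2) (neg k).
  rewrite (_ : (_ + _) / 2 = t - k.+1%:R * h); last first.
    by rewrite -[k.+2%:R]natr1 -[k.+1%:R]natr1; field.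
  by move: IH; lra.
have K (k : nat) : h2norm t + k%:R * d <= h2norm (t - k%:R * h).
  elim: k => [|k IH]; first by rewrite !mul0r subr0 addr0.
  have := H k; rewrite -[in X in _ + X * d]natr1 mulrDl mul1r.
  by move: IH; lra.
have [k kP] : exists k : nat, (4 * pi - h2norm t) / d < k%:R.
  by exists (Num.truncn ((4 * pi - h2norm t) / d)).+1; exact: truncnS_gt.
have := K k; have := h2norm_bound (neg k).
by move: kP; rewrite ltr_pdivrMr//; lra.
Qed.

(** The squared norms increase to a supremum M as s tends to 0. Once two of them and the one on the
    middle line exceed M - 16^-k, [h2distE] bounds the distance by 2 * 16^-k, a rate fast enough for
    summable increments. *)
Lemma h2_subsequence : exists s : nat -> R,
  [/\ forall k, s k < 0, s @ \oo --> 0 &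
      forall k, h2dist (s k) (s k.+1) <= 2 * (16^-1) ^+ k].
Proof.
pose E := [set h2norm s | s in [set s : R | s < 0]].
have supE : has_sup E.
  split; first by exists (h2norm (-1)); exists (-1) => //=; rewrite ltrN10.
  by exists (4 * pi) => _ [s s0 <-]; exact: h2norm_bound.
pose M := sup E.
have mM s : s < 0 -> h2norm s <= M by move=> s0; apply: ub_le_sup => //; [exact: supE.2|exists s].
have /choice[s sP] : forall k : nat, exists s : R, [/\ s < 0, - k.+1%:R^-1 <= s &
    M - (16^-1) ^+ k <= h2norm s].
  move=> k; have e0 : 0 < (16^-1) ^+ k :> R by rewrite exprn_gt0// invr_gt0.
  have [_ [t /= t0 <-] tM] := sup_adherent e0 supE.
  have k0 : - k.+1%:R^-1 < 0 :> R by rewrite oppr_lt0 invr_gt0.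
  (* Moving right to at least -1/(k + 1) forces convergence to 0, and monotonicity preserves the
     lower bound on the norm. *)
  exists (Num.max t (- k.+1%:R^-1)); split; first by rewrite gt_max t0.
    by rewrite le_max lexx orbT.
  apply: le_trans (ltW tM) _; apply: h2norm_homo; first by rewrite le_max lexx.
  by rewrite gt_max t0.
exists s; split=> [k||k]; first by case: (sP k).
- apply: (@squeeze_cvgr _ _ _ _ (fun k => - k.+1%:R^-1) (fun=> 0)).
  + by near=> k; have [/ltW -> -> _] := sP k.
  + rewrite -oppr0; apply: cvgN; exact: cvg_harmonic.
  + exact: cvg_cst.
- have [s0 _ sM] := sP k; have [t0 _ tM] := sP k.+1.
  rewrite h2distE//.
  have e1 : (16^-1 : R) ^+ k.+1 <= 16^-1 ^+ k.
    by rewrite exprS ler_piMl// ?exprn_ge0// ?invr_ge0// invf_le1// ler1n.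
  have mid : M - 16^-1 ^+ k <= h2norm ((s k + s k.+1) / 2).
    have [st|ts] := leP (s k) (s k.+1).
      by apply: le_trans sM _; apply: h2norm_homo; lra.
    apply: (@le_trans _ _ (h2norm (s k.+1))); first by move: tM e1; lra.
    by apply: h2norm_homo; lra.
  have := mM _ s0; have := mM _ t0; move: mid; lra.
Unshelve. all: by end_near. Qed.

End half_plane.

(** * Dominated convergence and almost everywhere convergence of sequences *)

Section dominated.
Context d (T : measurableType d) (R : realType) (mu : {measure set T -> \bar R}).

Lemma RintegrableD (D : set T) (f g : T -> R) : measurable D ->
  mu.-integrable D (EFin \o f) -> mu.-integrable D (EFin \o g) ->
  mu.-integrable D (EFin \o (fun x => f x + g x)).
Proof. by move=> mD fi gi; exact: (integrableD mD fi gi). Qed.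

Lemma RintegrableB (D : set T) (f g : T -> R) : measurable D ->
  mu.-integrable D (EFin \o f) -> mu.-integrable D (EFin \o g) ->
  mu.-integrable D (EFin \o (fun x => f x - g x)).
Proof. by move=> mD fi gi; exact: (integrableB mD fi gi). Qed.

Lemma RintegrableZl (D : set T) (c : R) (f : T -> R) : measurable D ->
  mu.-integrable D (EFin \o f) -> mu.-integrable D (EFin \o (fun x => c * f x)).
Proof. by move=> mD fi; exact: (integrableZl mD c fi). Qed.

Lemma Rdominated_cvg (D : set T) (f_ : nat -> T -> R) (f g : T -> R) :
  measurable D -> (forall n, measurable_fun D (f_ n)) -> measurable_fun D f ->
  {ae mu, forall x, D x -> f_ ^~ x @ \oo --> f x} ->
  mu.-integrable D (EFin \o g) ->
  (forall n x, D x -> `|f_ n x| <= g x) ->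
  \int[mu]_(x in D) f_ n x @[n --> \oo] --> \int[mu]_(x in D) f x.
Proof.
move=> mD mf_ mf fcvg ig fg.
have [|||||intf _ H] := @dominated_convergence _ _ _ mu D mD (fun n x => (f_ n x)%:E)
  (fun x => (f x)%:E) (EFin \o g).
- by move=> n; apply/measurable_EFinP; exact: mf_.
- exact/measurable_EFinP.
- apply: filterS fcvg => x + Dx => /(_ Dx) H.
  by apply: cvg_EFin; [exact: nearW|exact: H].
- exact: ig.
- by apply: aeW => x n Dx; rewrite /= lee_fin fg.
have fint : (\int[mu]_(x in D) (f x)%:E)%E \is a fin_num by exact: integrable_fin_num.
by move: H; rewrite -(fineK fint) => /fine_cvgP[].
Qed.

End dominated.

Section ae_convergence.
Variable R : realType.
Local Notation mu := (@lebesgue_measure R).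
Implicit Types (a b : R).

Lemma summable_increments_cvg (f : nat -> R) (B : R) :
  (forall N, \sum_(0 <= k < N) `|f k.+1 - f k| <= B) -> cvgn f.
Proof.
move=> fB.
have /normed_cvg : cvgn [normed series (fun k => f k.+1 - f k : R^o)].
  apply: nondecreasing_is_cvgn.
    by apply: nondecreasing_series => k _ _; exact: normr_ge0.
  by exists B => _ [N _ <-]; exact: fB.
move=> H; have -> : f = fun n => f 0%N + series (fun k => f k.+1 - f k : R^o) n.
  by apply/funext => n; rewrite seriesEnat /= telescope_sumr// addrC subrK.
by apply: is_cvgD => //; exact: is_cvg_cst.
Qed.

(** The increments g satisfy g <= 4^-k/2 + 4^k g^2/2, whose integral is at most (b - a + 1) 4^-k.
    Their sum is therefore integrable, hence finite almost everywhere, and there the sequence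
    converges absolutely by telescoping. *)
Lemma ae_cvg_of_L2_increments a b (f : nat -> R -> R) : a <= b ->
  (forall k, measurable_fun `[a, b] (f k)) ->
  (forall k y, a <= y <= b -> `|f k y| <= 1) ->
  (forall k, \int[mu]_(y in `[a, b]) `|f k.+1 y - f k y| ^+ 2 <= 2 * (16^-1) ^+ k) ->
  {ae mu, forall y, `[a, b]%classic y -> cvgn (f ^~ y)}.
Proof.
move=> ab mf f1 fI.
pose g (k : nat) (y : R) : R := `|f k.+1 y - f k y|.
have g0 k y : 0 <= g k y by exact: normr_ge0.
have mg k : measurable_fun `[a, b] (g k).
  by apply: measurableT_comp => //; apply: measurable_funB; exact: mf.
have g2 k y : a <= y <= b -> `|g k y| <= 2.
  move=> hy; rewrite normr_id; apply: le_trans (ler_normB _ _) _.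
  by rewrite (_ : 2 = 1 + 1 :> R)// lerD// f1.
have ig k : mu.-integrable `[a, b] (EFin \o g k).
  by apply: (@itv_bounded_integrable _ _ _ _ 2) => // y; exact: g2.
have ig2 k : mu.-integrable `[a, b] (EFin \o (fun y => g k y ^+ 2)).
  apply: (@itv_bounded_integrable _ _ _ _ 4); first by apply: measurable_funX; exact: mg.
  move=> y hy; rewrite normrX (_ : 4 = 2 ^+ 2 :> R); last by ring.
  by rewrite ler_pXn2r ?nnegrE// g2.
pose K := (b - a) + 1.
have K0 : 0 <= K by rewrite addr_ge0 ?subr_ge0.
have gI k : \int[mu]_(y in `[a, b]) g k y <= K * (4^-1) ^+ k.
  have q0 : 0 < 4 ^+ k :> R by rewrite exprn_gt0.
  have ic : mu.-integrable `[a, b] (EFin \o (fun _ : R => (4^-1) ^+ k / 2)).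
    by have [+ _] := cintegrable_cst a b (((4^-1) ^+ k / 2)%:C : R[i]).
  have i2 : mu.-integrable `[a, b] (EFin \o (fun y => 4 ^+ k / 2 * g k y ^+ 2)).
    by apply: RintegrableZl.
  apply: (@le_trans _ _ (\int[mu]_(y in `[a, b]) ((4^-1) ^+ k / 2 + 4 ^+ k / 2 * g k y ^+ 2))).
    apply: le_Rintegral => //; first exact: RintegrableD.
    move=> y _; rewrite exprVn -(ler_pM2r q0) mulrDl.
    rewrite (_ : (4 ^+ k)^-1 / 2 * 4 ^+ k = 2^-1); last by field; rewrite gt_eqF.
    have := sqr_ge0 (g k y * 4 ^+ k - 1); rewrite sqrrB1 expr2; lra.
  rewrite RintegralD// [X in _ + X]RintegralZl// [X in X + _]Rintegral_cst//.
  have -> : fine (mu `[a, b]) = b - a.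
    by rewrite /= lebesgue_measure_itv /= lte_fin; move: ab; rewrite le_eqVlt => /predU1P[->|->]; rewrite ?ltxx ?subrr.
  have := fI k; rewrite -(ler_pM2l q0) => H.
  have E : 4 ^+ k * (2 * 16^-1 ^+ k) = 2 * (4^-1) ^+ k :> R.
    rewrite mulrCA -exprMn (_ : 4 * 16^-1 = 4^-1 :> R)//; by field.
  rewrite E in H.
  have p0 : 0 <= (4^-1 : R) ^+ k by rewrite exprn_ge0// invr_ge0.
  have q1 : 0 <= (b - a) * (4^-1) ^+ k by rewrite mulr_ge0// subr_ge0.
  by rewrite /K; move: H; lra.
have psum N : \sum_(0 <= k < N) (4^-1 : R) ^+ k <= 2.
  suff : \sum_(0 <= k < N) (4^-1 : R) ^+ k <= 4 / 3 * (1 - (4^-1) ^+ N).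
    move/le_trans; apply; have : 0 <= (4^-1 : R) ^+ N by rewrite exprn_ge0// invr_ge0.
    by lra.
  elim: N => [|N IH]; first by rewrite big_geq// expr0 subrr mulr0 lexx.
  by rewrite big_nat_recr//= exprS; move: IH; lra.
pose G y := (\sum_(k <oo) (g k y)%:E)%E.
have mG : measurable_fun `[a, b] G.
  apply: ge0_emeasurable_sum => [k x _ _|k _]; first by rewrite lee_fin g0.
  by apply/measurable_EFinP; exact: mg.
have GI : (\int[mu]_(y in `[a, b]) G y < +oo)%E.
  rewrite integral_nneseries//; last 2 first.
  - by move=> k; apply/measurable_EFinP; exact: mg.
  - by move=> k x _; rewrite lee_fin g0.
  apply: (@le_lt_trans _ _ (K * 2)%:E); last by rewrite ltry.
  apply: lime_le; first by apply: is_cvg_nneseries => k _ _; apply: integral_ge0 => y _; rewrite lee_fin g0.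
  apply: nearW => N; apply: (@le_trans _ _ (\sum_(0 <= k < N) (K * (4^-1) ^+ k)%:E)%E).
    apply: lee_sum => k _; have := gI k; rewrite -lee_fin /Rintegral fineK//.
    exact: integrable_fin_num (ig k).
  by rewrite sumEFin lee_fin -mulr_sumr ler_wpM2l.
have iG : mu.-integrable `[a, b] G.
  apply/integrableP; split => //; apply: le_lt_trans GI.
  rewrite le_eqVlt; apply/orP; left; apply/eqP/eq_integral => y _.
  by rewrite gee0_abs//; apply: nneseries_ge0 => k _ _; rewrite lee_fin g0.
have := integrable_ae _ iG; move=> /(_ (measurable_itv _)); apply: filterS => y H /H Gfin.
apply: (@summable_increments_cvg _ (fine (G y))) => N.
rewrite -lee_fin fineK// -sumEFin; apply: nneseries_lim_ge => k _ _.
by rewrite lee_fin g0.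
Qed.

End ae_convergence.

(** * The Poisson kernel and Fatou's theorem *)

Section rect_linear.
Variable R : realType.
Local Notation C := R[i].
Implicit Types (f g : C -> C) (a b c d : R).

Definition rect_int a b c d f :=
  [/\ cintegrable a b (fun x => f (x +i* c)), cintegrable a b (fun x => f (x +i* d)),
      cintegrable c d (fun y => f (a +i* y)) & cintegrable c d (fun y => f (b +i* y))].

(** The sides avoid the interior point [w0], so the integrands are continuous. *)
Lemma rect_int_except f a b c d (w0 : C) : a < Re w0 < b -> c < Im w0 < d ->
  (forall w : C, crect a b c d w -> w != w0 -> exists l, cderiv f w l) ->
  rect_int a b c d f.
Proof.
case: w0 => p q /= /andP[ap pb] /andP[cq qd] Hf.
have ab := lt_trans ap pb; have cd := lt_trans cq qd.
split; apply: cintegrable_rcts => t /andP[t1 t2].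
- have [||l /cderiv_rctsx//] := Hf (t +i* c); first by split; rewrite /= ?t1 ?t2 ?lexx ?ltW.
  by rewrite eq_complex /= negb_and (lt_eqF cq) orbT.
- have [||l /cderiv_rctsx//] := Hf (t +i* d); first by split; rewrite /= ?t1 ?t2 ?lexx ?ltW.
  by rewrite eq_complex /= negb_and (gt_eqF qd) orbT.
- have [||l /cderiv_rctsy//] := Hf (a +i* t); first by split; rewrite /= ?t1 ?t2 ?lexx ?ltW.
  by rewrite eq_complex /= negb_and (lt_eqF ap).
- have [||l /cderiv_rctsy//] := Hf (b +i* t); first by split; rewrite /= ?t1 ?t2 ?lexx ?ltW.
  by rewrite eq_complex /= negb_and (gt_eqF pb).
Qed.

Lemma rectBZ f g a b c d (k : C) : rect_int a b c d f -> rect_int a b c d g ->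
  rect a b c d (fun w => f w - k * g w) = rect a b c d f - k * rect a b c d g.
Proof.
move=> [f1 f2 f3 f4] [g1 g2 g3 g4]; rewrite /rect.
have -> : ci a b (fun x => f (x +i* c) - k * g (x +i* c) - (f (x +i* d) - k * g (x +i* d))) =
  ci a b (fun x => (f (x +i* c) - f (x +i* d)) - k * (g (x +i* c) - g (x +i* d))).
  by apply: eq_ci => x _; ring.
have -> : ci c d (fun y => f (b +i* y) - k * g (b +i* y) - (f (a +i* y) - k * g (a +i* y))) =
  ci c d (fun y => (f (b +i* y) - f (a +i* y)) - k * (g (b +i* y) - g (a +i* y))).
  by apply: eq_ci => y _; ring.
have i1 := cintegrableB f1 f2; have j1 := cintegrableB g1 g2.
have i2 := cintegrableB f4 f3; have j2 := cintegrableB g4 g3.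
rewrite (ciB i1 (cintegrableZ k j1)) (ciZ k j1) (ciB i2 (cintegrableZ k j2)) (ciZ k j2).
by ring.
Qed.

(** Isolates the right side, which will carry the Poisson kernel, from the three remote sides, where
    the kernel is small. *)
Lemma rect_right_bound f a b c d (M : R) : a <= b -> c <= d -> rect_int a b c d f ->
  (forall x, a <= x <= b -> cabs (f (x +i* c)) <= M /\ cabs (f (x +i* d)) <= M) ->
  (forall y, c <= y <= d -> cabs (f (a +i* y)) <= M) ->
  cabs (rect a b c d f - 'i * ci c d (fun y => f (b +i* y))) <=
    4 * M * (b - a) + 2 * M * (d - c).
Proof.
move=> ab cd [f1 f2 f3 f4] fh fv; rewrite /rect [ci c d _]ciB//.
rewrite (_ : _ - _ = ci a b (fun x => f (x +i* c) - f (x +i* d)) -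
    'i * ci c d (fun y => f (a +i* y))); last by ring.
apply: le_trans (cabsBD _ _) _; apply: lerD.
- rewrite (_ : 4 * M = 2 * (2 * M)); last by ring.
  apply: ci_bound => //; first exact: cintegrableB.
  by move=> x /fh[h1 h2]; apply: le_trans (cabsBD _ _) _; lra.
- by rewrite cabsM cabs_imag normr1 mul1r; apply: ci_bound.
Qed.

Lemma ci_norm_bound (g : R -> C) a b (p : R -> R) : cintegrable a b g ->
  (@lebesgue_measure R).-integrable `[a, b] (EFin \o p) ->
  (forall x, a <= x <= b -> `|Re (g x)| + `|Im (g x)| <= p x) ->
  cabs (ci a b g) <= \int[@lebesgue_measure R]_(x in `[a, b]) p x.
Proof.
move=> [gr gi] ip gp; apply: le_trans (cabs_le_ReIm _) _; rewrite /ci /=.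
have ngr : (@lebesgue_measure R).-integrable `[a, b] (EFin \o (fun x => `|Re (g x)|)).
  exact: (integrable_norm gr).
have ngi : (@lebesgue_measure R).-integrable `[a, b] (EFin \o (fun x => `|Im (g x)|)).
  exact: (integrable_norm gi).
apply: le_trans (lerD (le_normr_Rintegral _ gr) (le_normr_Rintegral _ gi)) _ => //.
rewrite -(RintegralD _ ngr ngi)//; apply: le_Rintegral => //; first exact: RintegrableD.
Qed.

End rect_linear.

Section poisson.
Variable R : realType.
Local Notation C := R[i].
Local Notation mu := (@lebesgue_measure R).
Implicit Types (L r s y tau : R).

(** The Poisson kernel of the half plane at height r, normalized to have total mass 2 pi. *)
Definition poisson (r tau y : R) : R := 2 * r / (r ^+ 2 + (y - tau) ^+ 2).

Lemma poisson_ge0 r tau y : 0 <= r -> 0 <= poisson r tau y.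
Proof. by move=> r0; rewrite divr_ge0 ?mulr_ge0// addr_ge0 ?sqr_ge0. Qed.

Lemma poisson_den_gt0 r tau y : 0 < r -> 0 < r ^+ 2 + (y - tau) ^+ 2.
Proof. by move=> r0; rewrite ltr_wpDr ?sqr_ge0// exprn_gt0. Qed.

Lemma poisson_le r tau y : 0 < r -> poisson r tau y <= 2 / r.
Proof.
move=> r0; have d0 := poisson_den_gt0 tau y r0.
rewrite /poisson ler_pdivrMr// mulrAC ler_pdivlMr//.
have := sqr_ge0 (y - tau); lra.
Qed.

Lemma poisson_le_far r tau y m : 0 <= r -> 0 < m -> m <= `|y - tau| ->
  poisson r tau y <= 2 * r / m ^+ 2.
Proof.
move=> r0 m0 my.
have m2 : m ^+ 2 <= (y - tau) ^+ 2.
  by rewrite -[leRHS]real_normK ?num_real// ler_pXn2r ?nnegrE// ltW.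
have m3 : 0 < m ^+ 2 by rewrite exprn_gt0.
rewrite /poisson ler_pM ?mulr_ge0 ?invr_ge0 ?addr_ge0 ?sqr_ge0//.
rewrite lef_pV2 ?posrE//; last by rewrite ltr_wpDl ?sqr_ge0// (lt_le_trans m3).
by apply: le_trans m2 _; rewrite lerDr sqr_ge0.
Qed.

(** Lets the kernel at distance r - s from the line Re w = - s be replaced by the one at distance r,
    uniformly in s. *)
Lemma poisson_compare r r' tau y : 0 < r -> r / 2 <= r' -> r' <= r ->
  poisson r' tau y <= 4 * poisson r tau y.
Proof.
move=> r0 rr' r'r; have r'0 : 0 < r' by lra.
have d0 := poisson_den_gt0 tau y r0; have d'0 := poisson_den_gt0 tau y r'0.
rewrite /poisson ler_pdivrMr// mulrA mulrAC ler_pdivlMr//.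
set t := (y - tau) ^+ 2; have t0 : 0 <= t by exact: sqr_ge0.
apply: (@le_trans _ _ (2 * r * (r ^+ 2 + t))).
  by apply: ler_wpM2r; [rewrite addr_ge0// sqr_ge0|lra].
rewrite (_ : 4 * (2 * r) * _ = 2 * r * (4 * r' ^+ 2 + 4 * t)); last by ring.
apply: ler_wpM2l; first lra.
apply: lerD; last lra.
rewrite (_ : 4 * r' ^+ 2 = (2 * r') ^+ 2); last by ring.
by rewrite ler_pXn2r ?nnegrE//; lra.
Qed.

Lemma poisson_measurable r tau (D : set R) : measurable_fun D (poisson r tau).
Proof.
apply: measurable_funTS; apply: measurable_funM => //.
under eq_fun do rewrite -powR_inv1 ?addr_ge0 ?sqr_ge0//.
apply: (measurableT_comp (measurable_powR _)); apply: measurable_funD => //.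
by apply: measurable_funX; exact: measurable_funB.
Qed.

End poisson.

Section poisson_estimate.
Variable R : realType.
Local Notation C := R[i].
Local Notation mu := (@lebesgue_measure R).
Variable u : C -> C.
Hypothesis Hu : forall w : C, Re w < 0 -> exists l, cderiv u w l.
Hypothesis u1 : forall w : C, Re w < 0 -> cabs (u w) <= 1.
Implicit Types (L r s y tau : R).

(* A Poisson kernel of the half plane to the left of the point midway between
   its poles [w0] and [w1]. *)
Definition pkernel (r : R) (w0 w1 w : C) : C := (2 * r)%:C * ((w - w0) * (w1 - w))^-1.

Lemma cderiv_pkernel r (w0 w1 w : C) : w != w0 -> w != w1 ->
  exists l, cderiv (pkernel r w0 w1) w l.
Proof.
move=> h0 h1.
have n0 : (w - w0) * (w1 - w) != 0 by rewrite mulf_neq0// subr_eq0// eq_sym.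
have H1 : cderiv (fun w => w - w0) w (1 - 0).
  by apply: cderivB; [exact: cderiv_id|exact: cderiv_cst].
have H2 : cderiv (fun w => w1 - w) w (0 - 1).
  by apply: cderivB; [exact: cderiv_cst|exact: cderiv_id].
eexists; apply: cderivZ; apply: (cderiv_comp (f := fun z => z^-1) (cderivM H1 H2)).
exact: cderivV.
Qed.

(** On |y - tau| <= r, an interval of length 2r, the kernel is at least 1/r. *)
Lemma integral_poisson_ge L r tau : 0 < r -> r <= L ->
  2 <= \int[mu]_(y in `[tau - L, tau + L]) poisson r tau y.
Proof.
move=> r0 rL.
have ip a b : mu.-integrable `[a, b] (EFin \o poisson r tau).
  apply: (@itv_bounded_integrable _ _ _ _ (2 / r)); first exact: poisson_measurable.
  by move=> x _; rewrite ger0_norm ?poisson_le// poisson_ge0// ltW.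
rewrite (@Rintegral_split _ _ _ (tau - r))//; try lra.
rewrite (@Rintegral_split _ _ (tau - r) (tau + r))//; try lra.
have p0 a b : 0 <= \int[mu]_(y in `[a, b]) poisson r tau y.
  by apply: Rintegral_ge0 => y _; rewrite poisson_ge0 ?ltW.
suff : 2 <= \int[mu]_(y in `[tau - r, tau + r]) poisson r tau y.
  by move=> h; apply: ler_wpDl => //; exact: ler_wpDr.
have -> : 2 = \int[mu]_(y in `[tau - r, tau + r]) r^-1.
  rewrite Rintegral_cst// /= lebesgue_measure_itv /= lte_fin ifT; last lra.
  by rewrite -EFinD /=; field; rewrite gt_eqF.
apply: le_Rintegral => //.
  by have [] := cintegrable_cst (tau - r) (tau + r) (r^-1)%:C.
move=> y; rewrite /= in_itv /= => /andP[y1 y2].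
rewrite /poisson ler_pdivlMr ?poisson_den_gt0// ler_pdivrMl//.
have : (y - tau) ^+ 2 <= r ^+ 2.
  rewrite -[leLHS]real_normK ?num_real// ler_pXn2r ?nnegrE//; last exact: ltW.
  by rewrite ler_norml; apply/andP; split; lra.
rewrite [r * (2 * r)]mulrCA -expr2; lra.
Qed.

(** The contour integral of (u - c) K around a rectangle with right side on Re w = - s equals (u(w0)
    - c) times that of K. The latter has modulus at least 1. In the former the right side is a
    Poisson average, and the other sides cost at most 3 * 32 r / L, as |u - c| <= 3. *)
Lemma poisson_estimate tau L r s (c : C) : 0 < s -> s <= r / 2 -> 0 < L ->
  r <= L / 4 -> 32 * r / L <= 1 -> cabs c <= 2 ->
  cabs (u ((- r) +i* tau) - c) <=
    4 * \int[mu]_(y in `[tau - L, tau + L])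
      ((`|Re (u ((- s) +i* y)) - Re c| + `|Im (u ((- s) +i* y)) - Im c|) * poisson r tau y)
    + 96 * r / L.
Proof.
move=> s0 sr L0 rL rL1 c2.
pose r' := r - s; have r'0 : 0 < r' by rewrite /r'; lra.
have r'r : r' <= r by rewrite /r'; lra.
have r'2 : r / 2 <= r' by rewrite /r'; lra.
have r'L : r' <= L by lra.
have r0 : 0 < r by lra.
(* [w1] is the mirror image of [w0] in the line Re w = - s, on which K is therefore the real kernel
   [poisson r' tau]. *)
set w0 := (- r) +i* tau; pose w1 : C := (r' - s) +i* tau.
set K := pkernel r' w0 w1.
have Ra : - L < Re w0 < - s by apply/andP; split; rewrite /w0 /=; lra.
have Ia : tau - L < Im w0 < tau + L by apply/andP; split; rewrite /w0 /=; lra.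
have ab : - L <= - s by lra.
have cd : tau - L <= tau + L by lra.
set rc := crect (- L) (- s) (tau - L) (tau + L).
have rcRe (w : C) : rc w -> Re w < 0 by case=> /andP[_ h] _; lra.
have w1w (w : C) : rc w -> r' <= cabs (w1 - w).
  move=> [/andP[_ h] _]; apply: le_trans (normr_Re _); apply: le_trans (ler_norm _).
  by rewrite cReImE /w1 /=; lra.
have nw1 (w : C) : rc w -> w != w1.
  move=> hw; apply/eqP => E; have := w1w _ hw; rewrite E subrr cabs0; lra.
have HK (w : C) : rc w -> w != w0 -> exists l, cderiv K w l.
  by move=> hw ww0; apply: cderiv_pkernel => //; exact: nw1.
have HFK k (w : C) : rc w -> w != w0 -> exists l, cderiv (fun w => (u w - k) * K w) w l.
  move=> hw ww0; have [l Hl] := Hu (rcRe _ hw); have [l' Hl'] := HK _ hw ww0.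
  by eexists; exact: cderivM (cderivB Hl (cderiv_cst k w)) Hl'.
have iK : rect_int (- L) (- s) (tau - L) (tau + L) K by exact: rect_int_except HK.
have iFK : rect_int (- L) (- s) (tau - L) (tau + L) (fun w => (u w - c) * K w).
  exact: rect_int_except (HFK c).
(* The difference of the two sides is the contour integral of (u - u(w0)) K, whose singularity at
   [w0] is removable. *)
have E0 : rect (- L) (- s) (tau - L) (tau + L) (fun w => (u w - c) * K w) =
    (u w0 - c) * rect (- L) (- s) (tau - L) (tau + L) K.
  apply/eqP; rewrite -subr_eq0 -rectBZ//; apply/eqP.
  have [l Hl] : exists l, cderiv u w0 l by apply: Hu; rewrite /w0 /=; lra.
  have [d d0 Hd] := Hl 1 ltr01.
  rewrite (_ : (fun w => _) = (fun w => (u w - u w0) * K w)); last first.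
    by apply/funext => w; ring.
  (* The quotient (u - u(w0)) / (w - w0) is at most 1 + |l| within d of [w0] and at most 2/d
     elsewhere; the other factor, 2 r' / |w1 - w|, is at most 2. *)
  apply: (@goursat_except _ _ _ _ _ _ w0 (2 * (1 + cabs l + 2 / d))) => //.
    exact: HFK.
  move=> w hw; have pos : 0 <= 1 + cabs l + 2 / d.
    by rewrite !addr_ge0 ?cabs_ge0// divr_ge0// ltW.
  have [->|ww0] := eqVneq w w0.
    by rewrite subrr mul0r cabs0 mulr_ge0.
  have wp : 0 < cabs (w - w0) by rewrite cabs_gt0 subr_eq0.
  have w1p : 0 < cabs (w1 - w) by apply: lt_le_trans (w1w _ hw).
  rewrite /K /pkernel !cabsM cabsV cabsM cabs_real ger0_norm; last by rewrite mulr_ge0// ltW.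
  rewrite (_ : _ * _ = (2 * r' / cabs (w1 - w)) * (cabs (u w - u w0) / cabs (w - w0))); last first.
    by field; rewrite !gt_eqF.
  apply: ler_pM; rewrite ?divr_ge0 ?mulr_ge0 ?cabs_ge0 ?(ltW r'0)//.
    by rewrite ler_pdivrMr// ler_pM2l// w1w.
  rewrite ler_pdivrMr//; have [wd|dw] := ltP (cabs (w - w0)) d.
    have := Hd (w - w0) wd; rewrite [w0 + _]addrC subrK mul1r => h.
    rewrite -(subrK (l * (w - w0)) (u w - u w0)).
    apply: le_trans (cabsD _ _) _; rewrite cabsM !mulrDl mul1r.
    have : 0 <= 2 / d * cabs (w - w0) by rewrite mulr_ge0 ?cabs_ge0// divr_ge0// ltW.
    by move: h; lra.
  apply: (@le_trans _ _ (2 / d * d)).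
    rewrite divfK ?gt_eqF//; apply: le_trans (cabsBD _ _) _.
    rewrite (_ : 2 = 1 + 1 :> R)//; apply: lerD; apply: u1; first exact: rcRe.
    by rewrite /w0 /=; lra.
  have dp : 0 <= 2 / d by rewrite divr_ge0// ltW.
  apply: ler_pM => //; first exact: ltW.
  by rewrite lerDr addr_ge0// cabs_ge0.
(* The three remote sides are at distance at least L/2 from [w0] and at least L from [w1]. *)
have KB (w : C) : rc w -> L / 2 <= cabs (w - w0) -> L <= cabs (w1 - w) -> cabs (K w) <= 4 * r / L ^+ 2.
  move=> hw h0 h1; have L2 : 0 < L / 2 by rewrite divr_gt0.
  have L3 : 0 < L ^+ 2 by rewrite exprn_gt0.
  rewrite /K /pkernel cabsM cabsV cabsM cabs_real ger0_norm; last by rewrite mulr_ge0// ltW.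
  have p0 := lt_le_trans L2 h0; have p1 := lt_le_trans L0 h1.
  rewrite ler_pdivrMr ?mulr_gt0//.
  apply: (@le_trans _ _ (4 * r / L ^+ 2 * (L / 2 * L))).
    rewrite (_ : _ * (L / 2 * L) = 2 * r); last by field; rewrite gt_eqF.
    by lra.
  apply: ler_wpM2l; first by apply: divr_ge0; [lra|exact: ltW].
  by apply: ler_pM => //; exact: ltW.
have Kh x : - L <= x <= - s -> cabs (K (x +i* (tau - L))) <= 4 * r / L ^+ 2 /\
    cabs (K (x +i* (tau + L))) <= 4 * r / L ^+ 2.
  move=> hx; split; apply: KB; try by split; rewrite /= ?hx ?lexx ?cd.
  - apply: le_trans (normr_Im _); rewrite !cReImE /w0 /= -normrN.
    by apply: le_trans (ler_norm _); lra.
  - apply: le_trans (normr_Im _); rewrite !cReImE /w1 /=.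
    by apply: le_trans (ler_norm _); lra.
  - apply: le_trans (normr_Im _); rewrite !cReImE /w0 /=.
    by apply: le_trans (ler_norm _); lra.
  - apply: le_trans (normr_Im _); rewrite !cReImE /w1 /= -normrN.
    by apply: le_trans (ler_norm _); lra.
have Kv y : tau - L <= y <= tau + L -> cabs (K ((- L) +i* y)) <= 4 * r / L ^+ 2.
  move=> hy; apply: KB; first by split; rewrite /= ?hy ?lexx ?ab.
  - apply: le_trans (normr_Re _); rewrite !cReImE /w0 /= -normrN.
    by apply: le_trans (ler_norm _); lra.
  - apply: le_trans (normr_Re _); rewrite !cReImE /w1 /r' /=.
    by apply: le_trans (ler_norm _); lra.
have Kr y : K ((- s) +i* y) = (poisson r' tau y)%:C.
  have d0 := poisson_den_gt0 tau y r'0.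
  rewrite /K /pkernel /poisson (_ : (_ - w0) * (w1 - _) = (r' ^+ 2 + (y - tau) ^+ 2)%:C).
    by rewrite -fmorphV -rmorphM.
  by apply: complex_eq; rewrite !cReImE /w0 /w1 /r' /=; ring.
have M0 : 0 <= 4 * r / L ^+ 2 by rewrite divr_ge0 ?exprn_ge0//; lra.
(* Two horizontal sides of length at most L and a left side of length 2L give 8 L times the sup of
   the integrand. *)
have side B : 0 <= B -> 4 * (B * (4 * r / L ^+ 2)) * (- s - - L) +
    2 * (B * (4 * r / L ^+ 2)) * (tau + L - (tau - L)) <= B * (32 * r / L).
  move=> B0; apply: (@le_trans _ _ (4 * (B * (4 * r / L ^+ 2)) * L +
    2 * (B * (4 * r / L ^+ 2)) * (2 * L))).
    have BM : 0 <= B * (4 * r / L ^+ 2) by rewrite mulr_ge0.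
    by apply: lerD; (apply: ler_wpM2l; [apply: mulr_ge0 => //|lra]).
  by rewrite le_eqVlt; apply/orP; left; apply/eqP; field; rewrite gt_eqF.
have side1 := rect_right_bound ab cd iK Kh Kv.
have side3 : cabs (rect (- L) (- s) (tau - L) (tau + L) (fun w => (u w - c) * K w) -
   'i * ci (tau - L) (tau + L) (fun y => (u ((- s) +i* y) - c) * K ((- s) +i* y)))
   <= 3 * (32 * r / L).
  have uc (w : C) : rc w -> cabs (u w - c) <= 3.
    by move=> hw; apply: le_trans (cabsBD _ _) _; have := u1 (rcRe _ hw); lra.
  apply: le_trans (side 3 _) => //.
  apply: (rect_right_bound ab cd iFK).
  - have ucK (w : C) : rc w -> cabs (K w) <= 4 * r / L ^+ 2 ->
        cabs ((u w - c) * K w) <= 3 * (4 * r / L ^+ 2).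
      by move=> hw hK; rewrite cabsM; apply: ler_pM => //; [exact: cabs_ge0|exact: cabs_ge0|exact: uc].
    move=> x hx; have [h1 h2] := Kh _ hx.
    by split; apply: ucK => //; split; rewrite /= ?hx ?lexx ?cd.
  - move=> y hy; rewrite cabsM; apply: ler_pM; rewrite ?cabs_ge0 ?Kv//.
    by apply: uc; split; rewrite /= ?hy ?lexx ?ab.
(* The right side contributes at least 2 and the others at most 32 r / L <= 1. *)
have K1 : 1 <= cabs (rect (- L) (- s) (tau - L) (tau + L) K).
  have side1' : cabs (rect (- L) (- s) (tau - L) (tau + L) K -
      'i * ci (tau - L) (tau + L) (fun y => K ((- s) +i* y))) <= 1.
    apply: le_trans rL1; have := side 1 ler01; rewrite !mul1r; apply: le_trans.
    exact: side1.
  have : 2 <= cabs (ci (tau - L) (tau + L) (fun y => K ((- s) +i* y))).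
    apply: le_trans (normr_Re _); apply: le_trans (ler_norm _).
    rewrite /ci /=.
    have -> : \int[mu]_(y in `[tau - L, tau + L]) Re (K ((- s) +i* y)) =
        \int[mu]_(y in `[tau - L, tau + L]) poisson r' tau y.
      by apply: eq_Rintegral => y _; rewrite Kr.
    exact: integral_poisson_ge.
  set I := ci _ _ _ in side1' *; set Q := rect _ _ _ _ _ in side1' *.
  have -> : cabs I = cabs ('i * I) by rewrite cabsM cabs_imag normr1 mul1r.
  by have := cabsD ('i * I - Q) Q; rewrite subrK cabsB; lra.
have Bmain : cabs (ci (tau - L) (tau + L) (fun y => (u ((- s) +i* y) - c) * K ((- s) +i* y))) <=
  4 * \int[mu]_(y in `[tau - L, tau + L])
      ((`|Re (u ((- s) +i* y)) - Re c| + `|Im (u ((- s) +i* y)) - Im c|) * poisson r tau y).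
  have ius : cintegrable (tau - L) (tau + L) (fun y => u ((- s) +i* y)).
    by apply: (half_plane_int Hu); lra.
  have ip : mu.-integrable `[tau - L, tau + L] (EFin \o (fun y =>
      (`|Re (u ((- s) +i* y)) - Re c| + `|Im (u ((- s) +i* y)) - Im c|) * poisson r tau y)).
    apply: (@itv_bounded_integrable _ _ _ _ (6 * (2 / r))).
      apply: measurable_funM; last exact: poisson_measurable.
      case: ius => /(measurable_int mu)/measurable_EFinP mR /(measurable_int mu)/measurable_EFinP mI.
      by apply: measurable_funD; apply: measurableT_comp => //; exact: measurable_funB.
    move=> y hy; rewrite normrM; apply: ler_pM => //; last first.
      by rewrite ger0_norm ?poisson_le// poisson_ge0// ltW.
    have uc : cabs (u ((- s) +i* y) - c) <= 3.
      apply: le_trans (cabsBD _ _) _; have := u1 (w := (- s) +i* y).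
      by rewrite /= oppr_lt0 => /(_ s0); lra.
    have := normr_Re (u ((- s) +i* y) - c); have := normr_Im (u ((- s) +i* y) - c).
    by rewrite !cReImE ger0_norm ?addr_ge0//; lra.
  rewrite -RintegralZl//; apply: ci_norm_bound.
  - by case: iFK.
  - exact: RintegrableZl.
  - move=> y hy; rewrite Kr.
    have cmp : poisson r' tau y <= 4 * poisson r tau y by exact: poisson_compare.
    have p'0 := poisson_ge0 tau y (ltW r'0).
    move: cmp p'0; move: (poisson r' tau y) (poisson r tau y) => P' P cmp p'0.
    have -> z : (z : C) * P'%:C = (P' * Re z) +i* (P' * Im z).
      by apply: complex_eq; rewrite !cReImE /=; ring.
    rewrite /= !normrM (ger0_norm p'0) -mulrDr !cReImE mulrC mulrCA.
    by apply: ler_wpM2l => //; rewrite addr_ge0.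
apply: (@le_trans _ _ (cabs ((u w0 - c) * rect (- L) (- s) (tau - L) (tau + L) K))).
  by rewrite cabsM ler_peMr ?cabs_ge0.
rewrite -E0; set Q := rect _ _ _ _ _ in side3 *; set I := ci _ _ _ in side3 Bmain.
rewrite -(subrK ('i * I) Q); apply: le_trans (cabsD _ _) _.
rewrite [cabs ('i * I)]cabsM cabs_imag normr1 mul1r.
move: side3 Bmain; rewrite (_ : 3 * (32 * r / L) = 96 * r / L); last by field; rewrite gt_eqF.
lra.
Qed.

End poisson_estimate.

(** * Poisson averages at a point where the means tend to 0 *)

Section poisson_average.
Variable R : realType.
Local Notation mu := (@lebesgue_measure R).
Variables (psi : R -> R) (tau L B : R).
Hypothesis L0 : 0 < L.
Hypothesis mpsi : measurable_fun `[tau - L, tau + L] psi.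
Hypothesis psi0 : forall y, 0 <= psi y.
Hypothesis psiB : forall y, psi y <= B.
Implicit Types (r m y a b : R).

Let psi_int a b : tau - L <= a -> b <= tau + L ->
  mu.-integrable `[a, b] (EFin \o psi).
Proof.
move=> ha hb; apply: (@itv_bounded_integrable _ _ _ _ B).
  by apply: measurable_funS mpsi => //; apply: subset_itv; rewrite bnd_simp.
by move=> y _; rewrite ger0_norm.
Qed.

Let psiP_int r a b : 0 < r -> tau - L <= a -> b <= tau + L ->
  mu.-integrable `[a, b] (EFin \o (fun y => psi y * poisson r tau y)).
Proof.
move=> r0 ha hb; apply: (@itv_bounded_integrable _ _ _ _ (B * (2 / r))).
  apply: measurable_funM; last exact: poisson_measurable.
  by apply: measurable_funS mpsi => //; apply: subset_itv; rewrite bnd_simp.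
move=> y _; rewrite normrM !ger0_norm ?poisson_ge0 ?(ltW r0)//.
by apply: ler_pM; rewrite ?poisson_ge0 ?poisson_le ?(ltW r0).
Qed.

Let avg r m := \int[mu]_(y in `[tau - m, tau + m]) (psi y * poisson r tau y).

(** On the two added intervals |y - tau| >= m, so the kernel is at most 2 r / m^2 there. *)
Lemma poisson_annulus r m m' : 0 < r -> 0 < m -> m <= m' -> m' <= L ->
  avg r m' <= avg r m + 2 * r / m ^+ 2 * \int[mu]_(y in `[tau - m', tau + m']) psi y.
Proof.
move=> r0 m0 mm mL.
have [L1 L2] : tau - L <= tau - m' /\ tau + m' <= tau + L by split; lra.
have [m1 m2 m3] : [/\ tau - m' <= tau - m, tau - m <= tau + m & tau + m <= tau + m'] by split; lra.
have m12 := le_trans m1 m2; have m23 := le_trans m2 m3; have m13 := le_trans m1 m23.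
have Lm := le_trans L1 m1; have mL' := le_trans m3 L2.
have Lm2 := le_trans Lm m2; have mL2 := le_trans m23 L2.
have far a b : tau - L <= a -> b <= tau + L -> (forall y, a <= y <= b -> m <= `|y - tau|) ->
    \int[mu]_(y in `[a, b]) (psi y * poisson r tau y) <=
    2 * r / m ^+ 2 * \int[mu]_(y in `[a, b]) psi y.
  move=> ha hb hf; have ip := psi_int ha hb.
  rewrite -RintegralZl//; apply: le_Rintegral => //; first exact: psiP_int.
    exact: RintegrableZl.
  move=> y; rewrite /= in_itv => /hf my; rewrite mulrC ler_wpM2r//.
  exact: poisson_le_far (ltW r0) m0 my.
have h1 : \int[mu]_(y in `[tau - m', tau - m]) (psi y * poisson r tau y) <=
    2 * r / m ^+ 2 * \int[mu]_(y in `[tau - m', tau - m]) psi y.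
  apply: far => // y hy; rewrite -normrN opprB.
  by apply: le_trans (ler_norm _); move: hy; lra.
have h2 : \int[mu]_(y in `[tau + m, tau + m']) (psi y * poisson r tau y) <=
    2 * r / m ^+ 2 * \int[mu]_(y in `[tau + m, tau + m']) psi y.
  apply: far => // y hy.
  by apply: le_trans (ler_norm _); move: hy; lra.
have -> : avg r m' = \int[mu]_(y in `[tau - m', tau - m]) (psi y * poisson r tau y) +
    (avg r m + \int[mu]_(y in `[tau + m, tau + m']) (psi y * poisson r tau y)).
  rewrite /avg (@Rintegral_split _ _ (tau - m') (tau - m))//; last exact: psiP_int.
  by rewrite (@Rintegral_split _ _ (tau - m) (tau + m))//; exact: psiP_int.
have E : \int[mu]_(y in `[tau - m', tau + m']) psi y =
    \int[mu]_(y in `[tau - m', tau - m]) psi y +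
    (\int[mu]_(y in `[tau - m, tau + m]) psi y + \int[mu]_(y in `[tau + m, tau + m']) psi y).
  rewrite (@Rintegral_split _ _ (tau - m') (tau - m))//; last exact: psi_int.
  by rewrite (@Rintegral_split _ _ (tau - m) (tau + m))//; exact: psi_int.
rewrite E !mulrDr addrCA lerD2l.
apply: le_trans (lerD h1 h2) _; rewrite lerD2l lerDr.
by rewrite mulr_ge0 ?Rintegral_ge0// divr_ge0 ?exprn_ge0 ?mulr_ge0 ?(ltW m0) ?(ltW r0).
Qed.

Hypothesis psi_avg : forall e, 0 < e -> exists2 r0, 0 < r0 &
  forall r, 0 < r -> r <= r0 -> \int[mu]_(y in `[tau - r, tau + r]) psi y <= e * r.

(** Dyadic decomposition around tau: up to the scale r0 the mean condition makes the contributions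
    of successive annuli a geometric series, and beyond it the kernel is O(r). *)
Lemma poisson_average_small e : 0 < e -> exists2 d, 0 < d &
  forall r, 0 < r -> r < d ->
    \int[mu]_(y in `[tau - L, tau + L]) (psi y * poisson r tau y) <= e.
Proof.
move=> e0; pose e' := e / 20; have e'0 : 0 < e' by rewrite divr_gt0.
have [r1 r10 Hr1] := psi_avg e'0.
pose r0 := Num.min r1 L; have r00 : 0 < r0 by rewrite lt_min r10.
have r0L : r0 <= L by rewrite ge_min lexx orbT.
have r0r1 : r0 <= r1 by rewrite ge_min lexx.
have B0 : 0 <= B by apply: le_trans (psiB 0).
(* Beyond the last dyadic scale, which exceeds r0/2, the kernel is at most 8 r / r0^2 and the
   integral of psi at most 2 (B + 1) L: the product is r K. *)
pose K := 16 * (B + 1) * L / r0 ^+ 2.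
have K0 : 0 < K by rewrite !divr_gt0 ?mulr_gt0 ?exprn_gt0// ltr_wpDl.
exists (Num.min r0 (e / 2 / K)) => [|r rpos]; first by rewrite lt_min r00 /= (divr_gt0 _ K0)// divr_gt0.
rewrite lt_min => /andP[rr0 rK].
have exJ : exists J : nat, r0 < 2 ^+ J.+1 * r.
  have [J HJ] : exists J : nat, r0 / r < J%:R.
    by exists (Num.truncn (r0 / r)).+1; exact: truncnS_gt.
  exists J; rewrite -ltr_pdivrMr//; apply: lt_trans HJ _.
  by rewrite -natrX ltr_nat; apply: ltn_trans (ltn_expl J.+1 _).
case: (ex_minnP exJ) => J HJ Jmin.
have JL : 2 ^+ J * r <= r0.
  case: J HJ Jmin => [_ _|J _ Jmin]; first by rewrite expr0 mul1r ltW.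
  by rewrite leNgt; apply/negP => /Jmin; rewrite ltnn.
(* The central interval costs 2 e' and the j-th annulus 4 e' / 2^j, which is exactly the increment
   of the right-hand side. The total 10 e' is e/2. *)
have claim j : 2 ^+ j * r <= r0 -> avg r (2 ^+ j * r) <= (10 - 8 / 2 ^+ j) * e'.
  elim: j => [|j IH] hj.
    rewrite expr0 mul1r divr1 (_ : 10 - 8 = 2); last by ring.
    have rL : r <= L by apply: le_trans (ltW rr0) r0L.
    apply: (@le_trans _ _ (2 / r * \int[mu]_(y in `[tau - r, tau + r]) psi y)).
      have ip : mu.-integrable `[tau - r, tau + r] (EFin \o psi) by apply: psi_int; lra.
      rewrite -RintegralZl//; apply: le_Rintegral => //.
      - by apply: psiP_int; lra.
      - exact: RintegrableZl.
      - by move=> y _; rewrite mulrC ler_wpM2r// poisson_le.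
    apply: (@le_trans _ _ (2 / r * (e' * r))).
      apply: ler_wpM2l; first by rewrite divr_ge0// ltW.
      by apply: Hr1 => //; apply: le_trans (ltW rr0) _.
    by rewrite le_eqVlt; apply/orP; left; apply/eqP; field; rewrite gt_eqF.
  have p0 : 0 < 2 ^+ j :> R by rewrite exprn_gt0.
  have jj : 2 ^+ j * r <= 2 ^+ j.+1 * r.
    by rewrite ler_pM2r// exprS ler_peMl// ?ltW// ltr1n.
  have hj' := le_trans jj hj.
  have jr : 0 < 2 ^+ j * r by rewrite mulr_gt0.
  apply: le_trans (poisson_annulus rpos jr jj (le_trans hj r0L)) _.
  have h3 : \int[mu]_(y in `[tau - 2 ^+ j.+1 * r, tau + 2 ^+ j.+1 * r]) psi y <= e' * (2 ^+ j.+1 * r).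
    by apply: Hr1; [rewrite mulr_gt0 ?exprn_gt0|apply: le_trans r0r1].
  apply: le_trans (lerD (IH hj') (ler_wpM2l _ h3)) _.
    by rewrite divr_ge0 ?mulr_ge0 ?exprn_ge0 ?(ltW rpos)// ltW.
  rewrite le_eqVlt; apply/orP; left; apply/eqP; rewrite !exprS; field.
  by rewrite !gt_eqF.
have JLL : 2 ^+ J * r <= L by apply: le_trans r0L.
have Jr : 0 < 2 ^+ J * r by rewrite mulr_gt0 ?exprn_gt0.
apply: le_trans (poisson_annulus rpos Jr JLL (lexx _)) _.
have pJ : 0 < 2 ^+ J :> R by rewrite exprn_gt0.
have c1 : (10 - 8 / 2 ^+ J) * e' <= 10 * e'.
  by rewrite ler_pM2r// lerBlDr lerDl divr_ge0// ltW.
have c2 : \int[mu]_(y in `[tau - L, tau + L]) psi y <= (B + 1) * (2 * L).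
  apply: le_trans (ler_norm _) _; rewrite (_ : (B + 1) * (2 * L) = (B + 1) * (tau + L - (tau - L))); last by ring.
  apply: Rintegral_le_cst; [lra|by apply: psi_int; lra|].
  by move=> y _; rewrite ger0_norm//; have := psiB y; lra.
have c3 : 2 * r / (2 ^+ J * r) ^+ 2 * \int[mu]_(y in `[tau - L, tau + L]) psi y <= e / 2.
  apply: (@le_trans _ _ (2 * r / (r0 / 2) ^+ 2 * ((B + 1) * (2 * L)))).
    apply: ler_pM.
    - by rewrite divr_ge0 ?exprn_ge0 ?(ltW Jr) ?mulr_ge0 ?(ltW rpos).
    - exact: Rintegral_ge0.
    - rewrite ler_pM2l ?mulr_gt0// lef_pV2 ?posrE ?exprn_gt0 ?divr_gt0//.
      rewrite ler_pXn2r ?nnegrE ?divr_ge0 ?(ltW r00) ?(ltW Jr)//.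
      by rewrite ler_pdivrMr// mulrAC -exprSr ltW.
    - exact: c2.
  rewrite (_ : _ * _ = r * K); last by rewrite /K; field; rewrite gt_eqF.
  by rewrite -ler_pdivlMr// ltW.
apply: le_trans (lerD (le_trans (claim _ JL) c1) c3) _.
by rewrite /e'; lra.
Qed.

End poisson_average.

#[local] Instance ae_lebesgue_filter (R : realType) :
  Filter (nbhs (almost_everywhere (@lebesgue_measure R))).
Proof. exact: (ae_filter_ringOfSetsType (@lebesgue_measure R)). Qed.

(** * Measurable limits and Lebesgue points *)

Section limit_function.
Variable R : realType.
Local Notation mu := (@lebesgue_measure R).
Implicit Types (g : R -> R) (a b e r tau x y : R).

Definition clamp (x : R) : R := Num.max (-1) (Num.min 1 x).

Lemma clamp_norm x : `|clamp x| <= 1.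
Proof.
rewrite ler_norml /clamp le_max lexx /= ge_max ge_min lexx /= andbT.
by rewrite (le_trans _ ler01)// lerN10.
Qed.

Lemma clamp_id x : `|x| <= 1 -> clamp x = x.
Proof.
by rewrite ler_norml => /andP[h1 h2]; rewrite /clamp (min_r h2) (max_r h1).
Qed.

(** The upper limit is measurable and equals the limit where there is one; clamping it and extending
    it by 0 gives the bound 1 at every point. *)
Lemma ae_limit_function a b (f : nat -> R -> R) :
  (forall k, measurable_fun `[a, b] (f k)) ->
  (forall k y, a <= y <= b -> `|f k y| <= 1) ->
  {ae mu, forall y, `[a, b]%classic y -> cvgn (f ^~ y)} ->
  exists g, [/\ measurable_fun setT g, forall y, `|g y| <= 1 &
    {ae mu, forall y, `[a, b]%classic y -> f ^~ y @ \oo --> g y}].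
Proof.
move=> mf f1 fc; exists ((fun y => clamp (limn_sup (f ^~ y))) \_ `[a, b]%classic); split.
- apply/(measurable_restrictT _ _).1 => //.
  apply: measurable_maxr => //; apply: measurable_minr => //.
  apply: measurable_fun_limn_sup => //.
  + move=> y; rewrite /= in_itv => hy; exists 1 => _ [k _ <-].
    by apply: le_trans (ler_norm _) _; exact: f1.
  + move=> y; rewrite /= in_itv => hy; exists (-1) => _ [k _ <-].
    by have := f1 k _ hy; rewrite ler_norml => /andP[].
- by move=> y; rewrite patchE; case: ifP => _; rewrite ?clamp_norm// normr0.
- move: fc; apply: filterS => y Hy yD; have cy := Hy yD.
  rewrite patchE mem_set// cvg_limn_supE// clamp_id//.
  rewrite ler_norml; apply/andP; split.
    apply: (limr_ge cy); apply: nearW => k.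
    by have := f1 k y; rewrite ler_norml => /(_ _)/wrap[|/andP[]//]; move: yD; rewrite /= in_itv.
  apply: (limr_le cy); apply: nearW => k.
  by have := f1 k y; rewrite ler_norml => /(_ _)/wrap[|/andP[]//]; move: yD; rewrite /= in_itv.
Qed.

Lemma bounded_locally_integrable g : measurable_fun setT g -> (forall y, `|g y| <= 1) ->
  locally_integrable setT g.
Proof.
move=> mg g1; split; [exact: mg|exact: openT|].
move=> K _ cK; have mK := compact_measurable cK.
apply: (@le_lt_trans _ _ (\int[mu]_(x in K) 1%:E)%E).
  apply: ge0_le_integral => //.
  - by apply/measurable_EFinP; apply: measurableT_comp => //; exact: measurable_funTS.
  - by move=> x _; rewrite lee_fin.
by rewrite integral_cst// mul1e; exact: compact_finite_measure.
Qed.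

Lemma lebesgue_pt_average g tau : measurable_fun setT g -> (forall y, `|g y| <= 1) ->
  lebesgue_pt g tau -> forall e, 0 < e -> exists2 r0, 0 < r0 &
    forall r, 0 < r -> r <= r0 ->
      \int[mu]_(y in `[tau - r, tau + r]) `|g y - g tau| <= e * r.
Proof.
move=> mg g1 /fine_cvgP[/= fin cv] e e0.
have e2 : 0 < e / 4 by rewrite divr_gt0.
have := @filterI _ _ _ _ _ fin ((@cvgrPdist_le _ _ _ _ _ _ _).1 cv _ e2).
move=> [d /= d0 Hd]; exists (d / 4) => [|r r0 rd]; first by rewrite divr_gt0.
(* The open ball of radius 2r contains the closed interval of radius r, and its measure 4r turns the
   average e/4 into e r. *)
pose q := 2 * r; have q0 : 0 < q by rewrite mulr_gt0.
have [|//|fq Hq] := Hd q.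
  by rewrite /= sub0r normrN gtr0_norm// /q; lra.
rewrite /= sub0r normrN in Hq.
have mga (D : set R) : measurable_fun D (fun y => `|g y - g tau|).
  by apply: measurableT_comp => //; apply: measurable_funB => //; exact: measurable_funTS.
have ii a b : mu.-integrable `[a, b] (EFin \o (fun y => `|g y - g tau|)).
  apply: (@itv_bounded_integrable _ _ _ _ 2) => // y _.
  rewrite normr_id; apply: le_trans (ler_normB _ _) _.
  by rewrite (_ : 2 = 1 + 1 :> R)// lerD.
have dq : (davg g tau q <= (e / 4)%:E)%E.
  by rewrite -(fineK fq) lee_fin (le_trans (ler_norm _) Hq).
rewrite -lee_fin /Rintegral fineK; last exact: integrable_fin_num.
apply: (@le_trans _ _ (\int[mu]_(y in ball tau q) (`|g y - g tau|)%:E)%E).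
  apply: ge0_subset_integral => //.
  - exact: measurable_ball.
  - by apply/measurable_EFinP; exact: mga.
  - move=> y; rewrite /= in_itv /= => /andP[y1 y2].
    by rewrite /ball /= ltr_norml /q; apply/andP; split; lra.
move: dq; rewrite /davg /iavg (lebesgue_measure_ball _ (ltW q0)) inver.
have q2 : 0 < q *+ 2 by rewrite mulrn_wgt0.
rewrite gt_eqF// lee_pdivrMl// => /le_trans; apply.
rewrite -EFinM lee_fin /q -mulr_natl; lra.
Qed.

End limit_function.

(** * Fatou's theorem on the half plane *)

Section fatou.
Variable R : realType.
Local Notation C := R[i].
Local Notation mu := (@lebesgue_measure R).
Variable u : C -> C.
Hypothesis Hu : forall w : C, Re w < 0 -> exists l, cderiv u w l.
Hypothesis u1 : forall w : C, Re w < 0 -> cabs (u w) <= 1.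
Hypothesis per : forall x, u (x +i* (- pi)) = u (x +i* pi).

Let pi_le : - pi <= pi :> R. Proof. by rewrite ge0_cp// pi_ge0. Qed.

Lemma radial_sequence_limit : exists (s : nat -> R) (gR gI : R -> R),
  [/\ forall k : nat, s k < 0, s @ \oo --> (0 : R),
      measurable_fun setT gR /\ measurable_fun setT gI,
      forall y, `|gR y| <= 1 /\ `|gI y| <= 1 &
      {ae mu, forall y, `[- pi, pi]%classic y ->
        Re (u (s k +i* y)) @[k --> \oo] --> gR y /\
        Im (u (s k +i* y)) @[k --> \oo] --> gI y}].
Proof.
have [s [s0 scvg sd]] := h2_subsequence Hu u1 per.
have K (p : C -> R) : (forall z w, p (z - w) = p z - p w) -> (forall z, `|p z| <= cabs z) ->
    (forall k, measurable_fun `[- pi, pi] (fun y => p (u (s k +i* y)))) ->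
    exists g : R -> R, [/\ measurable_fun setT g, forall y, `|g y| <= 1 &
    {ae mu, forall y, `[- pi, pi]%classic y -> p (u (s k +i* y)) @[k --> \oo] --> g y}].
  move=> pB pl mp.
  have p1 k y : `|p (u (s k +i* y))| <= 1 by apply: le_trans (pl _) _; apply: u1; exact: s0.
  apply: (@ae_limit_function _ _ _ (fun k y => p (u (s k +i* y)))) => //.
  apply: ae_cvg_of_L2_increments => // k; apply: le_trans (sd k).
  have u2 y : cabs (u (s k +i* y) - u (s k.+1 +i* y)) <= 2.
    by apply: le_trans (cabsBD _ _) _; rewrite (_ : 2 = 1 + 1 :> R)// lerD// u1 ?s0.
  have [iR iI] : cintegrable (- pi) pi (fun y => u (s k +i* y) - u (s k.+1 +i* y)).
    by apply: cintegrableB; exact: (half_plane_int Hu).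
  apply: le_Rintegral => //.
  - apply: (@itv_bounded_integrable _ _ _ _ 4).
      apply: measurable_funX; apply: measurableT_comp => //.
      by apply: measurable_funB; exact: mp.
    move=> y _; rewrite normrX normr_id (_ : 4 = 2 ^+ 2 :> R); last by ring.
    rewrite ler_pXn2r ?nnegrE//; apply: le_trans (ler_normB _ _) _.
    by rewrite (_ : 2 = 1 + 1 :> R)// lerD.
  - apply: (@itv_bounded_integrable _ _ _ _ 4).
      apply: (eq_measurable_fun (fun y => Re (u (s k +i* y) - u (s k.+1 +i* y)) ^+ 2 +
          Im (u (s k +i* y) - u (s k.+1 +i* y)) ^+ 2)) => [y _|]; first by rewrite sqr_cabs.
      apply: measurable_funD; apply: measurable_funX; apply/measurable_EFinP.
        exact: (measurable_int mu iR).
      exact: (measurable_int mu iI).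
    move=> y _; rewrite normrX ger0_norm ?cabs_ge0// (_ : 4 = 2 ^+ 2 :> R); last by ring.
    by rewrite ler_pXn2r ?nnegrE ?cabs_ge0.
  - move=> y _; rewrite ler_pXn2r ?nnegrE ?cabs_ge0//.
    by rewrite -pB; apply: le_trans (pl _) _; rewrite cabsB.
have mRI k : measurable_fun `[- pi, pi] (fun y => Re (u (s k +i* y))) /\
             measurable_fun `[- pi, pi] (fun y => Im (u (s k +i* y))).
  have [iR iI] := half_plane_int Hu (- pi) pi (s0 k).
  by split; apply/measurable_EFinP; [exact: (measurable_int mu iR)|exact: (measurable_int mu iI)].
have [gR [mR R1 cR]] := K (@Re R) (@cReB R) (@normr_Re R) (fun k => (mRI k).1).
have [gI [mI I1 cI]] := K (@Im R) (@cImB R) (@normr_Im R) (fun k => (mRI k).2).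
exists s, gR, gI; split => //.
by apply: filterS2 cR cI => y hR hI yD; split; [exact: hR|exact: hI].
Qed.

Theorem half_plane_fatou : {ae mu, forall tau, `]- pi, pi[%classic tau ->
  exists c : C, forall e : R, 0 < e -> exists2 d : R, 0 < d &
    forall r, 0 < r -> r < d -> cabs (u ((- r) +i* tau) - c) <= e}.
Proof.
have [s [gR [gI [s0 scvg [mR mI] g1 gcvg]]]] := radial_sequence_limit.
have lR := lebesgue_differentiation (bounded_locally_integrable mR (fun y => (g1 y).1)).
have lI := lebesgue_differentiation (bounded_locally_integrable mI (fun y => (g1 y).2)).
apply: filterS2 lR lI => tau lR lI; rewrite /= in_itv /= => /andP[tau1 tau2].
pose c := gR tau +i* gI tau; exists c => e e0.
have c2 : cabs c <= 2.
  by apply: le_trans (cabs_le_ReIm _) _; have [] := g1 tau; rewrite /c /=; lra.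
(* The window [tau - L, tau + L] must stay within [-pi, pi], where almost everywhere convergence is
   known. *)
pose L := Num.min (tau + pi) (pi - tau).
have L0 : 0 < L by rewrite lt_min; apply/andP; split; lra.
have [La Lb] : L <= tau + pi /\ L <= pi - tau by rewrite /L !ge_min !lexx orbT.
pose psi y := `|gR y - gR tau| + `|gI y - gI tau|.
have mpsi (D : set R) : measurable_fun D psi.
  by apply: measurable_funD; apply: measurableT_comp => //; apply: measurable_funB => //;
    exact: measurable_funTS.
have psi0 y : 0 <= psi y by rewrite addr_ge0.
have psi4 y : psi y <= 4.
  have [a1 a2] := g1 y; have [b1 b2] := g1 tau.
  have := ler_normB (gR y) (gR tau); have := ler_normB (gI y) (gI tau); rewrite /psi; lra.
have psi_avg e' : 0 < e' -> exists2 r0, 0 < r0 & forall r, 0 < r -> r <= r0 ->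
    \int[mu]_(y in `[tau - r, tau + r]) psi y <= e' * r.
  move=> e'0; have e'2 : 0 < e' / 2 by rewrite divr_gt0.
  have [r1 r10 H1] := lebesgue_pt_average mR (fun y => (g1 y).1) lR e'2.
  have [r2 r20 H2] := lebesgue_pt_average mI (fun y => (g1 y).2) lI e'2.
  exists (Num.min r1 r2) => [|r r0]; first by rewrite lt_min r10.
  rewrite le_min => /andP[h1 h2].
  have ii (g : R -> R) : measurable_fun setT g -> (forall y, `|g y| <= 1) ->
      mu.-integrable `[tau - r, tau + r] (EFin \o (fun y => `|g y - g tau|)).
    move=> mg gg1; apply: (@itv_bounded_integrable _ _ _ _ 2).
      by apply: measurableT_comp => //; apply: measurable_funB => //; exact: measurable_funTS.
    move=> y _; rewrite normr_id; apply: le_trans (ler_normB _ _) _.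
    by rewrite (_ : 2 = 1 + 1 :> R)// lerD.
  rewrite RintegralD//; [|exact: ii mR (fun y => (g1 y).1)|exact: ii mI (fun y => (g1 y).2)].
  by apply: le_trans (lerD (H1 _ r0 h1) (H2 _ r0 h2)) _; rewrite -mulrDl -splitr.
have e8 : 0 < e / 16 by rewrite divr_gt0.
have [d d0 Hd] := poisson_average_small L0 (mpsi _) psi0 psi4 psi_avg e8.
(* The bound L/32 gives 32 r / L <= 1, and e L / 192 gives 96 r / L <= e/2. *)
pose d1 := Num.min d (Num.min (L / 32) (e * L / 192)).
exists d1 => [|r r0]; first by rewrite !lt_min d0 !divr_gt0// mulr_gt0.
rewrite !lt_min => /andP[rd /andP[rL re]].
have rL1 : 32 * r / L <= 1 by rewrite ler_pdivrMr//; lra.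
have rL4 : r <= L / 4 by lra.
have re2 : 96 * r / L <= e / 2 by rewrite ler_pdivrMr//; lra.
(* At fixed r, [poisson_estimate] is used on the line of abscissa [s k]. As k grows, [A k] tends to
   the Poisson average of psi, at most e/16, so that 4 * [A k] is eventually at most e/2. *)
pose A k := \int[mu]_(y in `[tau - L, tau + L])
  ((`|Re (u (s k +i* y)) - Re c| + `|Im (u (s k +i* y)) - Im c|) * poisson r tau y).
have Acvg : A k @[k --> \oo] --> \int[mu]_(y in `[tau - L, tau + L]) (psi y * poisson r tau y).
  apply: (@Rdominated_cvg _ _ _ mu _ _ _ (fun=> 8 * (2 / r))) => //.
  - move=> k; apply: measurable_funM; last exact: poisson_measurable.
    have [iR iI] := half_plane_int Hu (tau - L) (tau + L) (s0 k).
    apply: measurable_funD; apply: measurableT_comp => //; apply: measurable_funB => //;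
      apply/measurable_EFinP; [exact: (measurable_int mu iR)|exact: (measurable_int mu iI)].
  - by apply: measurable_funM; [exact: mpsi|exact: poisson_measurable].
  - apply: filterS gcvg => y Hy yD.
    have [hR hI] : Re (u (s k +i* y)) @[k --> \oo] --> gR y /\
        Im (u (s k +i* y)) @[k --> \oo] --> gI y.
      by apply: Hy; move: yD; rewrite /= !in_itv /= => /andP[? ?]; apply/andP; split; lra.
    apply: cvgM; last exact: cvg_cst.
    by apply: cvgD; apply: cvg_norm; apply: cvgB => //; exact: cvg_cst.
  - by have [] := cintegrable_cst (tau - L) (tau + L) (8 * (2 / r))%:C.
  - move=> k y _; rewrite normrM; apply: ler_pM => //; last first.
      by rewrite ger0_norm ?poisson_le// poisson_ge0// ltW.
    have uk : cabs (u (s k +i* y)) <= 1 by apply: u1; exact: s0.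
    have := ler_normB (Re (u (s k +i* y))) (Re c); have := ler_normB (Im (u (s k +i* y))) (Im c).
    have := normr_Re (u (s k +i* y)); have := normr_Im (u (s k +i* y)).
    have := normr_Re c; have := normr_Im c.
    by rewrite ger0_norm ?addr_ge0//; lra.
have Hd' := Hd r r0 rd.
have nearA : \forall k \near \oo, A k <= e / 8.
  have /cvgrPdist_le/(_ _ e8) := Acvg; apply: filterS => k.
  rewrite ler_distl lerBlDr => /andP[h _]; apply: (le_trans h); apply: (le_trans (lerD Hd' (lexx _))); lra.
have r2 : 0 < r / 2 by rewrite divr_gt0.
have nears : \forall k \near \oo, - s k <= r / 2.
  have /cvgrPdist_le/(_ _ r2) := scvg; apply: filterS => k.
  by rewrite sub0r normrN => h; apply: le_trans h; rewrite -normrN ler_norm.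
have [k [kA ks]] := @filter_ex _ \oo _ _ (filterI nearA nears).
have sk : 0 < - s k by rewrite oppr_gt0.
have := poisson_estimate Hu u1 tau sk ks L0 rL4 rL1 c2; rewrite opprK => H.
apply: (le_trans H); apply: (le_trans (lerD (ler_wpM2l (ler0n _ 4) kA) re2)).
by lra.
Qed.

End fatou.

(** * Weak convergence on an interval *)

Lemma bounded_mul_integrable d (T : measurableType d) (R : realType)
    (mu : {measure set T -> \bar R}) (D : set T) (y h : T -> R) (M : R) :
  measurable D -> measurable_fun D y -> (forall x, D x -> `|y x| <= M) ->
  mu.-integrable D (EFin \o h) -> mu.-integrable D (EFin \o (fun x => y x * h x)).
Proof.
move=> mD my yM ih; have mh : measurable_fun D h.
  by apply/measurable_EFinP; exact: (measurable_int mu ih).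
apply: (@le_integrable _ _ _ mu D mD _ (EFin \o (fun x => M * h x))).
- by apply/measurable_EFinP; exact: measurable_funM.
- move=> x Dx; rewrite /= lee_fin !normrM ler_wpM2r//.
  by apply: le_trans (yM _ Dx) _; exact: ler_norm.
- exact: RintegrableZl.
Qed.

Section weak_convergence.
Variable R : realType.
Local Notation mu := (@lebesgue_measure R).
Variables (A B : R) (y : nat -> R -> R) (M : R).
Hypothesis AB : A <= B.
Hypothesis my : forall k, measurable_fun `[A, B] (y k).
Hypothesis yM : forall k t, A <= t <= B -> `|y k t| <= M.
Hypothesis yI : forall a b, A <= a -> a <= b -> b <= B ->
  \int[mu]_(t in `[a, b]) y k t @[k --> \oo] --> (0 : R).

Let M0 : 0 <= M.
Proof. by apply: le_trans (yM 0%N (t := A) _); rewrite ?normr_ge0// lexx. Qed.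

Let mys k a b : A <= a -> b <= B -> measurable_fun `[a, b] (y k).
Proof.
by move=> ha hb; apply: measurable_funS (my k) => //; apply: subset_itv; rewrite bnd_simp.
Qed.

Let yMs k a b t : A <= a -> b <= B -> a <= t <= b -> `|y k t| <= M.
Proof. by move=> ha hb /andP[at_ tb]; apply: yM; rewrite (le_trans ha) ?(le_trans tb). Qed.

(** The bound e (b - a) + eta, for every eta > 0, is stable under cutting the interval. On a short
    interval g is nearly constant and the hypothesis on integrals of [y k] applies, so bisection
    takes the place of uniform continuity. *)
Lemma weak_cvg_continuous (g : R -> R) : continuous g ->
  \int[mu]_(t in `[A, B]) (y k t * g t) @[k --> \oo] --> (0 : R).
Proof.
move=> gc.
have ig a b : mu.-integrable `[a, b] (EFin \o g).
  apply: continuous_compact_integrable; first exact: segment_compact.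
  exact: continuous_subspaceT.
have iyg k a b : A <= a -> b <= B -> mu.-integrable `[a, b] (EFin \o (fun t => y k t * g t)).
  move=> ha hb; apply: (@bounded_mul_integrable _ _ _ _ _ _ _ M) => //; first exact: mys.
  by move=> t; rewrite /= in_itv => ht; exact: (yMs _ ha hb ht).
suff H e : 0 < e -> forall eta, 0 < eta -> \forall k \near \oo,
    `|\int[mu]_(t in `[A, B]) (y k t * g t)| <= e * (B - A) + eta.
  apply/cvgrPdist_le => e e0.
  have e2 : 0 < e / 2 by rewrite divr_gt0.
  have BA : 0 < B - A + 1 by rewrite ltr_wpDl// subr_ge0.
  have := H (e / 2 / (B - A + 1)) _ _ e2; rewrite divr_gt0// => /(_ isT).
  apply: filterS => k Hk; rewrite sub0r normrN; apply: le_trans Hk _.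
  rewrite [leRHS](splitr e) lerD2r mulrAC ler_pdivrMr//.
  by rewrite ler_pM2l// lerDl.
move=> e0.
(* The last two arguments are dummies for the second side of the rectangle. *)
pose P a b (c d : R) := forall eta, 0 < eta -> \forall k \near \oo,
    `|\int[mu]_(t in `[a, b]) (y k t * g t)| <= e * (b - a) + eta.
suff : P A B 0 0 by [].
apply: (@rectangle_bisection _ P) => //.
- move=> a b c d aA ab bB _ _ _ /=; set m := (a + b) / 2 => P1 P2 _ _ eta eta0.
  have am : a <= m by rewrite /m; lra.
  have mb : m <= b by rewrite /m; lra.
  have eta2 : 0 < eta / 2 by rewrite divr_gt0.
  apply: filterS2 (P1 _ eta2) (P2 _ eta2) => k H1 H2.
  rewrite (@Rintegral_split _ _ a m b)//; last exact: iyg.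
  apply: le_trans (ler_normD _ _) _; apply: le_trans (lerD H1 H2) _.
  by lra.
- move=> x z /andP[Ax xB] _.
  have M1 : 0 < M + 1 by rewrite ltr_wpDl.
  have e1 : 0 < e / (M + 1) by rewrite divr_gt0.
  have /cvgrPdist_le/(_ _ e1)[d /= d0 Hd] := gc x.
  exists d => // a b c d' aA /andP[ax xb] bB _ _ _ bad _ eta eta0.
  have ab := le_trans ax xb.
  have g1 : 0 < `|g x| + 1 by rewrite ltr_wpDl.
  have eta1 : 0 < eta / (`|g x| + 1) by rewrite divr_gt0.
  have /cvgrPdist_le/(_ _ eta1) := yI aA ab bB; apply: filterS => k.
  rewrite sub0r normrN => Hk.
  have iy : mu.-integrable `[a, b] (EFin \o y k).
    by apply: (@itv_bounded_integrable _ _ _ _ M) => [|t ht]; [exact: mys|exact: (yMs _ aA bB ht)].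
  have igx : mu.-integrable `[a, b] (EFin \o (fun t => g x * y k t)) by exact: RintegrableZl.
  have -> : \int[mu]_(t in `[a, b]) (y k t * g t) =
      \int[mu]_(t in `[a, b]) (y k t * g t - g x * y k t) + g x * \int[mu]_(t in `[a, b]) y k t.
    rewrite RintegralB//; last exact: iyg.
    by rewrite RintegralZl// subrK.
  apply: le_trans (ler_normD _ _) _; apply: lerD.
    apply: Rintegral_le_cst => //; first by apply: RintegrableB => //; exact: iyg.
    move=> t ht; rewrite [g x * _]mulrC -mulrBr normrM.
    apply: (@le_trans _ _ (M * (e / (M + 1)))).
      apply: ler_pM => //; first exact: (yMs _ aA bB ht).
      rewrite distrC; apply: Hd; rewrite /= ltr_norml; move: ht => /andP[t1 t2].
      by apply/andP; split; lra.
    by rewrite mulrCA ger_pMr// ler_pdivrMr// mul1r lerDl.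
  rewrite normrM; apply: (@le_trans _ _ (`|g x| * (eta / (`|g x| + 1)))).
    by rewrite ler_wpM2l.
  by rewrite mulrCA ger_pMr// ler_pdivrMr// mul1r lerDl.
Qed.

Lemma weak_cvg_L1 (h : R -> R) : mu.-integrable `[A, B] (EFin \o h) ->
  \int[mu]_(t in `[A, B]) (y k t * h t) @[k --> \oo] --> (0 : R).
Proof.
move=> ih.
have iyh k (f : R -> R) : mu.-integrable `[A, B] (EFin \o f) ->
    mu.-integrable `[A, B] (EFin \o (fun t => y k t * f t)).
  move=> fi; apply: (@bounded_mul_integrable _ _ _ _ _ _ _ M) => //; first exact: my.
  by move=> t; rewrite /= in_itv; exact: yM.
apply/cvgrPdist_le => e e0.
have M1 : 0 < M + 1 by rewrite ltr_wpDl.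
have e2 : 0 < e / 2 / (M + 1) by rewrite !divr_gt0.
have [g_ [gc gi]] := approximation_continuous_integrable (measurable_itv _) (itv_measure_lty A B) ih.
move=> /fine_cvgP[fin /cvgrPdist_le/(_ _ e2) cv].
have [n [fn Hn]] := @filter_ex _ \oo _ _ (filterI fin cv).
have ihg : mu.-integrable `[A, B] (EFin \o (fun t => `|h t - g_ n t|)).
  by apply: integrable_norm; exact: (RintegrableB _ ih (gi n)).
have small : \int[mu]_(t in `[A, B]) `|h t - g_ n t| <= e / 2 / (M + 1).
  by move: Hn; rewrite /= sub0r normrN; apply: le_trans; exact: ler_norm.
have e3 : 0 < e / 2 by rewrite divr_gt0.
have /cvgrPdist_le/(_ _ e3) := weak_cvg_continuous (gc n); apply: filterS => k.
rewrite !sub0r !normrN => Hk.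
have -> : \int[mu]_(t in `[A, B]) (y k t * h t) =
   \int[mu]_(t in `[A, B]) (y k t * (h t - g_ n t)) + \int[mu]_(t in `[A, B]) (y k t * g_ n t).
  rewrite -RintegralD//; [|by apply: iyh; exact: RintegrableB|exact: iyh].
  by apply: eq_Rintegral => t _; rewrite -mulrDr subrK.
apply: le_trans (ler_normD _ _) _; rewrite [leRHS](splitr e); apply: lerD => //.
have iyd : mu.-integrable `[A, B] (EFin \o (fun t => y k t * (h t - g_ n t))).
  by apply: iyh; exact: RintegrableB.
apply: le_trans (le_normr_Rintegral _ iyd) _ => //.
apply: (@le_trans _ _ (\int[mu]_(t in `[A, B]) (M * `|h t - g_ n t|))).
  apply: le_Rintegral => //; [exact: (integrable_norm iyd)|exact: RintegrableZl|].
  by move=> t; rewrite /= in_itv => ht; rewrite normrM ler_wpM2r// yM.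
rewrite RintegralZl//; apply: (@le_trans _ _ (M * (e / 2 / (M + 1)))).
  by rewrite ler_wpM2l.
by rewrite mulrCA ger_pMr// ler_pdivrMr// mul1r lerDl.
Qed.

End weak_convergence.

(** * Boundary values of functions on the half plane *)

Section boundary_values.
Variable R : realType.
Local Notation C := R[i].
Local Notation mu := (@lebesgue_measure R).
#[local] Existing Instance ae_lebesgue_filter.
Implicit Types (u : C -> C) (v : R -> C) (a b r e tau : R).

Definition half_plane_schur u := (forall w : C, Re w < 0 -> exists l, cderiv u w l) /\
  (forall w : C, Re w < 0 -> cabs (u w) <= 1).

Definition radial_cvg u tau (c : C) := forall e, 0 < e -> exists2 d, 0 < d &
  forall r, 0 < r -> r < d -> cabs (u ((- r) +i* tau) - c) <= e.

Definition boundary_value u v :=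
  [/\ measurable_fun `[- pi, pi] (fun t => Re (v t)),
      measurable_fun `[- pi, pi] (fun t => Im (v t)),
      forall t, cabs (v t) <= 1 &
      {ae mu, forall tau, `[- pi, pi]%classic tau -> radial_cvg u tau (v tau)}].

(** The common properties of [Re] and [Im], so that each limit argument is carried out once for
    both. *)
Record real_part (p : C -> R) := RealPart {
  rpB : forall z w, p (z - w) = p z - p w;
  rp_le : forall z, `|p z| <= cabs z;
  rp_ci : forall a b g, p (ci a b g) = \int[mu]_(x in `[a, b]) p (g x) }.

Lemma real_part_Re : real_part (@Re R).
Proof. by split => //; [exact: cReB|exact: normr_Re]. Qed.

Lemma real_part_Im : real_part (@Im R).
Proof. by split => //; [exact: cImB|exact: normr_Im]. Qed.

Variables (p : C -> R).
Hypothesis pP : real_part p.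

Lemma rp_int u a b s : half_plane_schur u -> s < 0 ->
  (forall x, p x = Re x) \/ (forall x, p x = Im x) ->
  mu.-integrable `[a, b] (EFin \o (fun y => p (u (s +i* y)))).
Proof.
move=> [Hu _] s0 ph; have [iR iI] := half_plane_int Hu a b s0.
case: ph => pE; [apply: eq_integrable iR|apply: eq_integrable iI] => // y _;
  by rewrite /= pE.
Qed.

Hypothesis pRI : (forall x, p x = Re x) \/ (forall x, p x = Im x).

Lemma rp_measurable u v : boundary_value u v -> measurable_fun `[- pi, pi] (fun t => p (v t)).
Proof.
by move=> [mR mI _ _]; case: pRI => pE; [apply: (eq_measurable_fun _ _ mR)|apply: (eq_measurable_fun _ _ mI)] => y _;
  rewrite pE.
Qed.

(** [half_plane_interval] compares the abscissas - r and - s_j, and s_j tends to 0 under dominated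
    convergence. The bound involves neither u nor v. *)
Lemma boundary_interval u v a b r : half_plane_schur u -> boundary_value u v ->
  - pi <= a -> a <= b -> b <= pi -> 0 < r ->
  `|\int[mu]_(y in `[a, b]) p (v y) - \int[mu]_(y in `[a, b]) p (u ((- r) +i* y))| <= 4 * r.
Proof.
move=> su bv ha ab hb r0; have [Hu u1] := su; have [_ _ v1 vcvg] := bv.
pose s (j : nat) : R := r / 2 * harmonic j.
have s0 j : 0 < s j by rewrite mulr_gt0 ?divr_gt0 ?invr_gt0.
have sr j : s j < r.
  have h1 : harmonic j <= 1 :> R by rewrite invf_le1 ?ler1n.
  have r2 : 0 <= r / 2 by rewrite divr_ge0// ltW.
  by have := ler_wpM2l r2 h1; rewrite -/(s j); lra.
have step j : `|\int[mu]_(y in `[a, b]) p (u ((- s j) +i* y)) -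
    \int[mu]_(y in `[a, b]) p (u ((- r) +i* y))| <= 4 * r.
  rewrite -!(rp_ci pP) -(rpB pP); apply: le_trans (rp_le pP _) _.
  apply: le_trans (half_plane_interval Hu u1 _ _ ab) _; rewrite ?lerN2 ?oppr_lt0//; first exact: ltW.
  by rewrite ler_pM2l// opprK; have := s0 j; lra.
have scvg : s j @[j --> \oo] --> (0 : R).
  rewrite -(mulr0 (r / 2)); apply: cvgM; first exact: cvg_cst.
  exact: cvg_harmonic.
have lim : \int[mu]_(y in `[a, b]) p (u ((- s j) +i* y)) @[j --> \oo] -->
    \int[mu]_(y in `[a, b]) p (v y).
  apply: (@Rdominated_cvg _ _ _ mu _ _ _ (fun=> 1)) => //.
  - move=> j; apply/measurable_EFinP.
    by apply: (measurable_int mu); apply: rp_int => //; rewrite oppr_lt0.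
  - by apply: measurable_funS (rp_measurable bv) => //; apply: subset_itv; rewrite bnd_simp.
  - move: vcvg; apply: filterS => y Hy yD.
    have yD' : `[- pi, pi]%classic y.
      by move: yD; rewrite /= !in_itv /= => /andP[h1 h2]; rewrite (le_trans ha h1) (le_trans h2 hb).
    apply/cvgrPdist_le => e e0; have [d d0 Hd] := Hy yD' _ e0.
    have /cvgrPdist_lt/(_ _ d0) := scvg; apply: filterS => j.
    rewrite sub0r normrN gtr0_norm// => sd; rewrite distrC -(rpB pP).
    by apply: le_trans (rp_le pP _) _; exact: Hd.
  - by have [] := cintegrable_cst a b (1 : C).
  - move=> j y _; apply: le_trans (rp_le pP _) _; apply: u1; by rewrite /= oppr_lt0.
apply/ler_addgt0Pr => e e0.
have /cvgrPdist_le/(_ _ e0) := lim => /(@filter_ex _ \oo _)[j Hj].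
set I := \int[mu]_(y in _) p (v y) in Hj *; set J := \int[mu]_(y in _) _ in Hj.
rewrite -[X in `|X|](subrK (I - J)) addrC; have sj := step j; rewrite -/J in sj.
set K := \int[mu]_(y in _) _ in sj *.
rewrite (_ : I - J + (I - K - (I - J)) = (I - J) + (J - K)); last by ring.
by apply: le_trans (ler_normD _ _) _; rewrite addrC lerD.
Qed.

Lemma boundary_weak (u_ : nat -> C -> C) u (v_ : nat -> R -> C) v (h : R -> R) :
  (forall k, half_plane_schur (u_ k)) -> half_plane_schur u ->
  (forall k, boundary_value (u_ k) (v_ k)) -> boundary_value u v ->
  (forall (w : C), Re w < 0 -> forall e, 0 < e -> \forall k \near \oo, cabs (u_ k w - u w) <= e) ->
  mu.-integrable `[- pi, pi] (EFin \o h) ->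
  \int[mu]_(t in `[- pi, pi]) ((p (v_ k t) - p (v t)) * h t) @[k --> \oo] --> (0 : R).
Proof.
move=> su_ su bv_ bv ucvg ih.
have pl : - pi <= pi :> R by rewrite ge0_cp// pi_ge0.
have mp (f : R -> C) w : boundary_value w f -> measurable_fun `[- pi, pi] (fun t => p (f t)).
  exact: rp_measurable.
have p1 (f : R -> C) w t : boundary_value w f -> `|p (f t)| <= 1.
  by move=> [_ _ f1 _]; exact: le_trans (rp_le pP _) _.
apply: (@weak_cvg_L1 _ _ _ (fun k t => p (v_ k t) - p (v t)) 2 pl) => //.
- by move=> k; apply: measurable_funB; [exact: mp (bv_ k)|exact: mp bv].
- move=> k t _; apply: le_trans (ler_normB _ _) _.
  by rewrite (_ : 2 = 1 + 1 :> R)//; apply: lerD; [exact: p1 (bv_ k)|exact: p1 bv].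
move=> a b ha ab hb.
have ip (f : R -> C) w : boundary_value w f -> mu.-integrable `[a, b] (EFin \o (fun t => p (f t))).
  move=> bf; apply: (@itv_bounded_integrable _ _ _ _ 1).
    by apply: measurable_funS (mp _ _ bf) => //; apply: subset_itv; rewrite bnd_simp.
  by move=> t _; exact: p1 bf.
(* Passing from the boundary to the abscissa - r costs 4 r = e/4 for each of the two functions; the
   remaining e/2 is for the convergence on that line. *)
apply/cvgrPdist_le => e e0; pose r := e / 16.
have r0 : 0 < r by rewrite divr_gt0.
have lim : \int[mu]_(y in `[a, b]) p (u_ k ((- r) +i* y)) @[k --> \oo] -->
    \int[mu]_(y in `[a, b]) p (u ((- r) +i* y)).
  apply: (@Rdominated_cvg _ _ _ mu _ _ _ (fun=> 1)) => //.
  - move=> k; apply/measurable_EFinP; apply: (measurable_int mu).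
    by apply: rp_int => //; rewrite oppr_lt0.
  - apply/measurable_EFinP; apply: (measurable_int mu).
    by apply: rp_int => //; rewrite oppr_lt0.
  - apply: aeW => y _; apply/cvgrPdist_le => e1 e10.
    have rn : Re ((- r) +i* y) < 0 by rewrite /= oppr_lt0.
    have := ucvg _ rn _ e10; apply: filterS => k.
    by rewrite distrC -(rpB pP) => H; exact: le_trans (rp_le pP _) H.
  - by have [] := cintegrable_cst a b (1 : C).
  - move=> k y _; apply: le_trans (rp_le pP _) _; apply: (su_ k).2; by rewrite /= oppr_lt0.
have e2 : 0 < e / 2 by rewrite divr_gt0.
have /cvgrPdist_le/(_ _ e2) := lim; apply: filterS => k Hk.
rewrite sub0r normrN RintegralB//; [|exact: ip (bv_ k)|exact: ip bv].
have H1 := boundary_interval (su_ k) (bv_ k) ha ab hb r0.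
have H2 := boundary_interval su bv ha ab hb r0.
move: Hk H1 H2.
move: (\int[mu]_(y in _) p (v_ k y)) (\int[mu]_(y in _) p (v y)) (\int[mu]_(y in _) p (u _)) (\int[mu]_(y in _) p (u_ _ _)).
move=> I J J' I'; rewrite !ler_norml => /andP[h1 h2] /andP[h3 h4] /andP[h5 h6].
by apply/andP; split; rewrite /r in h3 h4 h5 h6; lra.
Qed.

End boundary_values.

(** * Averages over orbits *)

Section orbit_averages.
Context d (T : measurableType d) (R : realType) (m : {sigma_finite_measure set T -> \bar R}).
Local Notation RM := (measurableTypeR R).
Local Notation mu := (@lebesgue_measure R).
Variable act : R -> T -> T.
Hypothesis mact : measurable_fun setT (fun p : T * RM => act p.2 p.1).
Hypothesis act_inv : forall t A, measurable A -> m (act t @^-1` A) = m A.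
Variables a b : R.
Hypothesis ab : a < b.
Local Notation I := (`[a, b]%classic : set RM).

Let mact1 t : measurable_fun setT (act t).
Proof.
apply: (measurableT_comp mact (f := fun p : T * RM => act p.2 p.1) (g := fun x => (x, t : RM))).
by apply/measurable_fun_pairP; split; [exact: measurable_id|exact: measurable_cst].
Qed.

Let push_act t : {measure set T -> \bar R} :=
  measure_function_pushforward__canonical__measure_function_Measure m (mact1 t).

Let integral_push_act t (f : T -> \bar R) :
  (\int[push_act t]_x f x = \int[m]_x f x)%E.
Proof.
by apply: (@eq_measure_integral _ _ _ _ m (push_act t)) => A mA _; exact: act_inv.
Qed.

Let ge0_integral_act t (f : T -> \bar R) : measurable_fun setT f -> (forall x, 0 <= f x)%E ->
  (\int[m]_x f (act t x) = \int[m]_x f x)%E.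
Proof.
move=> mf f0; rewrite -[RHS](integral_push_act t).
have := @ge0_integral_pushforward _ _ _ _ _ _ (mact1 t) m setT f measurableT mf
  (fun x _ => f0 x).
by rewrite preimage_setT => H; exact: (esym H).
Qed.

Let integrable_act t (f : T -> \bar R) : m.-integrable setT f -> m.-integrable setT (f \o act t).
Proof.
move=> /integrableP[mf fi]; apply/integrableP; split.
  exact: (measurableT_comp mf (mact1 t)).
have ma : measurable_fun setT (fun x => `|f x|%E) := measurableT_comp (@abse_measurable R setT) mf.
by have /= -> := ge0_integral_act t ma (fun x => abse_ge0 (f x)).
Qed.

Let integral_act t (f : T -> \bar R) : m.-integrable setT f ->
  (\int[m]_x f (act t x) = \int[m]_x f x)%E.
Proof.
move=> fi; rewrite -[RHS](integral_push_act t).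
have := @integral_pushforward _ _ _ _ _ _ (mact1 t) m setT f (measurable_int m fi).
by rewrite preimage_setT => /(_ (integrable_act t fi) measurableT) H; exact: esym H.
Qed.

(** The indicator extends the integral over [a, b] to the whole line, so that Fubini's theorem
    applies to the plain product with Lebesgue measure. *)
Definition orbit_fun (g : T -> R) (p : T * RM) : \bar R := (\1_I p.2 * g (act p.2 p.1))%:E.

Lemma measurable_orbit_fun g : measurable_fun setT g -> measurable_fun setT (orbit_fun g).
Proof.
move=> mg; apply/measurable_EFinP; apply: measurable_funM.
  by apply: (@measurableT_comp _ _ _ _ _ _ (\1_I : RM -> R)) => //; exact: measurable_snd.
exact: measurableT_comp mg mact.
Qed.

Let int_indic : (\int[mu]_t (\1_I t)%:E = (b - a)%:E)%E.
Proof.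
rewrite integral_indic// setIT; have := lebesgue_measure_itv `[a, b].
by rewrite /= lte_fin ab -EFinB => H; exact: H.
Qed.

Lemma orbit_fun_integrable g : m.-integrable setT (EFin \o g) ->
  (m \x mu)%E.-integrable setT (orbit_fun g).
Proof.
move=> ig; have mg : measurable_fun setT g by apply/measurable_EFinP; exact: measurable_int ig.
have [_ gi] := integrableP _ _ _ ig.
apply/integrable21ltyP; first exact: measurable_orbit_fun.
set G := (\int[m]_x _)%E in gi.
rewrite (_ : (fun t => _) = (fun t => (\1_I t)%:E * G)%E); last first.
  apply/funext => t; rewrite /orbit_fun /=.
  under eq_integral do rewrite normrM EFinM.
  have mag : measurable_fun setT (fun x => `|(g x)%:E|%E) := measurableT_comp (@abse_measurable R setT) (measurable_int m ig).
  have H : (\int[m]_x `|(g (act t x))%:E| = G)%E := ge0_integral_act t mag (fun x => abse_ge0 (g x)%:E).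
  rewrite -H -ge0_integralZl//; last exact: (measurableT_comp mag (mact1 t)).
  by rewrite ger0_norm.
have G0 : (0 <= G)%E by exact: integral_ge0.
rewrite ge0_integralZr//.
  2: by apply/measurable_EFinP; exact: measurable_indic.
by rewrite int_indic lte_mul_pinfty// ?lee_fin ?subr_ge0 ?ltW.
Qed.

(** After exchanging the integrals, invariance makes the inner one independent of t. *)
Lemma orbit_fun_mean g : m.-integrable setT (EFin \o g) ->
  (\int[m]_x \int[mu]_t orbit_fun g (x, t) = ((b - a) * \int[m]_x g x)%:E)%E.
Proof.
move=> ig; rewrite Fubini; last exact: orbit_fun_integrable.
have fi : (\int[m]_x (g x)%:E)%E \is a fin_num by exact: integrable_fin_num.
rewrite (_ : (fun t => _) = (fun t => (\int[m]_x g x)%:E * (\1_I t)%:E)%E); last first.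
  apply/funext => t; rewrite /orbit_fun /=.
  under eq_integral do rewrite EFinM.
  rewrite integralZl//; last exact: (integrable_act t ig).
  rewrite (integral_act t ig) muleC; congr (_ * _)%E.
  by rewrite /Rintegral fineK.
rewrite integralZl//; last by apply/integrable_indic_itv.
by rewrite int_indic -EFinM mulrC.
Qed.

(* By invariance [\int y h] is an average over orbits of [\int_a^b (y h) (act t x) dt]. *)
Lemma orbit_weak_cvg (y : nat -> T -> R) (M : R) (h : T -> R) :
  (forall k, measurable_fun setT (y k)) -> (forall k x, `|y k x| <= M) ->
  m.-integrable setT (EFin \o h) ->
  (forall x (h' : R -> R), mu.-integrable `[a, b] (EFin \o h') ->
    \int[mu]_(t in `[a, b]) (y k (act t x) * h' t) @[k --> \oo] --> (0 : R)) ->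
  \int[m]_x (y k x * h x) @[k --> \oo] --> (0 : R).
Proof.
move=> my yM ih ycvg.
pose yh k x := y k x * h x; pose Mh x := M * `|h x|.
have mh : measurable_fun setT h by apply/measurable_EFinP; exact: measurable_int ih.
have iyh k : m.-integrable setT (EFin \o yh k).
  by apply: (@bounded_mul_integrable _ _ _ _ _ _ _ M) => // x _; exact: yM.
have iMh : m.-integrable setT (EFin \o Mh).
  by apply: RintegrableZl => //; exact: (integrable_abse ih).
have M0 : 0 <= M by apply: le_trans (yM 0%N point).
have imp g x : (\int[mu]_t orbit_fun g (x, t) = \int[mu]_(t in `[a, b]) (g (act t x))%:E)%E.
  rewrite [RHS]integral_mkcond; apply: eq_integral => t _.
  rewrite /orbit_fun /= patchE indicE; case: (t \in _); by rewrite ?mul1r ?mul0r.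
(* The dominating function is the orbit integral of M |h|, integrable by Fubini's theorem. *)
have dom k x : (`|\int[mu]_t orbit_fun (yh k) (x, t)| <=
    \int[mu]_t orbit_fun Mh (x, t))%E.
  have mo g : measurable_fun setT g -> measurable_fun setT (fun t : RM => orbit_fun g (x, t)).
    by move=> mg; exact: measurableT_comp (measurable_orbit_fun mg) (measurable_pair1 x).
  apply: le_trans (le_abse_integral _ _ _) _ => //.
    by apply: mo; exact: measurable_funM.
  apply: ge0_le_integral => //.
  - by apply: measurableT_comp => //; apply: mo; exact: measurable_funM.
  - by apply: mo; apply: measurable_funM => //; exact: measurableT_comp.
  - move=> t _; rewrite /orbit_fun /= lee_fin normrM ger0_norm// ler_wpM2l//.
    by rewrite normrM ler_wpM2r.
have [|||||_ _ H] := @dominated_convergence _ _ _ m setT measurableT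
  (fun k x => \int[mu]_t orbit_fun (yh k) (x, t))%E (cst 0%E)
  (fun x => \int[mu]_t orbit_fun Mh (x, t))%E.
- by move=> k; exact: measurable_fubini_F (orbit_fun_integrable (iyh k)).
- exact: measurable_cst.
(* Along the orbit of x, h is integrable only for almost every x, which is what dominated
   convergence asks for. *)
- have := ae_integrable1 (orbit_fun_integrable ih); apply: filterS => x ix _.
  have ihx : mu.-integrable `[a, b] (EFin \o (fun t => h (act t x))).
    apply/integrable_mkcond => //; apply: eq_integrable ix => // t _.
    by rewrite /orbit_fun /= patchE indicE; case: (t \in _); rewrite ?mul1r ?mul0r.
  have mob k : measurable_fun `[a, b] (fun t : RM => y k (act t x)).
    apply: measurable_funTS.
    exact: measurableT_comp (measurableT_comp (my k) mact) (measurable_pair1 x).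
  under eq_fun do rewrite imp.
  have := ycvg x _ ihx; set J := fun k => _ => Jcvg.
  rewrite (_ : (fun k => _) = EFin \o J); first by apply: cvg_EFin; [exact: nearW|exact: Jcvg].
  apply/funext => k; rewrite /J /= /Rintegral fineK//.
  apply: integrable_fin_num => //.
  exact: (@bounded_mul_integrable _ _ _ mu _ (fun t => y k (act t x)) _ M _ (mob k) (fun t _ => yM k _) ihx).
- exact: integrable_fubini_F (orbit_fun_integrable iMh).
- by apply: aeW => x k _; exact: dom.
move: H; rewrite integral_cst// mul0e.
under eq_fun do rewrite orbit_fun_mean//.
move=> /fine_cvgP[_ H].
have ba : b - a != 0 by rewrite subr_eq0 gt_eqF.
rewrite -(mulr0 (b - a)^-1) (_ : (fun k => _) = fun k => (b - a)^-1 * ((b - a) * \int[m]_x (y k x * h x))); last first.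
  by apply/funext => k; rewrite mulrA mulVf// mul1r.
by apply: cvgM; [exact: cvg_cst|exact: H].
Qed.

End orbit_averages.

(** * Rotation invariance *)

Section skew_products.
Context d1 d2 (T1 : measurableType d1) (T2 : measurableType d2) (R : realType).
Variables (m1 : {sigma_finite_measure set T1 -> \bar R}) (m2 : {sigma_finite_measure set T2 -> \bar R}).

(** Gives access to sections in the other variable, as [skew_product_left] requires. *)
Lemma product_measureE2 A : measurable A -> ((m1 \x m2) A = (m1 \x^ m2) A)%E.
Proof.
by move=> mA; apply: product_measure_unique => // B C mB mC/=; rewrite product_measure2E.
Qed.

(** The section at x of the preimage is the preimage under f x of the section at x, of equal
    measure; integrate over x. *)
Lemma skew_product_right (f : T1 -> T2 -> T2) A :
  (forall x B, measurable B -> m2 (f x @^-1` B) = m2 B) -> measurable A ->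
  ((m1 \x m2) ((fun p => (p.1, f p.1 p.2)) @^-1` A) = (m1 \x m2) A)%E.
Proof.
move=> fm mA; rewrite /product_measure1; apply: eq_integral => x _ /=.
rewrite -[RHS](fm x); last exact: measurable_xsection.
by congr (m2 _); apply/seteqP; split => y; rewrite /xsection /= !inE.
Qed.

Lemma skew_product_left (f : T2 -> T1 -> T1) A :
  (forall y B, measurable B -> m1 (f y @^-1` B) = m1 B) ->
  measurable_fun setT (fun p : T1 * T2 => f p.2 p.1) -> measurable A ->
  ((m1 \x m2) ((fun p => (f p.2 p.1, p.2)) @^-1` A) = (m1 \x m2) A)%E.
Proof.
move=> fm mf mA; rewrite !product_measureE2//; last first.
  rewrite -[X in measurable X]setTI; suff mF : measurable_fun setT (fun p => (f p.2 p.1, p.2)) by exact: mF.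
  by apply/measurable_fun_pairP; split => //; exact: measurable_snd.
rewrite /product_measure2; apply: eq_integral => y _ /=.
rewrite -[RHS](fm y); last exact: measurable_ysection.
by congr (m1 _); apply/seteqP; split => x; rewrite /ysection /= !inE.
Qed.

Lemma product_preserving (f : T1 -> T1) (g : T2 -> T2) A :
  measurable_fun setT f -> measurable_fun setT g ->
  (forall B, measurable B -> m1 (f @^-1` B) = m1 B) ->
  (forall B, measurable B -> m2 (g @^-1` B) = m2 B) -> measurable A ->
  ((m1 \x m2) ((fun p => (f p.1, g p.2)) @^-1` A) = (m1 \x m2) A)%E.
Proof.
move=> mf mg fm gm mA.
have mA' : measurable ((fun p : T1 * T2 => (p.1, g p.2)) @^-1` A).
  rewrite -[X in measurable X]setTI; suff mF : measurable_fun setT (fun p : T1 * T2 => (p.1, g p.2)) by exact: mF.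
  apply/measurable_fun_pairP; split; first exact: measurable_fst.
  exact: measurableT_comp mg measurable_snd.
rewrite -[RHS](@skew_product_right (fun=> g) A)//.
rewrite -[RHS](@skew_product_left (fun=> f))//.
exact: measurableT_comp mf measurable_fst.
Qed.

End skew_products.

(** * Rotation invariance of Lebesgue measure in the plane *)

Section rotations.
Variable R : realType.
Local Notation C := R[i].
Local Notation RM := (measurableTypeR R).
Local Notation mu := (@lebesgue_measure R).

Lemma lebesgue_measure_translate (c : R) (A : set RM) : measurable A ->
  mu ((fun x => x + c) @^-1` A) = mu A.
Proof.
have mc : measurable_fun (setT : set RM) (fun x : RM => (x + c : RM)).
  by apply: measurable_funD => //; exact: measurable_cst.
move=> mA; pose nu : {measure set RM -> \bar R} :=
  measure_function_pushforward__canonical__measure_function_Measure mu mc.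
suff H X : ocitv X -> mu X = nu X by exact: esym (lebesgue_measure_unique H mA).
move=> [[a b]] _ <-; rewrite /nu /= /pushforward.
rewrite (_ : _ @^-1` _ = `]a - c, b - c]%classic); last first.
  by apply/seteqP; split => x; rewrite /= !in_itv /= ltrBlDr lerBrDr.
have := lebesgue_measure_itv `]a, b]; have := lebesgue_measure_itv `]a - c, b - c].
rewrite /= !lte_fin ltrD2r => H1 H2; apply: (etrans H2); apply: esym; apply: (etrans H1).
by case: ifP => // _; rewrite -!EFinB; congr EFin; ring.
Qed.

Let shear_right (t : R) (A : set (RM * RM)) : measurable A ->
  ((mu \x mu) ((fun p : RM * RM => (p.1, p.2 + t * p.1)%R) @^-1` A) = (mu \x mu) A)%E.
Proof.
move=> mA; apply: (@skew_product_right _ _ _ _ _ mu mu (fun x y => y + t * x)) => // x B.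
exact: lebesgue_measure_translate.
Qed.

Let shear_left (t : R) (A : set (RM * RM)) : measurable A ->
  ((mu \x mu) ((fun p : RM * RM => (p.1 + t * p.2, p.2)%R) @^-1` A) = (mu \x mu) A)%E.
Proof.
move=> mA; apply: (@skew_product_left _ _ _ _ _ mu mu (fun y x => x + t * y)) => //.
  by move=> x B; exact: lebesgue_measure_translate.
apply: measurable_funD; first exact: measurable_fst.
by apply: measurable_funM; [exact: measurable_cst|exact: measurable_snd].
Qed.

Let measurable_shear_right (t : R) (A : set (RM * RM)) : measurable A ->
  measurable ((fun p : RM * RM => (p.1, p.2 + t * p.1)%R) @^-1` A).
Proof.
move=> mA; rewrite -[X in measurable X]setTI.
suff mF : measurable_fun setT (fun p : RM * RM => (p.1, p.2 + t * p.1)) by exact: mF.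
apply/measurable_fun_pairP; split; first exact: measurable_fst.
apply: measurable_funD; first exact: measurable_snd.
by apply: measurable_funM; [exact: measurable_cst|exact: measurable_fst].
Qed.

Let measurable_shear_left (t : R) (A : set (RM * RM)) : measurable A ->
  measurable ((fun p : RM * RM => (p.1 + t * p.2, p.2)%R) @^-1` A).
Proof.
move=> mA; rewrite -[X in measurable X]setTI.
suff mF : measurable_fun setT (fun p : RM * RM => (p.1 + t * p.2, p.2)) by exact: mF.
apply/measurable_fun_pairP; split; last exact: measurable_snd.
apply: measurable_funD; first exact: measurable_fst.
by apply: measurable_funM; [exact: measurable_cst|exact: measurable_snd].
Qed.

(* A rotation of angle other than pi is a product of three shears. *)
Let plane_rotation (a b : R) (A : set (RM * RM)) : a ^+ 2 + b ^+ 2 = 1 -> 1 + a != 0 -> measurable A ->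
  ((mu \x mu) ((fun p : RM * RM => (a * p.1 - b * p.2, a * p.2 + b * p.1)%R) @^-1` A) =
   (mu \x mu) A)%E.
Proof.
(* For a = cos x and b = sin x this is - tan (x/2), the coefficient of the two outer shears; the
   middle one has coefficient b. *)
move=> ab1 a1 mA; pose t := - b / (1 + a).
have ta : t * (1 + a) = - b by rewrite /t mulfVK.
have tb : 1 + t * b = a.
  apply: (mulfI a1); rewrite mulrDr mulr1 mulrA (mulrC _ t) ta.
  have b2 : b ^+ 2 = 1 - a ^+ 2 by rewrite -ab1; ring.
  by rewrite mulNr -expr2 b2; ring.
have E1 (x y : R) : a * x - b * y = x + t * y + t * (y + b * (x + t * y)).
  transitivity ((1 + t * b) * x + t * (1 + (1 + t * b)) * y); last by ring.
  by rewrite tb ta; ring.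
have E2 (x y : R) : a * y + b * x = y + b * (x + t * y).
  transitivity ((1 + t * b) * y + b * x); last by ring.
  by rewrite tb.
pose Sl := fun p : RM * RM => (p.1 + t * p.2, p.2).
pose Sr := fun p : RM * RM => (p.1, p.2 + b * p.1).
have -> : (fun p : RM * RM => (a * p.1 - b * p.2, a * p.2 + b * p.1)) @^-1` A =
    Sl @^-1` (Sr @^-1` (Sl @^-1` A)).
  by apply/funext => -[x y]; rewrite /preimage /mkset /Sl /Sr /= E1 E2.
have m1 := measurable_shear_left t mA; have m2 := measurable_shear_right b m1.
exact: etrans (shear_left t m2) (etrans (shear_right b m1) (shear_left t mA)).
Qed.

Let of_pair (p : RM * RM) : C := p.1 +i* p.2.

Let lebesgue_CE (A : set C) : lebesgue_C R A = (mu \x mu)%E (of_pair @^-1` A).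
Proof. reflexivity. Qed.

Lemma lebesgue_C_rotation (c : C) (A : set C) : cabs c = 1 -> measurable A ->
  lebesgue_C R ((fun z => c * z) @^-1` A) = lebesgue_C R A.
Proof.
have mc (c0 : C) B : measurable B -> measurable ((fun z : C => c0 * z) @^-1` B).
  move=> mB; rewrite -[X in measurable X]setTI.
  suff mF : measurable_fun setT (fun z : C => c0 * z) by exact: mF.
  apply/measurable_fun_complexP; split.
    rewrite (_ : _ \o _ = fun z : C => Re c0 * Re z - Im c0 * Im z); last by apply/funext => z; rewrite /= cReM.
    apply: measurable_funB; apply: measurable_funM => //; [exact: measurable_Re|exact: measurable_Im].
  rewrite (_ : _ \o _ = fun z : C => Re c0 * Im z + Im c0 * Re z); last by apply/funext => z; rewrite /= cImM.
  apply: measurable_funD; apply: measurable_funM => //; [exact: measurable_Im|exact: measurable_Re].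
have main (c0 : C) B : cabs c0 = 1 -> 1 + Re c0 != 0 -> measurable B ->
    lebesgue_C R ((fun z => c0 * z) @^-1` B) = lebesgue_C R B.
  move=> c1 a1 mB.
  have mof : measurable_fun setT of_pair.
    by apply/measurable_fun_complexP; split; [exact: measurable_fst|exact: measurable_snd].
  have ab1 : Re c0 ^+ 2 + Im c0 ^+ 2 = 1 by rewrite -sqr_cabs c1 expr1n.
  have mB' : measurable (of_pair @^-1` B) by rewrite -[X in measurable X]setTI; exact: mof.
  have := plane_rotation ab1 a1 mB'; rewrite !lebesgue_CE; set F := _ @^-1` (_ @^-1` B).
  suff -> : F = of_pair @^-1` ((fun z => c0 * z) @^-1` B) by move=> H; exact: H.
  apply/funext => -[x y]; rewrite /F /preimage /mkset; congr B.
  by apply: complex_eq; rewrite /= ?cReM ?cImM /=; ring.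
move=> c1 mA; have [a1|a1] := eqVneq (1 + Re c) 0; last exact: main.
have i1 : cabs ('i : C) = 1.
  by rewrite cabs_def /= expr0n expr1n add0r sqrtr1.
(* The exceptional case c = -1 is the composite of two quarter turns. *)
have c2 : c = 'i * 'i.
  have aE : Re c = -1 by move/eqP: a1; rewrite addrC addr_eq0 => /eqP.
  have sq : Re c ^+ 2 + Im c ^+ 2 = 1 by rewrite -sqr_cabs c1 expr1n.
  have bE : Im c = 0.
    by apply/eqP; rewrite -sqrf_eq0; apply/eqP; move: sq; rewrite aE => sq; lra.
  by apply: complex_eq; rewrite ?cReM ?cImM /= ?aE ?bE; ring.
have n1 : 1 + Re ('i : C) != 0 by rewrite /= addr0 oner_neq0.
have E : (fun z => c * z) @^-1` A = (fun z => 'i * z) @^-1` ((fun z => 'i * z) @^-1` A).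
  by apply/funext => z; rewrite /preimage /mkset mulrA -c2.
have R1 := main 'i ((fun z => 'i * z) @^-1` A) i1 n1 (mc 'i A mA).
have R2 := main 'i A i1 n1 mA.
by rewrite E R1 R2.
Qed.

End rotations.

Section measurable_scaling.
Context d (T : measurableType d) (R : realType) (n : nat).
Local Notation C := R[i].

Lemma measurable_complexM (f g : T -> C) : measurable_fun setT f -> measurable_fun setT g ->
  measurable_fun setT (fun x => f x * g x).
Proof.
move=> /measurable_fun_complexP[fR fI] /measurable_fun_complexP[gR gI].
apply/measurable_fun_complexP; split.
  rewrite (_ : _ \o _ = fun x => Re (f x) * Re (g x) - Im (f x) * Im (g x)); last first.
    by apply/funext => x; rewrite /= cReM.
  by apply: measurable_funB; apply: measurable_funM.
rewrite (_ : _ \o _ = fun x => Re (f x) * Im (g x) + Im (f x) * Re (g x)); last first.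
  by apply/funext => x; rewrite /= cImM.
by apply: measurable_funD; apply: measurable_funM.
Qed.

Lemma measurable_rowZ (f : T -> C) (g : T -> 'rV[C]_n) : measurable_fun setT f ->
  measurable_fun setT g -> measurable_fun setT (fun x => f x *: g x).
Proof.
move=> mf mg; apply/measurable_fun_rowP => i.
rewrite (_ : (fun _ => _) = fun x => f x * g x 0 i); last by apply/funext => x; rewrite mxE.
by apply: measurable_complexM => //; exact: measurableT_comp (measurable_coor i) mg.
Qed.

End measurable_scaling.

(** * Rotation invariance of the surface measure *)

Section sphere_rotation.
Variable R : realType.
Local Notation C := R[i].

Lemma measurable_scale n (c : C) : measurable_fun setT (fun z : 'rV[C]_n => c *: z).
Proof. by apply: (@measurable_rowZ _ _ R n (fun=> c) id); [exact: measurable_cst|exact: measurable_id]. Qed.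

Let cons_row n (p : C * 'rV[C]_n) : 'rV[C]_n.+1 := \row_j oapp (p.2 0) p.1 (unlift ord0 j).

Let lebesgue_CnSE n (A : set 'rV[C]_n.+1) :
  lebesgue_Cn R n.+1 A = (lebesgue_C R \x lebesgue_Cn R n)%E (@cons_row n @^-1` A).
Proof. reflexivity. Qed.

(** Induction on n: through [cons_row] the scalar acts separately on the first coordinate and on the
    others. *)
Lemma lebesgue_Cn_rotation n (c : C) (A : set 'rV[C]_n) : cabs c = 1 -> measurable A ->
  lebesgue_Cn R n ((fun z => c *: z) @^-1` A) = lebesgue_Cn R n A.
Proof.
move=> c1; elim: n A => [|n IH] A mA.
  have -> // : (fun z : 'rV[C]_0 => c *: z) @^-1` A = A.
  by apply/funext => z; rewrite /preimage /mkset (thinmx0 (c *: z)) (thinmx0 z).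
rewrite !lebesgue_CnSE.
have -> : @cons_row n @^-1` ((fun z => c *: z) @^-1` A) =
    (fun p => (c * p.1, c *: p.2)) @^-1` (@cons_row n @^-1` A).
  apply/funext => -[x v]; rewrite /preimage /mkset; congr A.
  apply/rowP => j; rewrite !mxE /=; case: unliftP => [i _|_] //=.
  by rewrite mxE.
apply: product_preserving.
- by apply: (@measurable_complexM _ _ R (fun=> c) id); [exact: measurable_cst|exact: measurable_id].
- exact: measurable_scale.
- by move=> B mB; exact: lebesgue_C_rotation.
- exact: IH.
rewrite -[X in measurable X]setTI; suff mF : measurable_fun setT (@cons_row n) by exact: mF.
apply/measurable_fun_rowP => i; under eq_fun do rewrite mxE.
case: unliftP => [j _|_] /=; last exact: measurable_fst.
exact: (measurableT_comp (measurable_coor j) measurable_snd).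
Qed.

Variable n : nat.
Local Notation Cn := 'rV[C]_n.

(** Unimodular scalars preserve the ball and commute with [radial_proj], so the cone over the
    preimage is the preimage of the cone. *)
Lemma sphere_measure_rotation (c : C) (A : set Cn) : cabs c = 1 -> measurable A ->
  sphere_measure ((fun z : Cn => c *: z) @^-1` A) = sphere_measure A.
Proof.
move=> c1 mA; rewrite /sphere_measure; congr (_ * _)%E.
have mB : measurable (@unit_ball R n `&` @radial_proj R n @^-1` A).
  apply: measurableI; first exact: measurable_unit_ball.
  by rewrite -[X in measurable X]setTI; exact: measurable_radial_proj.
rewrite -(lebesgue_Cn_rotation c1 mB).
have enc (z : Cn) : enorm (c *: z) = enorm z by rewrite enormZ c1 mul1r.
congr (lebesgue_Cn R n _); apply/funext => z.
rewrite /setI /preimage /mkset /unit_ball /mkset enc /radial_proj enc.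
by rewrite !scalerA [X in X *: z]mulrC.
Qed.

(* This needs no bound on the volume of the ball: were it infinite, [fine] would
   make the normalizing factor 0. *)
Lemma sphere_measure_fin : (sphere_measure (setT : set Cn) < +oo)%E.
Proof.
rewrite /sphere_measure preimage_setT setIT.
have [v0|v0] := eqVneq (fine (lebesgue_Cn R n (@unit_ball R n))) 0.
  by rewrite v0 invr0 mul0e ltry.
rewrite -[X in (_ * X)%E]fineK ?ltry//.
by rewrite fin_numE; apply/andP; split; apply: contraNneq v0 => ->.
Qed.

End sphere_rotation.

(** * Measurability of boundary functions *)

Section ball_measurability.
Variables (R : realType) (n : nat).
Local Notation C := R[i].
Local Notation Cn := 'rV[C]_n.
Implicit Types (z w : Cn) (phi : Cn -> C).
Local Notation gp := (@grid_point R n _).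

Lemma measurable_enorm_ball c (r : R) : measurable [set z : Cn | enorm (z - c) < r].
Proof.
rewrite (_ : mkset _ = (fun z : Cn => enorm (z - c)) @^-1` `]-oo, r[); last first.
  by apply/seteqP; split => z /=; rewrite in_itv.
rewrite -[X in measurable X]setTI.
suff mf : measurable_fun setT (fun z : Cn => enorm (z - c)) by exact: mf.
apply: (measurableT_comp (@measurable_enorm R n)); apply/measurable_fun_rowP => i.
apply/measurable_fun_complexP; split.
  rewrite (_ : _ \o _ = fun z : Cn => Re (z 0 i) - Re (c 0 i)); last first.
    by apply/funext => z; rewrite /= !mxE cReB.
  apply: measurable_funB => //; exact: measurableT_comp (@measurable_Re R) (measurable_coor i).
rewrite (_ : _ \o _ = fun z : Cn => Im (z 0 i) - Im (c 0 i)); last first.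
  by apply/funext => z; rewrite /= !mxE cImB.
apply: measurable_funB => //; exact: measurableT_comp (@measurable_Im R) (measurable_coor i).
Qed.

Lemma archi_inv (e : R) : 0 < e -> exists k : nat, k.+1%:R^-1 < e.
Proof.
move=> e0; have /cvgrPdist_lt/(_ _ e0) := @cvg_harmonic R.
by move=> /(@filter_ex _ \oo _)[k]; rewrite sub0r normrN ger0_norm ?invr_ge0// => H; exists k.
Qed.

(* An open subset of the ball is a countable union of balls centred at grid points. *)
Lemma ball_open_measurable (U : set Cn) :
  (forall z, U z -> enorm z < 1 /\ exists2 d : R, 0 < d & forall w, enorm (w - z) < d -> U w) ->
  measurable U.
Proof.
move=> Uo.
have -> : U = \bigcup_N \bigcup_k \bigcup_(f : {ffun 'I_n -> 'I_(N.*2).+1 * 'I_(N.*2).+1})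
    [set z | enorm (z - gp f) < k.+1%:R^-1 /\
       (forall w, enorm (w - gp f) < k.+1%:R^-1 -> U w)].
  apply/seteqP; split => [z Uz|z [N _ [k _ [f _ [zf]]]]]; last exact.
  have [z1 [d d0 Ud]] := Uo z Uz.
  have d2 : 0 < d / 2 by rewrite divr_gt0.
  have [k kd] := archi_inv d2.
  (* A mesh finer than [e] makes the grid error 2n/(N + 1) smaller than 1/(k + 1); the added 1 keeps
     the denominator positive when n = 0. *)
  pose e := k.+1%:R^-1 / (2 * n%:R + 1) : R.
  have n0 : 0 < 2 * n%:R + 1 :> R by rewrite ltr_wpDl// mulr_ge0.
  have e0 : 0 < e by rewrite divr_gt0// invr_gt0.
  have [N Ne] := archi_inv e0.
  have [f Hf] := @grid_near R n N.+1 z (ltn0Sn N) z1.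
  have near : enorm (z - gp f) < k.+1%:R^-1.
    rewrite enormB; apply: le_lt_trans Hf _.
    have : (2 * n%:R + 1) * N.+1%:R^-1 < k.+1%:R^-1 :> R.
      by rewrite mulrC -ltr_pdivlMr.
    have : 0 <= N.+1%:R^-1 :> R by rewrite invr_ge0.
    move: (N.+1%:R^-1) (k.+1%:R^-1) => x c x0.
    rewrite (_ : (2 * n%:R + 1) * x = 2 * n%:R * x + x); last by ring.
    by move: (2 * n%:R * x) => y; lra.
  exists N.+1 => //; exists k => //; exists f => //; split => // w wf; apply: Ud.
  have := enormD (w - gp f) (gp f - z); rewrite addrA subrK => /le_lt_trans; apply.
  by rewrite (splitr d) (enormB (gp f) z); apply: ltrD; [exact: lt_trans wf kd|exact: lt_trans near kd].
apply: bigcupT_measurable => N; apply: bigcupT_measurable => k.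
apply: countable_bigcupT_measurable => [|f]; first exact: countableP.
have [H|H] := pselect (forall w, enorm (w - gp f) < k.+1%:R^-1 -> U w).
  rewrite (_ : mkset _ = [set z | enorm (z - gp f) < k.+1%:R^-1]).
    exact: measurable_enorm_ball.
  by apply/seteqP; split => z //= [].
rewrite (_ : mkset _ = set0); first exact: measurable0.
by apply/seteqP; split => z //= [_ /H].
Qed.

(** The values of [phi] off the ball are arbitrary and might spoil measurability. *)
Definition zero_ext phi z : C := if enorm z < 1 then phi z else 0.

Definition ball_continuous phi := forall z, enorm z < 1 -> forall e : R, 0 < e ->
  exists2 d : R, 0 < d & forall w, enorm (w - z) < d -> cabs (phi w - phi z) <= e.

Lemma measurable_zero_ext phi : ball_continuous phi -> measurable_fun setT (zero_ext phi).
Proof.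
move=> cphi.
have main (p : C -> R) : (forall x y : C, `|p x - p y| <= cabs (x - y)) -> p 0 = 0 ->
    measurable_fun setT (p \o zero_ext phi).
  move=> plip p0.
  have mp : measurable_fun (@unit_ball R n) (p \o phi).
    move=> mD; apply: (measurability _ (RGenOInfty.measurableE R)) => //.
    move=> /= _ [_ [a ->] <-]; rewrite preimage_itvoy; apply: ball_open_measurable.
    move=> z [z1 /= az]; split => //.
    have e0 : 0 < (p (phi z) - a) / 2 by rewrite divr_gt0 ?subr_gt0.
    have [d d0 Hd] := cphi z z1 _ e0.
    have z1' : 0 < 1 - enorm z by rewrite subr_gt0.
    exists (Num.min d (1 - enorm z)); first by rewrite lt_min d0.
    move=> w; rewrite lt_min => /andP[wd w1]; split.
      by rewrite /unit_ball /=; have := enormD (w - z) z; rewrite subrK; lra.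
    have := le_trans (plip _ _) (Hd w wd); rewrite ler_norml => /andP[h1 h2] /=.
    by move: az h1 h2 => /=; move: (p (phi w)) (p (phi z)) => x y; lra.
  rewrite (_ : _ \o _ = (p \o phi) \_ (@unit_ball R n)).
    exact: (measurable_restrictT (p \o phi) (@measurable_unit_ball R n)).1 mp.
  apply/funext => z; rewrite patchE /zero_ext /=; case: ifPn => z1.
    by rewrite mem_set.
  by rewrite memNset//; apply/negP.
apply/measurable_fun_complexP; split; apply: main => // z w.
- by rewrite -cReB normr_Re.
- by rewrite -cImB normr_Im.
Qed.

Lemma schur_ball_continuous phi : schur_class phi -> ball_continuous phi.
Proof.
move=> sphi z z1 e e0; have z1' : 0 < 1 - enorm z by rewrite subr_gt0.
exists (Num.min ((1 - enorm z) / 2) (e * (1 - enorm z) / 16)).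
  by rewrite lt_min !divr_gt0// mulr_gt0.
move=> w; rewrite lt_min => /andP[w1 w2].
apply: le_trans (schur_lipschitz sphi z1 w1) _.
by rewrite ler_pdivrMr// mulrC -ler_pdivlMr// ltW.
Qed.

End ball_measurability.

(** * Radial limits as measurable functions *)

Section radial_limits.
Variables (R : realType) (n : nat).
Local Notation C := R[i].
Local Notation Cn := 'rV[C]_n.
Variable phi : Cn -> C.
Hypothesis cphi : ball_continuous phi.
Implicit Types (z w : Cn).

Let cabs_triangle (x y w : C) : cabs (x - w) <= cabs (x - y) + cabs (y - w).
Proof. by apply: le_trans (cabsD _ _); rewrite addrA subrK. Qed.

Lemma near_left1P (P : R -> Prop) : (\forall r \near (1 : R)^'-, P r) <->
  exists2 d, 0 < d & forall r, 1 - d < r -> r < 1 -> P r.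
Proof.
split=> [/nbhs_ballP[d /= d0 Hd]|[d d0 Hd]].
  exists d => // r r1 r2; apply: Hd => //.
  by rewrite /ball /= gtr0_norm ?subr_gt0// ltrBlDr addrC -ltrBlDr.
apply/nbhs_ballP; exists d => //= r; rewrite /ball /= => rd r1; apply: Hd => //.
by move: rd; rewrite gtr0_norm ?subr_gt0// ltrBlDr addrC -ltrBlDr.
Qed.

Definition radial_lim z (l : C) := forall e : R, 0 < e -> exists2 d, 0 < d &
  forall r, 1 - d < r -> r < 1 -> cabs (phi (r%:C *: z) - l) <= e.

Lemma radial_limP z l : phi (r%:C *: z) @[r --> (1 : R)^'-] --> l <-> radial_lim z l.
Proof.
split=> [/cvg_cabsP H e /H /near_left1P //|H].
by apply/cvg_cabsP => e e0; apply/near_left1P; exact: H.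
Qed.

Lemma boundary_fun_lim z l : radial_lim z l -> boundary_fun phi z = l.
Proof. by move=> /radial_limP H; apply: cvg_lim H; exact: norm_hausdorff. Qed.

Lemma boundary_fun_nolim z : ~ (exists l, radial_lim z l) -> boundary_fun phi z = 0.
Proof.
move=> H; rewrite /boundary_fun dvgP// => /cvg_ex[l Hl].
by apply: H; exists l; apply/radial_limP.
Qed.

(** Radii increasing to 1; the shift by 2 keeps the first one positive. *)
Let step (N : nat) : R := 1 - N.+2%:R^-1.

Let step_itv N : 0 < step N < 1.
Proof.
by rewrite /step subr_gt0 invf_lt1 ?ltr1n//= ltrBlDr ltrDl invr_gt0.
Qed.

Let radial z r := zero_ext phi (r%:C *: z).

Let enorm_radial z (r : R) : enorm z = 1 -> 0 < r -> enorm (r%:C *: z) = r.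
Proof. by move=> z1 r0; rewrite enormZ cabs_real z1 mulr1 gtr0_norm. Qed.

Let radialE z (r : R) : enorm z = 1 -> 0 < r -> r < 1 -> radial z r = phi (r%:C *: z).
Proof. by move=> z1 r0 r1; rewrite /radial /zero_ext enorm_radial// r1. Qed.

Let measurable_radial r : measurable_fun setT (fun z => radial z r).
Proof.
apply: (measurableT_comp (measurable_zero_ext cphi)); exact: measurable_scale.
Qed.

(* The points of the sphere with a radial limit; restricting the Cauchy condition to
   rational radii makes the measurability of this set visible. *)
Definition radial_cauchy : set Cn := [set z | enorm z = 1 /\ forall m : nat, exists N : nat,
  forall q : rat, step N < (ratr q : R) < 1 -> cabs (radial z (ratr q) - radial z (step N)) <= m.+1%:R^-1].

Lemma measurable_radial_cauchy : measurable radial_cauchy.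
Proof.
rewrite (_ : radial_cauchy = @unit_sphere R n `&` \bigcap_m \bigcup_N ~` (\bigcup_(q : rat)
    [set z | step N < (ratr q : R) < 1 /\ m.+1%:R^-1 < cabs (radial z (ratr q) - radial z (step N))])); last first.
  apply/seteqP; split => z [z1 Hz]; split => //.
    move=> m _; have [N HN] := Hz m; exists N => // -[q _ [qN]].
    by rewrite ltNge => /negP; apply; exact: HN.
  move=> m; have [N _ HN] := Hz m I; exists N => q qN; rewrite leNgt; apply/negP => H.
  by apply: HN; exists q.
apply: measurableI; first exact: measurable_unit_sphere.
apply: bigcapT_measurable => m; apply: bigcupT_measurable => N; apply: measurableC.
apply: countable_bigcupT_measurable => [|q]; first exact: countableP.
have [H|H] := boolP (step N < (ratr q : R) < 1); last first.
  rewrite (_ : mkset _ = set0); first exact: measurable0.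
  by apply/seteqP; split => z //= [].
rewrite (_ : mkset _ =
    (fun z => cabs (radial z (ratr q) - radial z (step N))) @^-1` `]m.+1%:R^-1, +oo[); last first.
  by apply/seteqP; split => z /=; rewrite in_itv /= andbT; [case|split].
rewrite -[X in measurable X]setTI.
suff mf : measurable_fun setT (fun z => cabs (radial z (ratr q) - radial z (step N))) by exact: mf.
apply: (measurableT_comp (@measurable_cmod R)).
have /measurable_fun_complexP[a1 a2] := measurable_radial (ratr q).
have /measurable_fun_complexP[b1 b2] := measurable_radial (step N).
apply/measurable_fun_complexP; split.
  rewrite (_ : _ \o _ = fun z => Re (radial z (ratr q)) - Re (radial z (step N))); last first.
    by apply/funext => z; rewrite /= cReB.
  exact: measurable_funB.
rewrite (_ : _ \o _ = fun z => Im (radial z (ratr q)) - Im (radial z (step N))); last first.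
  by apply/funext => z; rewrite /= cImB.
exact: measurable_funB.
Qed.

Lemma radial_lim_cauchy z l : enorm z = 1 -> radial_lim z l -> radial_cauchy z.
Proof.
move=> z1 Hl; split => // m.
have e0 : 0 < m.+1%:R^-1 / 2 :> R by rewrite divr_gt0 ?invr_gt0.
have [d d0 Hd] := Hl _ e0; have [N Nd] := archi_inv d0; exists N => q /andP[q1 q2].
have /andP[N0 N1] := step_itv N.
have dN : 1 - d < step N.
  rewrite /step ltrD2l ltrN2; apply: lt_trans Nd.
  by rewrite ltf_pV2 ?posrE// ltr_nat.
rewrite !radialE//; last exact: lt_trans q1.
apply: le_trans (cabs_triangle _ l _) _; rewrite [leRHS](splitr); apply: lerD.
  by apply: Hd => //; exact: lt_trans q1.
by rewrite cabsB; exact: Hd.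
Qed.

(** Rational radii are dense and [phi] is continuous along the radius, so the Cauchy bound extends
    to real radii, up to an arbitrary e. *)
Lemma radial_cauchy_real z m : radial_cauchy z -> exists N, forall r : R,
  step N < r -> r < 1 -> cabs (phi (r%:C *: z) - phi ((step N)%:C *: z)) <= m.+1%:R^-1.
Proof.
move=> [z1 Hz]; have [N HN] := Hz m; exists N => r Nr r1.
have /andP[N0 N1] := step_itv N.
have r0 : 0 < r by exact: lt_trans Nr.
apply/ler_addgt0Pr => e e0.
have rz : enorm (r%:C *: z) < 1 by rewrite enorm_radial.
have [d d0 Hd] := cphi rz e0.
have lt : Num.max (r - d) (step N) < r by rewrite gt_max Nr andbT ltrBlDr ltrDl.
have [q] := rat_in_itvoo lt; rewrite in_itv /= gt_max => /andP[/andP[q1 q2] q3].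
have qN : step N < (ratr q : R) < 1 by rewrite q2 (lt_trans q3).
have := HN q qN; rewrite !radialE//; [|exact: lt_trans q2|exact: lt_trans r1] => H.

apply: le_trans (cabs_triangle _ (phi ((ratr q)%:C *: z)) _) _; rewrite addrC; apply: lerD => //.
rewrite cabsB; apply: Hd; rewrite -scalerBl -rmorphB enormZ cabs_real z1 mulr1.
by rewrite ltr0_norm ?subr_lt0//; lra.
Qed.

Lemma radial_cauchy_lim z : radial_cauchy z -> exists l, radial_lim z l.
Proof.
move=> cz.
have main (p : C -> R) : (forall x y : C, `|p x - p y| <= cabs (x - y)) ->
    exists a : R, p (phi (r%:C *: z)) @[r --> (1 : R)^'-] --> a.
  move=> plip; apply/cvg_ex/cauchy_cvgP; apply: cauchy_exP => e e0.
  have [m me] := archi_inv e0; have [N HN] := radial_cauchy_real m cz.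
  have /andP[N0 N1] := step_itv N.
  exists (p (phi ((step N)%:C *: z))); apply/near_left1P.
  exists (1 - step N); first by rewrite subr_gt0.
  move=> r; rewrite subKr => r1 r2; rewrite /ball /= distrC.
  by apply: le_lt_trans (plip _ _) _; apply: le_lt_trans me; exact: HN.
have [|a Ha] := main (@Re R); first by move=> x y; rewrite -cReB normr_Re.
have [|b Hb] := main (@Im R); first by move=> x y; rewrite -cImB normr_Im.
exists (a +i* b); apply/radial_limP/cvg_cabsP => e e0.
have e2 : 0 < e / 2 by rewrite divr_gt0.
have /cvgrPdist_le/(_ _ e2) h1 := Ha; have /cvgrPdist_le/(_ _ e2) h2 := Hb.
move: h1 h2; apply: filterS2 => r h1 h2.
apply: le_trans (cabs_le_ReIm _) _; rewrite cReB cImB /= (splitr e).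
by apply: lerD; rewrite distrC.
Qed.

(* Where there is no radial limit [boundary_fun] is 0, hence no null set has to be
   discarded for measurability. *)
Definition boundary_ext z : C := if enorm z == 1 then boundary_fun phi z else 0.

Lemma boundary_ext_lim z l : enorm z = 1 -> radial_lim z l -> boundary_ext z = l.
Proof. by move=> z1 /boundary_fun_lim bl; rewrite /boundary_ext z1 eqxx. Qed.

Lemma boundary_ext_ncauchy z : ~ radial_cauchy z -> boundary_ext z = 0.
Proof.
rewrite /boundary_ext; case: eqP => // z1 nz; apply: boundary_fun_nolim => -[l Hl].
by apply: nz; exact: radial_lim_cauchy Hl.
Qed.

(** Multiplied by the indicator of [radial_cauchy], the values at the radii [step k] converge at
    every point: to the radial limit where it exists, to the default 0 elsewhere. *)
Lemma measurable_boundary_ext : measurable_fun setT boundary_ext.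
Proof.
have main (p : C -> R) : (forall x y : C, `|p x - p y| <= cabs (x - y)) -> p 0 = 0 ->
    (forall r, measurable_fun setT (fun z => p (radial z r))) ->
    measurable_fun setT (p \o boundary_ext).
  move=> plip p0 mp.
  apply: (@measurable_fun_cvg _ _ _ _ (fun k z => \1_radial_cauchy z * p (radial z (step k)))) => [k|z _].
    by apply: measurable_funM => //; apply: measurable_indic; exact: measurable_radial_cauchy.
  have [cz|nz] := pselect (radial_cauchy z); last first.
    rewrite /= boundary_ext_ncauchy// p0 indicE memNset//.
    by under eq_fun do rewrite mul0r; exact: cvg_cst.
  have [l Hl] := radial_cauchy_lim cz; have [z1 _] := cz.
  rewrite /= (boundary_ext_lim z1 Hl) indicE mem_set//.
  apply/cvgrPdist_le => e e0; have [d d0 Hd] := Hl e e0.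
  have [N Nd] := archi_inv d0; near=> k; have /andP[k0 k1] := step_itv k.
  rewrite mul1r radialE//; apply: le_trans (plip _ _) _; rewrite cabsB; apply: Hd => //.
  rewrite /step ltrD2l ltrN2; apply: lt_trans Nd; rewrite ltf_pV2 ?posrE// ltr_nat !ltnS.
  by near: k; exact: nbhs_infty_ge.
apply/measurable_fun_complexP; split; apply: main => //.
- by move=> x y; rewrite -cReB normr_Re.
- by move=> r; have /measurable_fun_complexP[] := measurable_radial r.
- by move=> x y; rewrite -cImB normr_Im.
- by move=> r; have /measurable_fun_complexP[] := measurable_radial r.
Unshelve. all: by end_near. Qed.

Lemma boundary_ext_le1 z : (forall w, enorm w < 1 -> cabs (phi w) <= 1) -> cabs (boundary_ext z) <= 1.
Proof.
move=> phi1; have [cz|nz] := pselect (radial_cauchy z); last by rewrite boundary_ext_ncauchy// cabs0.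
have [l Hl] := radial_cauchy_lim cz; have [z1 _] := cz; rewrite (boundary_ext_lim z1 Hl).
apply/ler_addgt0Pr => e e0; have [d d0 Hd] := Hl e e0.
pose r := Num.max (1 - d / 2) (1 / 2).
have r1 : r < 1 by rewrite gt_max; apply/andP; split; lra.
have rd : 1 - d < r by rewrite lt_max; apply/orP; left; lra.
have r0 : 0 < r by rewrite lt_max; apply/orP; right; lra.
have := Hd r rd r1; have := phi1 (r%:C *: z).
rewrite enorm_radial// => /(_ r1) h1 h2.
rewrite -[l](subrK (phi (r%:C *: z))) addrC; apply: le_trans (cabsD _ _) _.
by apply: lerD => //; rewrite cabsB.
Qed.

End radial_limits.

(** * Weak convergence on the sphere *)

Section slices.
Variables (R : realType) (n : nat).
Local Notation C := R[i].
Local Notation Cn := 'rV[C]_n.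
Local Notation RM := (measurableTypeR R).
Local Notation mu := (@lebesgue_measure R).
#[local] Existing Instance ae_lebesgue_filter.
Implicit Types (z : Cn) (phi : Cn -> C).

Definition turn (t : R) z : Cn := cexp (0 +i* t) *: z.

Lemma cabs_turn t : cabs (cexp (0 +i* t) : C) = 1.
Proof. by rewrite cabs_cexp /= expR0. Qed.

Lemma enorm_turn t z : enorm (turn t z) = enorm z.
Proof. by rewrite enormZ cabs_turn mul1r. Qed.

Lemma measurable_turn : measurable_fun setT (fun p : Cn * RM => turn p.2 p.1).
Proof.
apply: measurable_rowZ; last exact: measurable_fst.
have mcos : measurable_fun setT (cos : R -> R).
  by apply: continuous_measurable_fun; exact: continuous_cos.
have msin : measurable_fun setT (sin : R -> R).
  by apply: continuous_measurable_fun; exact: continuous_sin.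
apply/measurable_fun_complexP; split.
  rewrite (_ : _ \o _ = fun p : Cn * RM => cos p.2).
    exact: measurableT_comp mcos measurable_snd.
  by apply/funext => q; rewrite /= expR0 mul1r.
rewrite (_ : _ \o _ = fun p : Cn * RM => sin p.2).
  exact: measurableT_comp msin measurable_snd.
by apply/funext => q; rewrite /= expR0 mul1r.
Qed.

Lemma enorm_slice (w : C) z : enorm z = 1 -> enorm (cexp w *: z) = expR (Re w).
Proof. by move=> z1; rewrite enormZ cabs_cexp z1 mulr1. Qed.

Lemma slice_schur phi z : schur_class phi -> enorm z = 1 ->
  half_plane_schur (fun w => phi (cexp w *: z)).
Proof.
move=> /schur_classP[dphi phi1] z1; split=> w w0; have bw : enorm (cexp w *: z) < 1.
- by rewrite enorm_slice// expR_lt1.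
- exists ('d phi (0 + cexp w *: z) z * cexp w).
  have H : cderiv (fun l => phi (0 + l *: z)) (cexp w) ('d phi (0 + cexp w *: z) z).
    by apply: differentiable_cderiv; rewrite add0r; exact: dphi.
  have := @cderiv_comp R _ _ _ _ _ (cderiv_cexp w) H.
  by under eq_fun do rewrite add0r.
- by rewrite enorm_slice// expR_lt1.
- exact: phi1.
Qed.

(** With r = e^-x, the radius towards [turn t z] is the half line of points - x + it. *)
Lemma slice_radial phi z t (c : C) : enorm z = 1 ->
  radial_cvg (fun w => phi (cexp w *: z)) t c -> radial_lim phi (turn t z) c.
Proof.
move=> z1 H e e0; have [d d0 Hd] := H e e0.
exists (1 - expR (- d)); first by rewrite subr_gt0 expR_lt1// oppr_lt0.
move=> r; rewrite subKr => r1 r2.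
have r0 : 0 < r by apply: lt_trans r1; exact: expR_gt0.
have l0 : 0 < - ln r by rewrite oppr_gt0 ln_lt0// r0.
have ld : - ln r < d.
  by rewrite ltrNl -ltr_expR lnK// posrE.
have := Hd _ l0 ld; rewrite opprK /turn scalerA.
suff -> : r%:C * cexp (0 +i* t) = cexp (ln r +i* t) by [].
rewrite (_ : ln r +i* t = (ln r)%:C + (0 +i* t)); last by simpc.
by rewrite cexpD cexp_real lnK// posrE.
Qed.

Lemma slice_boundary phi z : schur_class phi -> enorm z = 1 ->
  boundary_value (fun w => phi (cexp w *: z)) (fun t => boundary_ext phi (turn t z)).
Proof.
move=> sphi z1; have [Hu u1] := slice_schur sphi z1.
have cphi := schur_ball_continuous sphi.
have /measurable_fun_complexP[mR mI] := measurable_boundary_ext cphi.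
have mt : measurable_fun setT (fun t : RM => turn t z).
  exact: measurableT_comp measurable_turn (measurable_pair1 z).
have per x : phi (cexp (x +i* (- pi)) *: z) = phi (cexp (x +i* pi) *: z) by rewrite cexp_pi.
split.
- by apply: measurable_funTS; exact: measurableT_comp mR mt.
- by apply: measurable_funTS; exact: measurableT_comp mI mt.
- move=> t; apply: boundary_ext_le1 => // w w1.
  by have /schur_classP[_] := sphi; apply.
(* Fatou's theorem was obtained on the open interval; the two end points form a null set. *)
have ends : {ae mu, forall t, t <> - pi /\ t <> pi}.
  exists [set - pi; pi]; split.
  - by apply: measurableU; exact: measurable_set1.
  - rewrite measureU0//; first exact: lebesgue_measure_set1.
    exact: lebesgue_measure_set1.
  - move=> t /= /not_andP[] /contrapT; [by left|by right].
have := half_plane_fatou Hu u1 per; move: ends; apply: filterS2 => t [t1 t2] Ht.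
rewrite /= in_itv /= => /andP[a1 a2].
have [c Hc] : exists c, radial_cvg (fun w => phi (cexp w *: z)) t c.
  apply: Ht; rewrite /= in_itv /= !lt_neqAle a1 a2 !andbT.
  by apply/andP; split; apply/eqP => // h; apply: t1.
rewrite (boundary_ext_lim _ (slice_radial z1 Hc)) ?enorm_turn//.
Qed.

End slices.

(** * From circles to the sphere *)

Section weak_limits.
Variables (R : realType) (n : nat).
Local Notation C := R[i].
Local Notation Cn := 'rV[C]_n.
Local Notation sigma := (@sphere_measure R n).
Local Notation S := (@unit_sphere R n).

HB.instance Definition _ := @Measure_isFinite.Build _ _ _ sigma
  (lty_fin_num_fun (@sphere_measure_fin R n)).

Variables (phi_ : nat -> Cn -> C) (phi : Cn -> C).
Hypothesis sphi_ : forall k, schur_class (phi_ k).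
Hypothesis sphi : schur_class phi.
Hypothesis phi_cvg : forall r : R, r < 1 -> forall e : R, 0 < e ->
  \forall k \near \oo, forall z, enorm z <= r -> cabs (phi_ k z - phi z) <= e.

Variable p : C -> R.
Hypothesis pP : real_part p.
Hypothesis pRI : (forall x, p x = Re x) \/ (forall x, p x = Im x).

(** Unlike [boundary_fun], the extension is measurable on the whole space, as the averaging over
    orbits requires, and vanishes off the sphere. *)
Let pext (f : Cn -> C) (z : Cn) := p (boundary_ext f z).

Let measurable_pext f : schur_class f -> measurable_fun setT (pext f).
Proof.
move=> /schur_ball_continuous/measurable_boundary_ext/measurable_fun_complexP[mR mI].
rewrite /pext; case: pRI => pE.
- by rewrite (_ : (fun _ => _) = @Re R \o boundary_ext f)//; apply/funext => z; rewrite pE.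
- by rewrite (_ : (fun _ => _) = @Im R \o boundary_ext f)//; apply/funext => z; rewrite pE.
Qed.

Let pext1 f z : schur_class f -> `|pext f z| <= 1.
Proof.
move=> sf; apply: le_trans (rp_le pP _) _; apply: boundary_ext_le1; last first.
  by move=> w w1; have /schur_classP[_] := sf; apply.
exact: schur_ball_continuous.
Qed.

Lemma integrable_boundary f (h : Cn -> R) : schur_class f -> sigma.-integrable S (EFin \o h) ->
  sigma.-integrable S (EFin \o (fun z => p (boundary_fun f z) * h z)).
Proof.
move=> sf ih; have mS := @measurable_unit_sphere R n.
have : sigma.-integrable S (EFin \o (fun z => pext f z * h z)).
  apply: (@bounded_mul_integrable _ _ _ _ _ _ _ 1) => //.
    by apply: measurable_funTS; exact: measurable_pext.
  by move=> z _; exact: pext1.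
apply: eq_integrable => // z; rewrite inE => z1.
by rewrite /= /pext /boundary_ext z1 eqxx.
Qed.

Lemma boundary_weak_cvg (h : Cn -> R) : sigma.-integrable S (EFin \o h) ->
  \int[sigma]_(z in S) (p (boundary_fun (phi_ k) z) * h z) @[k --> \oo] -->
  \int[sigma]_(z in S) (p (boundary_fun phi z) * h z).
Proof.
move=> ih; have mS := @measurable_unit_sphere R n.
pose y k z := pext (phi_ k) z - pext phi z.
have pl : - pi < pi :> R by rewrite gtrN// pi_gt0.
have ihS : sigma.-integrable setT (EFin \o (h \_ S)).
  by rewrite -restrict_EFin; exact: (integrable_mkcond _ mS).1 ih.
have H : \int[sigma]_z (y k z * (h \_ S) z) @[k --> \oo] --> (0 : R).
  apply: (@orbit_weak_cvg _ _ _ sigma (@turn R n) (@measurable_turn R n) _ _ _ pl _ 2) => //.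
  - by move=> t A mA; apply: sphere_measure_rotation => //; exact: cabs_turn.
  - by move=> k; apply: measurable_funB; exact: measurable_pext.
  - move=> k z; apply: le_trans (ler_normB _ _) _.
    by rewrite (_ : 2 = 1 + 1 :> R)//; apply: lerD; exact: pext1.
  (* The orbit of a point off the sphere stays off it, where both extensions are 0. *)
  move=> z h' ih'; have [z1|z1] := eqVneq (enorm z) 1; last first.
    have p0 : p 0 = 0 by rewrite -(subrr (0 : C)) (rpB pP) subrr.
    rewrite (_ : (fun k => _) = fun=> 0); first exact: cvg_cst.
    apply/funext => k; rewrite [LHS](_ : _ = \int[lebesgue_measure]_(t in `[- pi, pi]) 0); last first.
      apply: eq_Rintegral => t _.
      by rewrite /y /pext /boundary_ext enorm_turn (negbTE z1) p0 subrr mul0r.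
    by rewrite Rintegral_cst// mul0r.
  apply: (boundary_weak pP pRI (u_ := fun k w => phi_ k (cexp w *: z))
      (u := fun w => phi (cexp w *: z))) => //.
  - by move=> k; exact: slice_schur.
  - exact: slice_schur.
  - by move=> k; exact: slice_boundary.
  - exact: slice_boundary.
  - move=> w w0 e e0; have w1 : expR (Re w) < 1 by rewrite expR_lt1.
    have := phi_cvg w1 e0; apply: filterS => k; apply.
    by rewrite enorm_slice.
apply/cvgrPdist_le => e e0; have /cvgrPdist_le/(_ _ e0) := H; apply: filterS => k.
rewrite sub0r normrN distrC -RintegralB//; [|exact: integrable_boundary|exact: integrable_boundary].
rewrite [X in _ -> `|X| <= _]Rintegral_mkcond.
suff -> : (fun z => p (boundary_fun (phi_ k) z) * h z - p (boundary_fun phi z) * h z) \_ S =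
  (fun z => y k z * (h \_ S) z) by [].
apply/funext => z; rewrite !patchE; case: ifPn => [|_]; last by rewrite mulr0.
rewrite inE => z1; by rewrite /y /pext /boundary_ext z1 eqxx mulrBl.
Qed.

End weak_limits.

Lemma L1_sphere_integrable (R : realType) (n : nat) (f : 'rV[R[i]]_n -> R[i]) : L1_sphere f ->
  (@sphere_measure R n).-integrable (@unit_sphere R n) (EFin \o (fun z => Re (f z))) /\
  (@sphere_measure R n).-integrable (@unit_sphere R n) (EFin \o (fun z => Im (f z))).
Proof.
move=> [mf fi]; have mS := @measurable_unit_sphere R n.
have mc : measurable_fun (@unit_sphere R n) (fun z => cabs (f z)).
  exact: measurableT_comp (@measurable_cmod R) mf.
have ic : (@sphere_measure R n).-integrable (@unit_sphere R n) (EFin \o (fun z => cabs (f z))).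
  apply/integrableP; split; first exact/measurable_EFinP.
  move: fi; congr (_ < +oo)%E; apply: eq_integral => z _ /=.
  by rewrite ger0_norm// cabs_ge0.
split; apply: (@le_integrable _ _ _ _ _ mS _ _ _ _ ic).
- by apply/measurable_EFinP; exact: measurableT_comp (@measurable_Re R) mf.
- by move=> z _; rewrite /= lee_fin (ger0_norm (cabs_ge0 _)) normr_Re.
- by apply/measurable_EFinP; exact: measurableT_comp (@measurable_Im R) mf.
- by move=> z _; rewrite /= lee_fin (ger0_norm (cabs_ge0 _)) normr_Im.
Qed.

Lemma sphere_integral_weak_cvg (R : realType) (n : nat) (phi_ : nat -> 'rV[R[i]]_n -> R[i]) phi f :
  (forall k, schur_class (phi_ k)) -> schur_class phi ->
  (forall r : R, r < 1 -> forall e : R, 0 < e ->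
    \forall k \near \oo, forall z, enorm z <= r -> cabs (phi_ k z - phi z) <= e) ->
  L1_sphere f ->
  sphere_integral (fun zeta => boundary_fun (phi_ k) zeta * f zeta) @[k --> \oo] -->
  sphere_integral (fun zeta => boundary_fun phi zeta * f zeta).
Proof.
move=> sphi_ sphi pcvg /L1_sphere_integrable[iR iI].
have pR := real_part_Re R; have pI := real_part_Im R.
have hR : (forall x, @Re R x = Re x) \/ (forall x, @Re R x = Im x) by left.
have hI : (forall x, @Im R x = Re x) \/ (forall x, @Im R x = Im x) by right.
have mS := @measurable_unit_sphere R n.
(* The complex pairing splits into four real ones, each covered by [boundary_weak_cvg]. *)
have E psi : schur_class psi -> sphere_integral (fun z => boundary_fun psi z * f z) =
    (\int[@sphere_measure R n]_(z in @unit_sphere R n) (Re (boundary_fun psi z) * Re (f z)) -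
     \int[@sphere_measure R n]_(z in @unit_sphere R n) (Im (boundary_fun psi z) * Im (f z))) +i*
    (\int[@sphere_measure R n]_(z in @unit_sphere R n) (Re (boundary_fun psi z) * Im (f z)) +
     \int[@sphere_measure R n]_(z in @unit_sphere R n) (Im (boundary_fun psi z) * Re (f z))).
  move=> spsi; rewrite /sphere_integral -RintegralB//; last 2 first.
  - exact: integrable_boundary pR hR _ _ spsi iR.
  - exact: integrable_boundary pI hI _ _ spsi iI.
  rewrite -RintegralD//; last 2 first.
  - exact: integrable_boundary pR hR _ _ spsi iI.
  - exact: integrable_boundary pI hI _ _ spsi iR.
  by apply: complex_eq => /=; apply: eq_Rintegral => z _; rewrite ?cReM ?cImM.
under eq_fun do rewrite E//.
rewrite E//; apply/cvg_cabsP => e e0.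
have e2 : 0 < e / 2 by rewrite divr_gt0.
have c1 := boundary_weak_cvg sphi_ sphi pcvg pR hR iR.
have c2 := boundary_weak_cvg sphi_ sphi pcvg pI hI iI.
have c3 := boundary_weak_cvg sphi_ sphi pcvg pR hR iI.
have c4 := boundary_weak_cvg sphi_ sphi pcvg pI hI iR.
have cB (a b : nat -> R) x y : a k @[k --> \oo] --> x -> b k @[k --> \oo] --> y ->
    \forall k \near \oo, `|(x - y) - (a k - b k)| <= e / 2.
  move=> ax bx; have H : (a k - b k) @[k --> \oo] --> x - y by apply: cvgB.
  by move/cvgrPdist_le: H => /(_ _ e2).
have cD (a b : nat -> R) x y : a k @[k --> \oo] --> x -> b k @[k --> \oo] --> y ->
    \forall k \near \oo, `|(x + y) - (a k + b k)| <= e / 2.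
  move=> ax bx; have H : (a k + b k) @[k --> \oo] --> x + y by apply: cvgD.
  by move/cvgrPdist_le: H => /(_ _ e2).
have d1 := cB _ _ _ _ c1 c2; have d2 := cD _ _ _ _ c3 c4.
move: d1 d2; apply: filterS2 => k h1 h2.
apply: le_trans (cabs_le_ReIm _) _; rewrite cReB cImB /= (splitr e).
by apply: lerD; rewrite distrC.
Qed.

Theorem theorem2 (R : realType) (n : nat) (hn : (1 <= n)%N)
    (phi : 'rV[R[i]]_n -> R[i]) (hphi : schur_class phi) :
  exists phi_ : nat -> 'rV[R[i]]_n -> R[i],
    [/\ forall k, extremal_class (phi_ k),
        forall K : set 'rV[R[i]]_n, compact K -> K `<=` @unit_ball R n ->
          {uniform K, phi_ @ \oo --> phi}
      & forall f : 'rV[R[i]]_n -> R[i], L1_sphere f ->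
          sphere_integral (fun zeta => boundary_fun (phi_ k) zeta * f zeta)
            @[k --> \oo] -->
          sphere_integral (fun zeta => boundary_fun phi zeta * f zeta)].
Proof.
have [phi_ [ephi_ phi_cvg]] := extremal_sequence hn hphi.
exists phi_; split => // [K cK KB|f f1].
  have [r r1 Kr] := compact_ball_radius cK KB.
  apply: uniform_cabsP => e e0; have := phi_cvg r r1 e e0.
  by apply: filterS => k H z /Kr; exact: H.
by apply: sphere_integral_weak_cvg => // k; have [] := ephi_ k.
Qed.
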